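(* Let $K$ be a global function field of odd characteristic with full field of constants $\mathbb{F}_q$, and let $X$ be its set of places. Let $\mathfrak{B}=\{\mathfrak{b}_1,\dots,\mathfrak{b}_n\}\subset X$ be a finite set of places that forms a basis of $\operatorname{Pic}X/2\operatorname{Pic}X$. Consider the following procedure. 1. Initialize $\mathscr{A}:=\{\zeta\}$, where $\zeta\in\mathbb{F}_q^\times$ is a non-square constant. 2. Let $\operatorname{Pic}^0X=\langle[\mathcal{D}_1]\rangle\oplus\dots\oplus\langle[\mathcal{D}_m]\rangle$ be a Smith Normal Form presentation of $\operatorname{Pic}^0X$, for some divisors $\mathcal{D}_1,\dots,\mathcal{D}_m$. 3. Let $k\le m$ be the minimal index such that $[\mathcal{D}_k]$ has even order, or $k:=m+1$ if all the orders are odd. 4. For every $i\in\{k,\dots,m\}$: let $d$ be the order of $[\mathcal{D}_i]$ in $\operatorname{Pic}^0X$, choose a nonzero element $\alpha$ of the Riemann--Roch space $\mathcal{L}(d\cdot\mathcal{D}_i)$, and append $\alpha$ to $\mathscr{A}$. 5. Write $\mathscr{A}=\{\alpha_1,\dots,\alpha_n\}$ and for all $i,j\in\{1,\dots,n\}$ let $\varepsilon_{i,j}\in\mathbb{F}_2$ be given by $(-1)^{\varepsilon_{i,j}}=\left(\frac{\alpha_i}{\mathfrak{b}_j}\right)$. 6. Let $(e_{i,j}):=(\varepsilon_{i,j})^{-1}$ (inverse matrix over $\mathbb{F}_2$). 7. Set $\beta_i:=\alpha_1^{e_{i,1}}\cdots\alpha_n^{e_{i,n}}$ for $i\in\{1,\dots,n\}$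 and output $\mathscr{B}:=\{\beta_1,\dots,\beta_n\}$. Then the procedure is correct: all the steps can be carried out (in particular $\mathscr{A}$ has exactly $n$ elements after step 4, the symbols in step 5 are $\pm1$, and the matrix $(\varepsilon_{i,j})$ is invertible), and the output $\mathscr{B}$ is a basis over $\mathbb{F}_2$ of the group $\mathbb{E}$ of singular square classes of $K$ that is compatible with $\mathfrak{B}$.
   Context: $K$ is a global function field of odd characteristic with full constant field $\mathbb{F}_q$ ($q$ a power of an odd prime). $X$ is the set of places of $K$ (classes of discrete valuations), viewed as a smooth complete curve over $\mathbb{F}_q$. For $\mathfrak{p}\in X$, $\operatorname{ord}_\mathfrak{p}$ is the associated normalized valuation and $K_\mathfrak{p}$ the completion. $\operatorname{Pic}X$ is the group of divisor classes (divisors modulo principal divisors), $\operatorname{Pic}^0X$ its subgroup of classes of degree $0$, and $[\mathcal{D}]$ is the class of the divisor $\mathcal{D}$. The Riemann--Roch space is $\mathcal{L}(\mathcal{D})=\{\lambda\in K^\times : \operatorname{div}_X\lambda\ge-\mathcal{D}\}\cup\{0\}$. The group of singular elements modulo squares is $\mathbb{E}=\{\lambda\in K^\times/K^{\times2} : \operatorname{ord}_\mathfrak{p}\lambda\equiv0\pmod 2\text{ for all }\mathfrak{p}\in X\}$, a finite $\mathbb{F}_2$-vector space; elements of $K^\times$ are identified with their square classes where appropriate. For $\lambda\in K^\times$ (or its square class), $\left(\frac{\lambda}{\mathfrak{p}}\right)$ equals $1$ if $\lambda$ is a square in $K_\mathfrak{p}$, $0$ if $\operatorname{ord}_\mathfrak{p}\lambda$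 is odd, and $-1$ if $\operatorname{ord}_\mathfrak{p}\lambda$ is even but $\lambda$ is not a square in $K_\mathfrak{p}$. Places $\mathfrak{p}_1,\dots,\mathfrak{p}_n$ are said to be linearly independent (to form a basis) in $\operatorname{Pic}X/2\operatorname{Pic}X$ if the cosets $[\mathfrak{p}_i]+2\operatorname{Pic}X$ are linearly independent over $\mathbb{F}_2$ (form a basis). Sets $\mathfrak{B}=\{\mathfrak{b}_1,\dots,\mathfrak{b}_n\}\subset X$ and $\mathscr{B}=\{\beta_1,\dots,\beta_n\}\subset\mathbb{E}$ are compatible if $\left(\frac{\beta_i}{\mathfrak{b}_i}\right)=-1$ for all $i$ and $\left(\frac{\beta_i}{\mathfrak{b}_j}\right)=1$ for all $i\ne j$. A finite abelian group is presented in Smith Normal Form if it is given as a direct sum $C_1\oplus\dots\oplus C_m$ of cyclic groups such that the order of each $C_i$ divides the orders of its successors. *)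

(* Defs.v *)
From HB Require Import structures.
From mathcomp Require Import all_boot all_order all_algebra all_field.
From mathcomp Require Import boolp classical_sets functions.
From mathcomp.multinomials Require Import freeg.

Set Implicit Arguments.
Unset Strict Implicit.
Unset Printing Implicit Defensive.

Import Order.TTheory GRing.Theory Num.Theory.

Local Open Scope classical_set_scope.
Local Open Scope ring_scope.
Local Open Scope quotient_scope.

Section AbelianGroups.
Variable V : zmodType.

Definition has_order (x : V) (d : nat) : Prop :=
  [/\ (0 < d)%N, x *+ d = 0 & forall e, (0 < e < d)%N -> x *+ e <> 0].

Definition cyc (x : V) : set V := [set x *~ z | z in [set: int]].

Definition direct_sum_of (A : set V) (m : nat) (C : 'I_m -> set V) : Prop :=
  (forall x, A x <->
     exists2 c : 'I_m -> V, (forall i, C i (c i)) & x = \sum_i c i) /\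
  (forall c : 'I_m -> V, (forall i, C i (c i)) ->
     \sum_i c i = 0 -> forall i, c i = 0).

Definition smith_presentation (A : set V) (m : nat)
    (x : 'I_m -> V) (d : 'I_m -> nat) : Prop :=
  [/\ forall i, has_order (x i) (d i),
      direct_sum_of A (fun i => cyc (x i)) &
      forall i j : 'I_m, (i <= j)%N -> (d i %| d j)%N].

End AbelianGroups.

Definition is_basis (R : nzRingType) (V : lmodType R) (A : set V) (n : nat)
    (v : 'I_n -> V) : Prop :=
  [/\ forall i, A (v i),
      forall c : 'I_n -> R, \sum_i c i *: v i = 0 -> forall i, c i = 0 &
      forall x, A x -> exists c : 'I_n -> R, x = \sum_i c i *: v i].

(* V / 2V, with its structure of vector space over 'F_2 *)
Section Mod2.
Variable V : zmodType.

Definition doubles : {pred V} := fun x => `[< exists y : V, x = y *+ 2 >].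

Fact doubles_zmod_closed : zmod_closed doubles.
Proof.
split; first by apply/asboolP; exists 0; rewrite mul0rn.
move=> _ _ /asboolP[x ->] /asboolP[y ->].
by apply/asboolP; exists (x - y); rewrite mulrnBl.
Qed.

HB.instance Definition _ := GRing.isZmodClosed.Build V doubles
  doubles_zmod_closed.

Definition mod2 : Type := @Quotient.quot V doubles.

HB.instance Definition _ := Choice.on mod2.
HB.instance Definition _ := GRing.Zmodule.on mod2.

Definition class2 (x : V) : mod2 := \pi_(@Quotient.quot V doubles) x.

Definition mod2_scale (c : 'F_2) (x : mod2) : mod2 := x *+ c.

Fact mod2_mulr2n (x : mod2) : x *+ 2 = 0.
Proof.
rewrite -[x](@reprK _ (@Quotient.quot V doubles)); set y := repr _.
rewrite mulr2n; apply/eqP; rewrite piE Quotient.equivE subr0.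
by apply/asboolP; exists y; rewrite mulr2n.
Qed.

Fact mod2_scaleA a b x : mod2_scale a (mod2_scale b x) = mod2_scale (a * b) x.
Proof.
rewrite /mod2_scale -mulrnA.
by case: a b => [[|[|//]] ?] [[|[|//]] ?].
Qed.

Fact mod2_scale1 : left_id 1 mod2_scale.
Proof. by []. Qed.

Fact mod2_scaleDr : right_distributive mod2_scale +%R.
Proof. by move=> a x y; rewrite /mod2_scale mulrnDl. Qed.

Fact mod2_scaleDl x : {morph mod2_scale^~ x : a b / a + b}.
Proof.
rewrite /mod2_scale => a b; rewrite -mulrnDr.
case: a b => [[|[|//]] ?] [[|[|//]] ?] //=.
by rewrite mod2_mulr2n.
Qed.

HB.instance Definition _ := GRing.Zmodule_isLmodule.Build 'F_2 mod2
  mod2_scaleA mod2_scale1 mod2_scaleDr mod2_scaleDl.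

End Mod2.

(* The multiplicative group of K, written additively so that the quotient
   modulo squares is an instance of [mod2]. *)
Section MulGroup.
Variable K : fieldType.

Definition mulgroup : Type := {x : K | x != 0}.

HB.instance Definition _ := SubChoice.on mulgroup.

Implicit Types x y : mulgroup.

Definition mg_one : mulgroup := Sub 1 (oner_neq0 K).
Definition mg_inv x : mulgroup := Sub (val x)^-1 (invr_neq0 (valP x)).
Definition mg_mul x y : mulgroup :=
  Sub (val x * val y) (mulf_neq0 (valP x) (valP y)).

Fact mg_mulA : associative mg_mul.
Proof. by move=> x y z; apply: val_inj; rewrite /= mulrA. Qed.

Fact mg_mulC : commutative mg_mul.
Proof. by move=> x y; apply: val_inj; rewrite /= mulrC. Qed.

Fact mg_mul1 : left_id mg_one mg_mul.
Proof. by move=> x; apply: val_inj; rewrite /= mul1r. Qed.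

Fact mg_mulV : left_inverse mg_one mg_inv mg_mul.
Proof. by move=> x; apply: val_inj; rewrite /= mulVf ?(valP x). Qed.

HB.instance Definition _ :=
  GRing.isZmodule.Build mulgroup mg_mulA mg_mulC mg_mul1 mg_mulV.

(* K^* / K^*2 *)
Definition sqclasses : Type := mod2 mulgroup.

HB.instance Definition _ := GRing.Lmodule.on sqclasses.

(* Junk value: the class of 0 is the trivial class. *)
Definition sqclass (x : K) : sqclasses := class2 (insubd (0 : mulgroup) x).

End MulGroup.

(* Each class of discrete valuations is represented by its normalized member.
   The value at 0, morally infinite, is set to 0 so that two places are equal
   as soon as they agree on K^*. *)
Definition normalized_valuation (K : fieldType) (v : K -> int) : Prop :=
  [/\ v 0 = 0,
      forall x y, x != 0 -> y != 0 -> v (x * y) = v x + v y,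
      forall x y, x != 0 -> y != 0 -> x + y != 0 ->
        Num.min (v x) (v y) <= v (x + y) &
      exists2 x, x != 0 & v x = 1].

Record place (K : fieldType) := Place {
  ord :> K -> int;
  placeP : `[< normalized_valuation ord >]
}.

HB.instance Definition _ (K : fieldType) := [isSub for @ord K].
HB.instance Definition _ (K : fieldType) := [Choice of place K by <:].

Section Local.
Variables (K : fieldType) (P : place K).

(* ord_P x >= N, with ord_P 0 = +oo *)
Definition ord_ge (N : int) (x : K) : bool := (x == 0) || (N <= P x).

Fact placeM x y : x != 0 -> y != 0 -> P (x * y) = P x + P y.
Proof. by have /asboolP[_ + _ _] := placeP P; apply. Qed.

Fact place1 : P 1 = 0.
Proof.
have := @placeM 1 1 (oner_neq0 _) (oner_neq0 _).
by rewrite mul1r => /eqP; rewrite -subr_eq0 opprD addNKr oppr_eq0 => /eqP.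
Qed.

Fact placeN x : P (- x) = P x.
Proof.
have [->|x0] := eqVneq x 0; first by rewrite oppr0.
have N1 : (-1 : K) != 0 by rewrite oppr_eq0 oner_neq0.
rewrite -mulN1r placeM //.
have := placeM N1 N1; rewrite mulrNN mul1r place1 -mulr2n => /esym/eqP.
by rewrite mulrn_eq0 /= => /eqP ->; rewrite add0r.
Qed.

Fact ord_ge0 N : ord_ge N 0.
Proof. by rewrite /ord_ge eqxx. Qed.

Fact ord_geN N x : ord_ge N (- x) = ord_ge N x.
Proof. by rewrite /ord_ge oppr_eq0 placeN. Qed.

Fact ord_geD N x y : ord_ge N x -> ord_ge N y -> ord_ge N (x + y).
Proof.
rewrite /ord_ge; have [->|x0] := eqVneq x 0; first by rewrite add0r.
have [->|y0] := eqVneq y 0; first by rewrite addr0 (negPf x0).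
have [//|xy0 /= xN yN] := eqVneq (x + y) 0.
have /asboolP[_ _ minP _] := placeP P.
by apply: le_trans (minP _ _ x0 y0 xy0); rewrite le_min xN.
Qed.

Fact ord_geB N x y : ord_ge N x -> ord_ge N y -> ord_ge N (x - y).
Proof. by move=> xN yN; rewrite ord_geD // ord_geN. Qed.

Fact ord_geM M N x y : ord_ge M x -> ord_ge N y -> ord_ge (M + N) (x * y).
Proof.
rewrite /ord_ge mulf_eq0; have [//|x0] := eqVneq x 0.
by have [//|y0 /= xM yN] := eqVneq y 0; rewrite placeM // lerD.
Qed.

Fact ord_geW M N x : M <= N -> ord_ge N x -> ord_ge M x.
Proof. by rewrite /ord_ge => MN /orP[->//|/(le_trans MN)->]; rewrite orbT. Qed.

Definition in_valring : {pred K} := ord_ge 0.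

Fact in_valring_closed : subring_closed in_valring.
Proof.
split; first by rewrite unfold_in /ord_ge place1 lexx orbT.
- by move=> x y; apply: ord_geB.
- by move=> x y xO yO; have := ord_geM xO yO; rewrite addr0.
Qed.

HB.instance Definition _ := GRing.isSubringClosed.Build K in_valring
  in_valring_closed.

Definition valring : Type := {x : K | x \in in_valring}.

HB.instance Definition _ := SubChoice.on valring.
HB.instance Definition _ := [SubChoice_isSubComNzRing of valring by <:].

Definition in_maxideal : {pred valring} := fun x => ord_ge 1 (val x).

Fact in_maxideal_closed : idealr_closed in_maxideal.
Proof.
split; first exact: ord_ge0.
- by rewrite unfold_in /ord_ge /= place1 oner_eq0.
- move=> a x y xm ym; apply: ord_geD => //=.
  by have := ord_geM (valP a) xm; rewrite add0r.
Qed.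

HB.instance Definition _ := isIdealr.Build valring in_maxideal
  in_maxideal_closed.

Definition residue : Type := {ideal_quot in_maxideal}.

HB.instance Definition _ := GRing.ComNzRing.on residue.

Definition null (u : nat -> K) : Prop :=
  forall N : int, exists n0, forall n, (n0 <= n)%N -> ord_ge N (u n).

Definition cauchy (u : nat -> K) : Prop :=
  forall N : int, exists n0, forall m n, (n0 <= m)%N -> (n0 <= n)%N ->
    ord_ge N (u m - u n).

Definition in_cauchy : {pred nat -> K} := fun u => `[< cauchy u >].

Fact cauchy_bounded u : cauchy u ->
  exists B n0, forall n, (n0 <= n)%N -> ord_ge B (u n).
Proof.
move=> /(_ 0)[n0 un0]; exists (Num.min 0 (P (u n0))), n0 => n n0n.
rewrite -[u n](subrK (u n0)); apply: ord_geD.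
  by apply: ord_geW (un0 _ _ n0n (leqnn _)); rewrite ge_min lexx.
by rewrite /ord_ge ge_min lexx !orbT.
Qed.

Fact in_cauchy_closed : subring_closed in_cauchy.
Proof.
split.
- by apply/asboolP => N; exists 0%N => m n _ _; rewrite subrr ord_ge0.
- move=> u v /asboolP uC /asboolP vC; apply/asboolP => N.
  have [n0 un0] := uC N; have [n1 vn1] := vC N; exists (maxn n0 n1) => m n.
  rewrite !geq_max => /andP[n0m n1m] /andP[n0n n1n].
  rewrite [X in ord_ge _ X](_ : _ = (u m - u n) - (v m - v n)).
    by rewrite ord_geB ?un0 ?vn1.
  by rewrite !fctE !opprD !opprK addrACA.
- move=> u v /asboolP uC /asboolP vC; apply/asboolP => N.
  have [B [n0 uB]] := cauchy_bounded uC; have [C [n1 vC']] := cauchy_bounded vC.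
  have [n2 un2] := uC (N - C); have [n3 vn3] := vC (N - B).
  exists (maxn (maxn n0 n1) (maxn n2 n3)) => m n.
  rewrite !geq_max => /andP[/andP[a b] /andP[c d]] /andP[/andP[e f] /andP[g h]].
  rewrite [X in ord_ge _ X](_ : _ = (u m - u n) * v m + u n * (v m - v n)).
    apply: ord_geD; first by have := ord_geM (un2 _ _ c g) (vC' _ b); rewrite subrK.
    by have := ord_geM (uB _ e) (vn3 _ _ d h); rewrite addrC subrK.
  by rewrite !fctE mulrBl mulrBr addrA subrK.
Qed.

HB.instance Definition _ := GRing.isSubringClosed.Build (nat -> K) in_cauchy
  in_cauchy_closed.

Definition cauchyring : Type := {u : nat -> K | u \in in_cauchy}.

HB.instance Definition _ := SubChoice.on cauchyring.
HB.instance Definition _ := [SubChoice_isSubComNzRing of cauchyring by <:].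

Definition in_null : {pred cauchyring} := fun u => `[< null (val u) >].

Fact in_null_closed : idealr_closed in_null.
Proof.
split.
- by apply/asboolP => N; exists 0%N => n _; apply: ord_ge0.
- apply/asboolP => /(_ 1)[n0 /(_ n0 (leqnn _))].
  by rewrite /ord_ge /= place1 oner_eq0.
- move=> a u v /asboolP u0 /asboolP v0; apply/asboolP => N.
  have /asboolP/cauchy_bounded[B [n0 aB]] := valP a.
  have [n1 un1] := u0 (N - B); have [n2 vn2] := v0 N.
  exists (maxn n0 (maxn n1 n2)) => n; rewrite !geq_max => /and3P[a0 a1 a2].
  apply: ord_geD; last exact: vn2.
  by have := ord_geM (aB _ a0) (un1 _ a1); rewrite addrC subrK.
Qed.

HB.instance Definition _ := isIdealr.Build cauchyring in_null in_null_closed.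

(* K_P: Cauchy sequences modulo null sequences. *)
Definition completion : Type := {ideal_quot in_null}.

HB.instance Definition _ := GRing.ComNzRing.on completion.

Fact cst_in_cauchy (x : K) : (fun _ : nat => x) \in in_cauchy.
Proof. by apply/asboolP => N; exists 0%N => m n _ _; rewrite subrr ord_ge0. Qed.

Definition to_completion (x : K) : completion :=
  \pi_({ideal_quot in_null}) (Sub (fun _ => x) (cst_in_cauchy x) : cauchyring).

(* The symbol (x / P), meaningful for x != 0. *)
Definition symbol (x : K) : int :=
  if `[< exists y : completion, y ^+ 2 = to_completion x >] then 1
  else if (2 %| P x)%Z then -1 else 0.

End Local.

Section Divisors.
Variable K : fieldType.

Definition divisor : Type := {freeg (place K) / int}.

HB.instance Definition _ := GRing.Zmodule.on divisor.

Definition is_div (x : K) (D : divisor) : Prop :=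
  x != 0 /\ forall P : place K, coeff P D = P x.

Definition principal : {pred divisor} := fun D => `[< exists x, is_div x D >].

Fact principal_zmod_closed : zmod_closed principal.
Proof.
split.
  by apply/asboolP; exists 1; split=> [|P]; rewrite ?oner_neq0 // place1 coeff0.
move=> D E /asboolP[x [x0 xD]] /asboolP[y [y0 yE]]; apply/asboolP.
exists (x / y); split=> [|P]; first by rewrite mulf_neq0 ?invr_eq0.
rewrite coeffB xD yE; apply/eqP; rewrite subr_eq -placeM ?mulf_neq0 ?invr_eq0 //.
by rewrite divfK.
Qed.

HB.instance Definition _ := GRing.isZmodClosed.Build divisor principal
  principal_zmod_closed.

Definition Pic : Type := @Quotient.quot divisor principal.

HB.instance Definition _ := Choice.on Pic.
HB.instance Definition _ := GRing.Zmodule.on Pic.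

Definition divclass (D : divisor) : Pic :=
  \pi_(@Quotient.quot divisor principal) D.

Definition RR_space (D : divisor) : set K :=
  [set x | (x != 0 /\ forall P : place K, - coeff P D <= P x) \/ x = 0].

(* The group of singular elements modulo squares. *)
Definition singular_classes : set (sqclasses K) :=
  [set sqclass x | x in
    [set x : K | x != 0 /\ forall P : place K, (2 %| P x)%Z]].

Definition compatible (n : nat) (b : 'I_n -> place K) (beta : 'I_n -> K) : Prop :=
  [/\ forall i, singular_classes (sqclass (beta i)),
      forall i, symbol (b i) (beta i) = -1 &
      forall i j, i != j -> symbol (b j) (beta i) = 1].

End Divisors.

(* A global function field with field of constants F, presented as a finite
   extension of some F(t). *)
Section FunctionField.
Variables (F : finFieldType) (K : fieldExtType {fraction {poly F}}).

Definition constK : F -> K := in_alg K \o @tofrac {poly F} \o polyC.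

HB.instance Definition _ := GRing.RMorphism.copy constK
  (in_alg K \o @tofrac {poly F} \o polyC).

Definition full_constant_field : Prop :=
  forall x : K, algebraicOver constK x -> exists c : F, x = constK c.

Section Residue.
Variable P : place K.

Fact constK_in_valring c : constK c \in in_valring P.
Proof.
have [->|c0] := eqVneq c 0; first by rewrite rmorph0 rpred0.
have k0 : constK c != 0 by rewrite fmorph_eq0.
have kX n : P (constK c ^+ n) = P (constK c) *+ n.
  elim: n => [|n IHn]; first by rewrite expr0 place1.
  by rewrite exprS placeM ?expf_neq0 // IHn mulrS.
have := kX #|F|; rewrite -rmorphXn expf_card.
case: #|F| (finNzRing_gt1 F) => [//|[//|q]] _.
rewrite [RHS]mulrS => /eqP; rewrite -subr_eq0 opprD addNKr oppr_eq0.
by rewrite mulrn_eq0 /= unfold_in /ord_ge => /eqP ->; rewrite lexx orbT.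
Qed.

Definition valring_const (c : F) : valring P :=
  Sub (constK c) (constK_in_valring c).

(* An alias of the residue field carrying its structure of vector space over
   the constants. *)
Definition residue_over : Type := residue P.

HB.instance Definition _ := GRing.ComNzRing.on residue_over.

Definition residue_const (c : F) : residue_over :=
  \pi_({ideal_quot (in_maxideal (P := P))}) (valring_const c).

Fact residue_const_zmod : zmod_morphism residue_const.
Proof.
move=> a b; rewrite /residue_const -[RHS]raddfB; congr (\pi_ _ _).
by apply: val_inj; rewrite /= rmorphB.
Qed.

Fact residue_const_monoid : monoid_morphism residue_const.
Proof.
split.
  rewrite /residue_const.
  rewrite -[RHS](rmorph1 (\pi_({ideal_quot (in_maxideal (P := P))}))).
  by congr (\pi_ _ _); apply: val_inj; rewrite /= rmorph1.
move=> a b; rewrite /residue_const -[RHS]rmorphM; congr (\pi_ _ _).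
by apply: val_inj; rewrite /= rmorphM.
Qed.

HB.instance Definition _ := GRing.isZmodMorphism.Build F residue_over
  residue_const residue_const_zmod.
HB.instance Definition _ := GRing.isMonoidMorphism.Build F residue_over
  residue_const residue_const_monoid.

Definition residue_scale (c : F) (x : residue_over) : residue_over :=
  residue_const c * x.

Fact residue_scaleA a b x :
  residue_scale a (residue_scale b x) = residue_scale (a * b) x.
Proof. by rewrite /residue_scale rmorphM mulrA. Qed.

Fact residue_scale1 : left_id 1 residue_scale.
Proof. by move=> x; rewrite /residue_scale rmorph1 mul1r. Qed.

Fact residue_scaleDr : right_distributive residue_scale +%R.
Proof. by move=> a x y; rewrite /residue_scale mulrDr. Qed.

Fact residue_scaleDl x : {morph residue_scale^~ x : a b / a + b}.
Proof. by move=> a b; rewrite /residue_scale rmorphD mulrDl. Qed.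

HB.instance Definition _ := GRing.Zmodule_isLmodule.Build F residue_over
  residue_scaleA residue_scale1 residue_scaleDr residue_scaleDl.

(* [k_P : F]; the default value 0 is never reached on a function field. *)
Definition place_deg : nat :=
  xget 0%N [set n | exists v : 'I_n -> residue_over,
                      is_basis [set: residue_over] v].

End Residue.

Definition div_deg (D : divisor K) : int :=
  fglift (fun P : place K => (place_deg P)%:Z : int^o) D.

Definition Pic0 : set (Pic K) :=
  [set divclass D | D in [set D | div_deg D = 0]].

End FunctionField.

(* Main.v *)
Require Import Defs.
From HB Require Import structures.
From mathcomp Require Import all_boot all_order all_fingroup all_solvable all_algebra all_field.
From mathcomp Require Import generic_quotient.
From mathcomp Require Import boolp classical_sets functions.
From mathcomp.multinomials Require Import freeg.
From mathcomp Require Import zify ring.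

Set Implicit Arguments.
Unset Strict Implicit.
Unset Printing Implicit Defensive.

Import Order.TTheory GRing.Theory Num.Theory.

Local Open Scope classical_set_scope.
Local Open Scope ring_scope.
Local Open Scope quotient_scope.

(** Two counts give the size of the output: the classes of even order in a Smith
    presentation of Pic^0, together with a divisor of minimal positive degree,
    form a basis of Pic / 2 Pic, and the functions alpha_i, with div alpha_i =
    - d_i D_i, together with zeta form a basis of the singular classes.

    The matrix of symbols is invertible because a singular la which is a square
    at every b_j is a square.  Otherwise L = K(sqrt la) is unramified over K and
    every b_j splits in L, so that, the b_j spanning Pic K / 2 Pic K, every
    divisor coming from K is a norm C + sigma C up to a principal divisor of K.
    As sigma acts on Pic L preserving degrees and Pic^0 L is finite, counting
    kernels and images of 1 - sigma and 1 + sigma shows that some invariant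
    class of Pic L is not a norm and, when the invariant classes that are not
    norms are congruent modulo norms, that ker (1 + sigma) = im (1 - sigma).
    By Hilbert 90 an invariant class is a norm as soon as a certain constant of
    K attached to it is a norm from L.  If la is a constant times a square, every
    constant is such a norm, against the first fact; otherwise the second one,
    applied to a class C with C + sigma C = div (sqrt la / x), shows that la is
    after all a constant times a square.

    The function field theory needed on the way (places above a given one,
    deg div x = 0, finiteness of Pic^0) is obtained by counting residues in
    finite quotients. *)

(** * Counting in quotients of abelian groups *)

(** That a singular element which is a square at a generating set of places is globally a square is
    usually read off from class field theory. Only one quadratic extension occurs here, so the
    Herbrand quotient of a finite group with an involution suffices. Pic L itself is infinite, so
    the quotient is taken in degree 0, and a class of minimal positive degree accounts for the rest.
    Sizes of quotients over a finite constant field replace dimensions, and they enter as separate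
    lower and upper bounds, so the Riemann inequality is enough. A function field is given by an
    element [s] over whose rational functions it is finite. This datum is stable under [s -> s^-1],
    so places at infinity need no theory of their own. The theory has to cover L as well as K, and
    the constants of L may be larger than those of K; this happens exactly when [la] is a constant
    times a square. Degrees are therefore relative to [F] in both fields, while fullness of the
    constants is a separate hypothesis, made on K only. *)

Section Index.
Variable V : zmodType.
Implicit Types A B C : set V.

Definition is_subgroup A := A 0 /\ forall x y, A x -> A y -> A (x - y).

Lemma subgroupN A x : is_subgroup A -> A x -> A (- x).
Proof. by case=> A0 AB Ax; rewrite -[- x]add0r; apply: AB. Qed.

Lemma subgroupD A x y : is_subgroup A -> A x -> A y -> A (x + y).
Proof.
by move=> sA Ax Ay; rewrite -[y]opprK; apply: sA.2 => //; apply: subgroupN.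
Qed.

Lemma subgroup_set0 : is_subgroup [set 0 : V].
Proof. by split=> // x y /= -> ->; rewrite subr0. Qed.

(** One-sided bounds on the number of classes of [A] modulo [B]. They ask neither that the index be
    finite nor that [B] lie in [A], and the representatives in [index_le] may lie outside [A]. So
    the two bounds can come from unrelated arguments and meet in [index_ge_le]. *)
Definition index_ge A B (c : nat) : Prop :=
  exists s : seq V, [/\ size s = c, uniq s, forall x, x \in s -> A x &
    forall x y, x \in s -> y \in s -> B (x - y) -> x = y].

Definition index_le A B (c : nat) : Prop :=
  exists s : seq V, (size s <= c)%N /\
    forall x, A x -> exists2 y, y \in s & B (x - y).

Lemma index_geW A A' B B' c : A `<=` A' -> B' `<=` B ->
  index_ge A B c -> index_ge A' B' c.
Proof.
move=> AA BB [s [ss us sA sB]]; exists s; split=> //.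
  by move=> x /sA/AA.
by move=> x y xs ys /BB; apply: sB.
Qed.

Lemma index_gew A B c c' : (c' <= c)%N -> index_ge A B c -> index_ge A B c'.
Proof.
move=> cc [s [ss us sA sB]]; exists (take c' s); split.
- by rewrite size_take ss; case: ltngtP cc.
- exact: take_uniq.
- by move=> x /mem_take/sA.
- by move=> x y /mem_take xs /mem_take ys; apply: sB.
Qed.

Lemma index_cover A B c : index_le A B c ->
  exists (f : V -> V) (r : seq V), (size r <= c)%N /\
    forall x, A x -> f x \in r /\ B (x - f x).
Proof.
move=> [r [rc rP]].
have [f fP] : {f : V -> V & forall x, A x -> f x \in r /\ B (x - f x)}.
  apply: (@boolp.choice _ _ (fun x y => A x -> y \in r /\ B (x - y))) => x.
  have [Ax|nAx] := pselect (A x); last by exists 0.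
  by have [y yr Bxy] := rP x Ax; exists y.
by exists f, r.
Qed.

Lemma index_ge_le A B m c : is_subgroup B ->
  index_ge A B m -> index_le A B c -> (m <= c)%N.
Proof.
move=> sB [s [<- us sA sBP]] /index_cover[f [r [rc fP]]].
apply: leq_trans rc; rewrite -(size_map f s); apply: uniq_leq_size.
  rewrite map_inj_in_uniq // => x y xs ys fxy; apply: sBP => //.
  have [_ Bx] := fP _ (sA _ xs); have [_ By] := fP _ (sA _ ys).
  by have := sB.2 _ _ Bx By; rewrite fxy opprB addrA subrK.
by move=> _ /mapP[x xs ->]; have [] := fP _ (sA _ xs).
Qed.

Lemma index_ge_trans A B C m k : is_subgroup A -> is_subgroup B ->
  is_subgroup C -> B `<=` A -> C `<=` B ->
  index_ge A B m -> index_ge B C k -> index_ge A C (m * k).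
Proof.
move=> sA sB sC BA CB [s [<- us sAP sBP]] [r [<- ur rB rC]].
have inj x x' y y' : x \in s -> x' \in s -> y \in r -> y' \in r ->
    C (x + y - (x' + y')) -> x = x' /\ y = y'.
  move=> xs x's yr y'r; rewrite opprD addrACA => Cxy.
  have xx' : x = x'.
    apply: sBP => //; rewrite -[x - x'](addrK (y - y')).
    by apply: sB.2; [exact: CB|apply: sB.2; exact: rB].
  by split=> //; apply: rC => //; move: Cxy; rewrite xx' subrr add0r.
exists [seq x + y | x <- s, y <- r]; split.
- by rewrite size_allpairs.
- apply: allpairs_uniq => // -[x y] [x' y'] /= /allpairsP[[a b] /= [ha hb [-> ->]]].
  move=> /allpairsP[[a' b'] /= [ha' hb' [-> ->]]] e.
  by have [|-> ->//] := @inj a a' b b' ha ha' hb hb'; rewrite e subrr; exact: sC.1.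
- by move=> _ /allpairsP[[a b] /= [/sAP Aa /rB/BA Ab ->]]; apply: subgroupD.
- move=> _ _ /allpairsP[[a b] /= [ha hb ->]] /allpairsP[[a' b'] /= [ha' hb' ->]].
  by move=> /inj[] // -> ->.
Qed.

Lemma pigeonhole (T : eqType) (U : eqType) (f : T -> U) (s : seq T) (r : seq U) :
  (forall x, x \in s -> f x \in r) -> s != [::] ->
  exists2 y, y \in r & (size s <= size r * count (fun x => f x == y) s)%N.
Proof.
move=> fr s0; apply/hasP; apply: contraT => /hasPn h.
have h1 : (\sum_(y <- r) (size r * count (fun x => (f x == y)) s).+1
    <= \sum_(y <- r) size s)%N.
  by rewrite !big_seq leq_sum // => y /h; rewrite -ltnNge.
have r0 : (0 < size r)%N.
  by case: (s) s0 fr => // x s' _ /(_ x (mem_head _ _)); case: (r).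
have h2 : (size s <= \sum_(y <- r) count (fun x => (f x == y)) s)%N.
  under eq_bigr do rewrite -sum1_count big_mkcond.
  rewrite exchange_big -{1}sum1_size !big_seq leq_sum // => x /fr fx.
  by rewrite (big_rem (f x)) //= eqxx leq_addr.
move: h1; rewrite big_const_seq count_predT iter_addn addn0.
under eq_bigr do rewrite -addn1.
rewrite big_split /= -big_distrr /= sum1_size => h1.
by move: h2 r0; set S := (\sum_(y <- r) _)%N in h1 *; nia.
Qed.

(** A most populated coset of [B], translated to the origin by one of its elements, provides the
    classes of [B] modulo [C]. This is how a lower bound for a large Riemann-Roch space passes to a
    smaller one. *)
Lemma index_ge_split A B C m c : is_subgroup B -> C `<=` B ->
  index_ge A C m -> index_le A B c ->
  exists2 k, (m <= c * k)%N & index_ge B C k.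
Proof.
move=> sB CB [s [<- us sA sC]] /index_cover[f [r [rc fP]]].
have [->|s0] := eqVneq s [::]; first by exists 0%N => //; exists [::].
have [y yr ys] := @pigeonhole _ _ f s r (fun x xs => (fP x (sA x xs)).1) s0.
exists (count (fun x => f x == y) s).
  by apply: leq_trans ys _; rewrite leq_mul2r rc orbT.
pose s' := [seq x <- s | f x == y].
have s'P x : x \in s' -> B (x - y) /\ x \in s.
  by rewrite mem_filter => /andP[/eqP <- xs]; split=> //; apply: (fP _ _).2; apply: sA.
have [es|[x0 x0s]] : s' = [::] \/ exists x0, x0 \in s'.
- by case: (s') => [|x0 ?]; [left|right; exists x0; rewrite mem_head].
- by exists [::]; split=> //; rewrite -size_filter -/s' es.
exists [seq x - x0 | x <- s']; split.
- by rewrite size_map size_filter.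
- by rewrite map_inj_uniq ?filter_uniq //; apply: addIr.
- move=> _ /mapP[x /s'P[Bx _] ->]; have [B0 _] := s'P _ x0s.
  by have := sB.2 _ _ Bx B0; rewrite opprB addrA subrK.
- move=> _ _ /mapP[x /s'P[_ xs] ->] /mapP[x' /s'P[_ xs'] ->].
  by rewrite opprB addrA subrK => /sC ->.
Qed.

Lemma index_le_trans A B C m k :
  index_le A B m -> index_le B C k -> index_le A C (m * k).
Proof.
move=> [s [sm sP]] [r [rk rP]]; exists [seq x + y | x <- s, y <- r]; split.
  by rewrite size_allpairs leq_mul.
move=> x /sP[y ys /rP[z zr Cz]]; exists (y + z); first exact: allpairs_f.
by rewrite opprD addrA.
Qed.

End Index.

(** * Places and weak approximation *)

Section PlaceTheory.
Variable K : fieldType.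
Implicit Types (P Q : place K) (x y z : K).

Lemma placeD P x y : x != 0 -> y != 0 -> x + y != 0 ->
  Num.min (P x) (P y) <= P (x + y).
Proof. by have /asboolP[_ _ + _] := placeP P; apply. Qed.

Lemma place_uniformizer P : exists2 x, x != 0 & P x = 1.
Proof. by have /asboolP[] := placeP P. Qed.

Lemma place0 P : P 0 = 0.
Proof. by have /asboolP[] := placeP P. Qed.

Lemma placeV P x : P x^-1 = - P x.
Proof.
have [->|x0] := eqVneq x 0; first by rewrite invr0 place0.
apply/eqP; rewrite -addr_eq0 -placeM ?invr_eq0 // mulVf //.
by rewrite place1.
Qed.

Lemma place_div P x y : x != 0 -> y != 0 -> P (x / y) = P x - P y.
Proof. by move=> x0 y0; rewrite placeM ?invr_eq0 // placeV. Qed.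

Lemma placeX P x n : P (x ^+ n) = P x *+ n.
Proof.
have [->|x0] := eqVneq x 0.
  by rewrite expr0n place0 mul0rn; case: n => [|n]; rewrite ?place1 ?place0.
by elim: n => [|n IH]; rewrite ?expr0 ?place1 // exprS placeM ?expf_neq0 // IH mulrS.
Qed.

Lemma placeXz P x (n : int) : P (x ^ n) = P x * n.
Proof.
rewrite -mulrzz; case: n => n; rewrite ?NegzE -?exprnN ?placeV placeX ?mulrNz //.
Qed.

Lemma ord_geE P N x : x != 0 -> ord_ge P N x = (N <= P x).
Proof. by move=> x0; rewrite /ord_ge (negPf x0). Qed.

Lemma ord_ge_sum P N (I : Type) (r : seq I) (p : pred I) (F : I -> K) :
  (forall i, p i -> ord_ge P N (F i)) -> ord_ge P N (\sum_(i <- r | p i) F i).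
Proof. by move=> h; elim/big_rec: _ => [|i x pi hx]; rewrite ?ord_ge0 ?ord_geD ?h. Qed.

Lemma ord_ge_subgroup P N : is_subgroup [set x | ord_ge P N x].
Proof. by split=> [|x y]; [exact: ord_ge0|exact: ord_geB]. Qed.

Lemma placeDl P x y : x != 0 -> ord_ge P (P x + 1) y ->
  x + y != 0 /\ P (x + y) = P x.
Proof.
move=> x0 hy; have hyx : ~ ord_ge P (P x + 1) x by rewrite ord_geE //; lia.
have xy0 : x + y != 0.
  apply/eqP => /eqP; rewrite addr_eq0 => /eqP e; apply: hyx.
  by rewrite e -ord_geN opprK -e.
split=> //; apply/eqP; rewrite eq_le; apply/andP; split.
  rewrite leNgt; apply/negP => lt; apply: hyx.
  by rewrite -[X in ord_ge _ _ X](addrK y); apply: ord_geB => //; rewrite ord_geE // lezD1.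
rewrite -(ord_geE _ _ xy0); apply: ord_geD; first by rewrite ord_geE.
by apply: ord_geW hy; lia.
Qed.

Lemma place1Dneg P z : P z < 0 -> 1 + z != 0 /\ P (1 + z) = P z.
Proof.
move=> z0; have zn : z != 0 by apply: contraTneq z0 => ->; rewrite place0.
rewrite addrC; apply: placeDl => //; rewrite ord_geE ?oner_neq0 ?place1 //.
by lia.
Qed.

Lemma place1Dpos P z : ord_ge P 1 z -> 1 + z != 0 /\ P (1 + z) = 0.
Proof.
move=> hz; rewrite -[RHS](place1 P); apply: placeDl; rewrite ?oner_neq0 //.
by rewrite place1 add0r.
Qed.

Lemma place_ext P Q : (forall x, x != 0 -> P x = Q x) -> P = Q.
Proof.
move=> h; apply: val_inj; apply: funext => x /=.
by have [->|/h //] := eqVneq x 0; rewrite !place0.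
Qed.

(** A discrete valuation ring is maximal among proper subrings: units at [P] are units at [Q], so
    [Q] is the multiple [Q p] of [P], and normalization of [Q] makes this factor divide 1. *)
Lemma place_le_eq P Q :
  (forall x, x != 0 -> 0 <= P x -> 0 <= Q x) -> P = Q.
Proof.
move=> h; have [p p0 Pp] := place_uniformizer P.
have hu x : x != 0 -> P x = 0 -> Q x = 0.
  move=> x0 Px; have := h x x0; have := h x^-1; rewrite !placeV invr_eq0 Px oppr0.
  by move=> /(_ x0 (lexx _)) ? /(_ (lexx _)) ?; lia.
have hQ x : x != 0 -> Q x = Q p * P x.
  move=> x0; have := hu (x / p ^ P x); rewrite !place_div ?expfz_neq0 //.
  rewrite !placeXz Pp mul1r mulf_neq0 ?invr_eq0 ?expfz_neq0 // => H.
  by have := H isT; rewrite subrr => /(_ erefl)/eqP; rewrite subr_eq0 => /eqP.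
have Qp : 0 <= Q p by apply: h; rewrite ?Pp.
have [y y0 Qy] := place_uniformizer Q.
have Qp1 : Q p = 1.
  move: (hQ y y0); rewrite Qy => e.
  have : (Q p %| 1)%Z by apply/dvdzP; exists (P y); rewrite mulrC.
  by rewrite dvdz1; lia.
by apply: place_ext => x x0; rewrite (hQ x x0) Qp1 mul1r.
Qed.

Lemma place_sep P Q : P != Q -> exists z, [/\ z != 0, P z < 0 & 0 < Q z].
Proof.
have half P' Q' : P' != Q' -> exists x, [/\ x != 0, 0 <= P' x & Q' x < 0].
  move=> PQ; apply: contrapT => h; move/eqP: PQ; apply; apply: place_le_eq.
  by move=> x x0 Px; rewrite leNgt; apply/negP => Qx; apply: h; exists x.
move=> PQ; have [x [x0 Px Qx]] := half _ _ PQ; rewrite eq_sym in PQ.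
have [y [y0 Qy Py]] := half _ _ PQ; exists (y / x).
by rewrite mulf_neq0 ?invr_eq0 // !place_div //; split=> //; lia.
Qed.

Lemma place_sep_seq P (S : seq (place K)) : P \notin S ->
  exists z, [/\ z != 0, P z < 0 & forall Q, Q \in S -> 0 < Q z].
Proof.
elim: S => [_|Q S IH].
  have [p p0 Pp] := place_uniformizer P; exists p^-1.
  by rewrite placeV Pp invr_eq0.
rewrite in_cons negb_or => /andP[PQ /IH[z [z0 Pz Sz]]].
have [y [y0 Py Qy]] := place_sep PQ.
(* [z ^+ k] must outweigh every pole of [y] at the places of [S]. *)
pose k := (\sum_(R <- S) `|R y|%N).+1.
have hk R : R \in S -> 0 < R z *+ k + R y.
  move=> RS; have : (`|R y| <= \sum_(R <- S) `|R y|)%N.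
    by rewrite (big_rem R) //= leq_addr.
  move: (Sz R RS); rewrite /k; set s := (\sum_(_ <- _) _)%N => Rz hs.
  have : (s.+1%:Z <= R z *+ s.+1).
    rewrite -mulr_natr -[X in X <= _]mul1r; apply: ler_pM => //; lia.
  by lia.
have [Qz|Qz] := lerP 0 (Q z).
  exists (z ^+ k * y); split; first by rewrite mulf_neq0 ?expf_neq0.
    rewrite placeM ?expf_neq0 // placeX /k; have := mulrn_wlt0 k Pz; rewrite /k /=; lia.
  move=> R; rewrite in_cons placeM ?expf_neq0 // placeX => /orP[/eqP ->|/hk//].
  by have := mulrn_wge0 k Qz; lia.
(* Here [z] has a pole at [Q] too, so [z ^+ k / (1 + z ^+ k)] is a unit at [P] and [Q] while it
   keeps the zeros of [z ^+ k] on [S]; the signs at [P] and [Q] are then those of [y]. *)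
have zk (R : place K) : R z < 0 -> R (z ^+ k) < 0 by move=> Rz; rewrite placeX mulrn_wlt0.
have [n0 Pk] := place1Dneg (zk _ Pz); have [_ Qk] := place1Dneg (zk _ Qz).
have z1 : z ^+ k != 0 by rewrite expf_neq0.
exists (z ^+ k * y / (1 + z ^+ k)); split.
- by rewrite !mulf_neq0 ?invr_eq0.
- by rewrite place_div ?mulf_neq0 // Pk placeM //; lia.
- move=> R; rewrite in_cons place_div ?mulf_neq0 // placeM // => /orP[/eqP ->|RS].
    by rewrite Qk; lia.
  have [_ ->] : 1 + z ^+ k != 0 /\ R (1 + z ^+ k) = 0.
    apply: place1Dpos; rewrite ord_geE // placeX.
    by have := pmulrn_lgt0 (R z) (ltn0Sn k.-1); rewrite Sz // => /= ?; rewrite /k /= in *; lia.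
  by rewrite placeX subr0; apply: hk.
Qed.

(** With [z] separating [P] from [S], the quotient [z ^+ N.+1 / (1 + z ^+ N.+1)] is close to 1 at
    the poles of [z] and close to 0 at its zeros. *)
Lemma weak_approx P (S : seq (place K)) (N : nat) : P \notin S ->
  exists e, ord_ge P N (e - 1) /\ forall Q, Q \in S -> ord_ge Q N e.
Proof.
move=> /place_sep_seq[z [z0 Pz Sz]].
have z1 : z ^+ N.+1 != 0 by rewrite expf_neq0.
have Pk : P (z ^+ N.+1) <= - (N.+1)%:Z.
  rewrite placeX -mulr_natr; have : (P z + 1) * N.+1%:R <= 0.
    by apply: mulr_le0_ge0 => //; lia.
  lia.
have [|n0 Pk1] := @place1Dneg P (z ^+ N.+1); first by lia.
exists (z ^+ N.+1 / (1 + z ^+ N.+1)); split.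
  have -> : z ^+ N.+1 / (1 + z ^+ N.+1) - 1 = - (1 + z ^+ N.+1)^-1.
    by field.
  by rewrite ord_geN ord_geE ?invr_eq0 // placeV Pk1; lia.
move=> Q /Sz Qz; have Qk : (N.+1)%:Z <= Q (z ^+ N.+1).
  by rewrite placeX -mulr_natr -[X in X <= _]mul1r; apply: ler_pM => //; lia.
have [|_ Qk1] := @place1Dpos Q (z ^+ N.+1); first by rewrite ord_geE //; lia.
by rewrite ord_geE ?mulf_neq0 ?invr_eq0 // place_div // Qk1; lia.
Qed.

End PlaceTheory.

(** * Clearing denominators; fields finite over rational functions *)

Lemma fraction_quot (R : idomainType) (z : {fraction R}) :
  exists n d : R, d != 0 /\ tofrac d * z = tofrac n.
Proof.
elim/quotW: z => x; exists (frac x).1, (frac x).2; split; first exact: denom_ratioP.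
unlock FracField.tofrac; rewrite -[LHS]FracField.pi_mul.
apply/eqmodP; rewrite /= FracField.equivfE /FracField.mulf.
by rewrite !numden_Ratio ?mul1r ?mulr1 ?oner_neq0 //= ?denom_ratioP.
Qed.

Lemma fraction_common_denom (R : idomainType) (n : nat) (z : 'I_n -> {fraction R}) :
  exists (g : R) (c : 'I_n -> R), g != 0 /\ forall i, tofrac g * z i = tofrac (c i).
Proof.
have /boolp.choice[nd ndP] : forall i, exists p : R * R,
    p.2 != 0 /\ tofrac p.2 * z i = tofrac p.1.
  by move=> i; have [a [d h]] := fraction_quot (z i); exists (a, d).
exists (\prod_i (nd i).2), (fun i => (nd i).1 * \prod_(j | j != i) (nd j).2).
split; first by apply/prodf_neq0 => i _; have [] := ndP i.
move=> i; rewrite (bigD1 i) //= !tofracM mulrAC (ndP i).2 //.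
Qed.

Section RatBasis.
Variables (F : finFieldType) (K : fieldType) (k : {rmorphism F -> K}).
Implicit Types (f g : {poly F}) (s x y : K).

Definition evalK (s : K) (f : {poly F}) : K := (map_poly k f).[s].

HB.instance Definition _ (s : K) :=
  GRing.RMorphism.copy (evalK s) (horner_eval s \o map_poly k).

Lemma evalKC s c : evalK s c%:P = k c.
Proof. by rewrite /evalK map_polyC hornerC. Qed.

Lemma evalKX s : evalK s 'X = s.
Proof. by rewrite /evalK map_polyX hornerX. Qed.

Lemma evalK_wide s f n : (size f <= n)%N ->
  evalK s f = \sum_(i < n) k f`_i * s ^+ i.
Proof.
move=> fn; rewrite /evalK (@horner_coef_wide _ n) ?size_map_poly //.
by apply: eq_bigr => i _; rewrite coef_map.
Qed.

(* K is finite over the field of fractions of F[s], with basis w. *)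
Record rat_basis (s : K) (n : nat) (w : 'I_n -> K) : Prop := RatBasis {
  rat_pos : (0 < n)%N;
  rat_free : forall c : 'I_n -> {poly F},
    \sum_i evalK s (c i) * w i = 0 -> forall i, c i = 0;
  rat_span : forall y, exists g (c : 'I_n -> {poly F}),
    g != 0 /\ evalK s g * y = \sum_i evalK s (c i) * w i;
  rat_alg : forall y, exists P : {poly {poly F}},
    P != 0 /\ (map_poly (evalK s) P).[y] = 0
}.

Section Theory.
Variables (s : K) (n : nat) (w : 'I_n -> K) (sw : rat_basis s w).

Lemma evalK_eq0 f : (evalK s f == 0) = (f == 0).
Proof.
apply/eqP/eqP => [f0|->]; last by rewrite rmorph0.
have n0 := rat_pos sw; apply: (rat_free sw (c := fun=> f) _ (Ordinal n0)).
by rewrite f0 big1 // => i _; rewrite mul0r.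
Qed.

Lemma rat_neq0 : s != 0.
Proof. by rewrite -(evalKX s) evalK_eq0 polyX_eq0. Qed.

(** The reversal [X^m f(1/X)], which turns polynomials in [s] into polynomials in [s^-1]. *)
Definition revp (m : nat) f : {poly F} := \poly_(i < m.+1) f`_(m - i).

Lemma revp_eq0 m f : (size f <= m.+1)%N -> revp m f = 0 -> f = 0.
Proof.
move=> fm f0; apply/polyP => i; rewrite coef0.
have [im|mi] := leqP i m; last by rewrite nth_default // (leq_trans fm).
have := congr1 (fun p : {poly F} => p`_(m - i)) f0.
by rewrite coef0 coef_poly ltnS leq_subr subKn.
Qed.

Lemma size_revp m f : (size (revp m f) <= m.+1)%N.
Proof. exact: size_poly. Qed.

Lemma revpK m f : (size f <= m.+1)%N -> revp m (revp m f) = f.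
Proof.
move=> fm; apply/polyP => i; rewrite !coef_poly ltnS.
have [im|mi] := leqP i m; last by rewrite nth_default // (leq_trans fm).
by rewrite ltnS leq_subr subKn.
Qed.

Lemma evalK_revp m f : (size f <= m.+1)%N ->
  evalK s^-1 (revp m f) = s ^- m * evalK s f.
Proof.
move=> fm; rewrite (evalK_wide _ (size_revp m f)) (evalK_wide _ fm) mulr_sumr.
rewrite (reindex_inj rev_ord_inj); apply: eq_bigr => -[i im] _ /=.
rewrite coef_poly subSS ltnS leq_subr subKn // mulrCA; congr (_ * _).
have im' : (i <= m)%N by [].
rewrite exprVn -[in s ^- m](subnK im') exprD invfM -mulrA mulVf ?mulr1 //.
by rewrite expf_neq0 // rat_neq0.
Qed.

Lemma bound_size (I : finType) (c : I -> {poly F}) :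
  exists m, forall i, (size (c i) <= m.+1)%N.
Proof.
exists (\max_i size (c i)) => i; apply: leqW.
exact: (leq_bigmax (F := fun i => size (c i))).
Qed.

(** Reversing all polynomials to a common degree [m] only multiplies a relation by a power of [s],
    so the same [w] serves over [s^-1]. Poles of [s] can thereby be treated as zeros of [s^-1]. *)
Lemma rat_basisV : rat_basis s^-1 w.
Proof.
have s0 := rat_neq0; split; first exact: rat_pos sw.
- move=> c c0 i; have [m cm] := bound_size c.
  apply: (revp_eq0 (cm i)); apply: (rat_free sw (c := revp m \o c)).
  transitivity (s ^+ m * \sum_i evalK s^-1 (c i) * w i); last by rewrite c0 mulr0.
  rewrite mulr_sumr; apply: eq_bigr => j _ /=.
  rewrite -[in RHS](revpK (cm j)) evalK_revp ?size_revp // !mulrA divff ?mul1r //.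
  by rewrite expf_neq0.
- move=> y; have [g [c [g0 gy]]] := rat_span sw y.
  have [m cm] := bound_size (fun i => oapp c g i).
  exists (revp m g), (revp m \o c); split.
    by apply: contra_neq g0 => /revp_eq0; apply; apply: (cm None).
  rewrite evalK_revp; last exact: (cm None).
  rewrite -mulrA gy mulr_sumr; apply: eq_bigr => j _ /=.
  by rewrite evalK_revp ?mulrA //; apply: (cm (Some j)).
- move=> y; have [P [P0 Py]] := rat_alg sw y.
  have [m Pm] := bound_size (fun i : 'I_(size P) => P`_i).
  have Pm' (i : nat) : (size (P`_i)%R <= m.+1)%N.
    have [iP|Pi] := ltnP i (size P); first exact: (Pm (Ordinal iP)).
    by rewrite nth_default ?size_poly0.
  exists (\poly_(i < size P) revp m P`_i); split.
    apply: contra_neq P0 => /polyP h; apply/polyP => i.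
    have := h i; rewrite !coef0 coef_poly; case: ltnP => [_ /revp_eq0 -> //|].
    by move=> ? _; rewrite nth_default.
  rewrite [map_poly _ _](_ : _ = (s ^- m)%:P * map_poly (evalK s) P).
    by rewrite hornerM Py mulr0.
  apply/polyP => i; rewrite coefCM !coef_map coef_poly.
  have [iP|Pi] := ltnP i (size P); first by rewrite /= evalK_revp.
  by rewrite nth_default // raddf0 raddf0 mulr0.
Qed.

(** Stripping factors [X] from an equation of [y] exposes a nonzero constant coefficient: a nonzero
    polynomial in [s] that is divisible by [y] in any ring containing the constants, [s] and [y]. *)
Lemma rat_alg_coef0 y : y != 0 -> exists P : {poly {poly F}},
  P`_0 != 0 /\ (map_poly (evalK s) P).[y] = 0.
Proof.
move=> y0; have [P []] := rat_alg sw y.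
elim/poly_ind: P => [/eqP //|P c IH].
have [->|c0] := eqVneq c 0; last first.
  by move=> _ h; exists (P * 'X + c%:P); rewrite coefD coefMX coefC add0r.
rewrite addr0 mulf_eq0 polyX_eq0 orbF => /IH {}IH.
rewrite rmorphM /= map_polyX hornerMX => /eqP.
by rewrite mulf_eq0 (negPf y0) orbF => /eqP.
Qed.

Lemma common_denominator (I : finType) (r : I -> K) :
  exists g (c : I -> 'I_n -> {poly F}), g != 0 /\
    forall a, evalK s g * r a = \sum_i evalK s (c a i) * w i.
Proof.
have /boolp.choice[gc gcP] : forall a, exists p : {poly F} * ('I_n -> {poly F}),
    p.1 != 0 /\ evalK s p.1 * r a = \sum_i evalK s (p.2 i) * w i.
  by move=> a; have [g [c h]] := rat_span sw (r a); exists (g, c).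
exists (\prod_a (gc a).1), (fun a i => (gc a).2 i * \prod_(b | b != a) (gc b).1).
split; first by apply/prodf_neq0 => a _; have [] := gcP a.
move=> a; rewrite (bigD1 a) //= rmorphM mulrAC (gcP a).2 mulr_suml.
by apply: eq_bigr => i _; rewrite rmorphM mulrAC.
Qed.

End Theory.
End RatBasis.

(** * Counting residues modulo a polynomial *)

Section ExpansionBound.
Variables (F : finFieldType) (K : fieldType) (k : {rmorphism F -> K}).
Variables (s : K) (n : nat) (w : 'I_n -> K) (sw : rat_basis k s w).

(** The lowest digit is determined modulo [x]; removing it and dividing by [x] leaves an expansion
    with one digit fewer. *)
Lemma expansion_inj (O : set K) (x : K) (R : set K) m (phi psi : nat -> K) :
  is_subgroup O -> (forall y, O y -> O (x * y)) -> x != 0 -> R `<=` O ->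
  (forall y z, R y -> R z -> (exists2 u, O u & y - z = x * u) -> y = z) ->
  (forall j, R (phi j)) -> (forall j, R (psi j)) ->
  \sum_(j < m) phi j * x ^+ j = \sum_(j < m) psi j * x ^+ j ->
  forall j, (j < m)%N -> phi j = psi j.
Proof.
move=> sO Ox x0 RO inj; elim: m phi psi => [|m IH] phi psi Rphi Rpsi //.
have shift (f : nat -> K) :
    \sum_(j < m.+1) f j * x ^+ j = f 0%N + x * \sum_(j < m) f j.+1 * x ^+ j.
  rewrite big_ord_recl expr0 mulr1 mulr_sumr; congr (_ + _).
  by apply: eq_bigr => j _; rewrite exprS mulrCA.
have sumO (f : nat -> K) : (forall j, R (f j)) -> O (\sum_(j < m) f j * x ^+ j).
  move=> Rf; elim/big_rec: _ => [|j y _ Oy]; first exact: sO.1.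
  apply: subgroupD => //; rewrite mulrC.
  have : O (f j) by apply/RO/Rf.
  elim: {2}(nat_of_ord j) => [|i IHi]; rewrite ?mul1r // exprS -mulrA => ?.
  exact/Ox/IHi.
rewrite !shift => e.
have e0 : phi 0%N = psi 0%N.
  apply: inj => //.
  exists (\sum_(j < m) psi j.+1 * x ^+ j - \sum_(j < m) phi j.+1 * x ^+ j).
    by apply: sO.2; apply: (sumO (fun j => _ j.+1)) => j.
  apply/eqP; rewrite mulrBr subr_eq addrAC eq_sym subr_eq; apply/eqP.
  by rewrite e addrC.
move: e; rewrite e0 => /addrI/(mulfI x0) /(IH (phi \o S) (psi \o S)) h.
by case=> // j; rewrite ltnS => /h; apply; move=> i; [exact: Rphi|exact: Rpsi].
Qed.

Lemma exp_growth (a m C : nat) : (0 < a)%N ->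
  (forall j, (m ^ j <= C * a ^ j)%N) -> (m <= a)%N.
Proof.
move=> a0 h; rewrite leqNgt; apply/negP => am.
(* Bernoulli's inequality for [1 + 1/a], cleared of denominators; [j = C * a] is where it beats the
   constant [C]. *)
have bern j : (a ^ j * (a + j) <= a.+1 ^ j * a)%N.
  elim: j => [|j IH]; first by rewrite !expn0 addn0.
  rewrite !expnS; nia.
have h1 : (a.+1 ^ (C * a) <= C * a ^ (C * a))%N.
  apply: leq_trans (h _); elim: (C * a)%N => // j IH.
  by rewrite !expnS leq_mul.
have := bern (C * a)%N; have : (0 < a ^ (C * a))%N by rewrite expn_gt0 a0.
set u := (a ^ (C * a))%N in h1 *; set v := (a.+1 ^ _)%N in h1 *; nia.
Qed.

Definition multiples (O : set K) (x : K) : set K := [set x * u | u in O].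

(* Base-x expansions with digits in a set of representatives are distinct, and
   up to a common denominator they lie in a box of polynomials; counting both
   gives the bound. *)
Lemma index_multiples (O : set K) (f : {poly F}) D m :
  is_subgroup O -> (forall y, O y -> O (evalK k s f * y)) -> size f = D.+1 ->
  index_ge O (multiples O (evalK k s f)) m -> (m <= #|F| ^ (n * D))%N.
Proof.
move=> sO Ox fD [R [<- uR RO Rinj]]; set x := evalK k s f in Ox Rinj *.
have x0 : x != 0 by rewrite (evalK_eq0 sw) -size_poly_eq0 fD.
have [->|m0] := posnP (size R); first by [].
have [g [c [g0 gc]]] := common_denominator sw (fun i : 'I_(size R) => tnth (in_tuple R) i).
have [B cB] := bound_size (fun p : 'I_(size R) * 'I_n => c p.1 p.2).
(* The sizes of the numerators of the digits enlarge the box of polynomials by a factor independent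
   of the length [j], which [exp_growth] discards. *)
apply: (@exp_growth _ _ (#|F| ^ (n * B.+1))%N).
  by rewrite expn_gt0 (ltn_trans _ (finNzRing_gt1 F)).
move=> j.
pose digits (phi : {ffun 'I_j -> 'I_(size R)}) i := \sum_(l < j) c (phi l) i * f ^+ l.
have sz phi i : (size (digits phi i) <= B.+1 + D * j)%N.
  apply: leq_trans (size_sum _ _ _) _; apply/bigmax_leqP => l _.
  apply: leq_trans (size_polyMleq _ _) _; have := cB (phi l, i).
  have := size_poly_exp_leq f l; rewrite fD /=.
  by have : (D * l <= D * j)%N; [rewrite leq_mul2l (ltnW (ltn_ord l)) orbT|lia].
pose code (phi : {ffun 'I_j -> 'I_(size R)}) : {ffun 'I_n -> {ffun 'I_(B.+1 + D * j) -> F}} :=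
  [ffun i => [ffun l : 'I__ => (digits phi i)`_l]].
have code_inj : injective code.
  move=> phi psi e.
  have dE i : digits phi i = digits psi i.
    apply/polyP => l; have [lt|ge] := ltnP l (B.+1 + D * j).
      by have /ffunP/(_ i)/ffunP/(_ (Ordinal lt)) := e; rewrite !ffunE.
    by rewrite !nth_default // (leq_trans (sz _ _)).
  (* [expansion_inj] takes digits indexed by [nat]; from [j] on they are filled with the first
     representative. *)
  pose val_ (phi : {ffun 'I_j -> 'I_(size R)}) (l : nat) : K :=
    if insub l is Some l' then tnth (in_tuple R) (phi l') else tnth (in_tuple R) (Ordinal m0).
  have valR phi' l : val_ phi' l \in R.
    by rewrite /val_; case: insub => [l'|]; exact: mem_tnth.
  have sumE phi' : evalK k s g * (\sum_(l < j) val_ phi' l * x ^+ l) =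
      \sum_i evalK k s (digits phi' i) * w i.
    under [RHS]eq_bigr do rewrite rmorph_sum mulr_suml.
    rewrite exchange_big mulr_sumr; apply: eq_bigr => l _.
    rewrite mulrA /val_ insubT //= => lj; rewrite -mulrA mulrA.
    have -> : Sub (val l) lj = l by apply: val_inj.
    rewrite gc mulr_suml; apply: eq_bigr => i _.
    by rewrite rmorphM rmorphXn /= -/x mulrAC.
  have e1 : \sum_(l < j) val_ phi l * x ^+ l = \sum_(l < j) val_ psi l * x ^+ l.
    apply: (mulfI (_ : evalK k s g != 0)); first by rewrite (evalK_eq0 sw).
    by rewrite !sumE; apply: eq_bigr => i _; rewrite dE.
  apply/ffunP => l; have := expansion_inj sO Ox x0 (R := fun y => y \in R) _ _ _ _ e1.
  have RP y z : y \in R -> z \in R -> (exists2 u, O u & y - z = x * u) -> y = z.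
    by move=> yR zR [u Ou yz]; apply: Rinj => //; exists u.
  move=> /(_ RO RP (valR phi) (valR psi) l (ltn_ord l)).
  rewrite /val_ insubT // => lj; have -> : Sub (val l) lj = l by apply: val_inj.
  move=> /tuple_uniqP h; exact: h.
have := leq_card _ code_inj.
rewrite !card_ffun !card_ord -!expnM -expnD => h; apply: leq_trans h _.
by rewrite leq_exp2l ?finNzRing_gt1 //; lia.
Qed.

End ExpansionBound.

(** * Existence of places *)

Section Chevalley.
Variable L : fieldType.
Implicit Types (A B I J O : set L).

Definition is_subring A := is_subgroup A /\ A 1 /\ forall x y, A x -> A y -> A (x * y).

Definition is_proper_ideal A I := is_subgroup I /\ I `<=` A /\ ~ I 1 /\
  forall a x, A a -> I x -> I (a * x).

Lemma subgroup_sum A (T : Type) (r : seq T) (f : T -> L) (p : pred T) : is_subgroup A ->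
  (forall i, p i -> A (f i)) -> A (\sum_(i <- r | p i) f i).
Proof.
move=> sA h; elim/big_rec: _ => [|i x pi Ax]; first exact: sA.1.
by apply: subgroupD => //; exact: h.
Qed.

(** For a subring this is [A[x]]; for an ideal [J] of [B] it is the ideal generated by [J] in
    [B[x]]. *)
Definition adjoin A (x : L) : set L :=
  [set y | exists2 p : {poly L}, (forall i, A p`_i) & y = p.[x]].

Lemma adjoin_subgroup A x : is_subgroup A -> is_subgroup (adjoin A x).
Proof.
move=> sA; split.
  by exists 0; rewrite ?horner0 // => i; rewrite coef0; exact: sA.1.
move=> _ _ [p pA ->] [q qA ->]; exists (p - q); last by rewrite !hornerE.
by move=> i; rewrite coefB; exact: sA.2.
Qed.

Lemma adjoinM A B x : is_subgroup B -> (forall a b, A a -> B b -> B (a * b)) ->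
  forall a b, adjoin A x a -> adjoin B x b -> adjoin B x (a * b).
Proof.
move=> sB AB _ _ [p pA ->] [q qA ->]; exists (p * q); last by rewrite hornerM.
by move=> i; rewrite coefM; apply: subgroup_sum => // j _; exact: AB.
Qed.

Lemma sub_adjoin A x : is_subgroup A -> A `<=` adjoin A x.
Proof.
move=> sA a Aa; exists a%:P; last by rewrite hornerC.
by move=> [|i]; rewrite coefC //=; exact: sA.1.
Qed.

Lemma adjoin_subring A x : is_subring A -> is_subring (adjoin A x) /\ adjoin A x x.
Proof.
move=> [sA [A1 AM]]; split.
  split; first exact: adjoin_subgroup.
  split; first exact: sub_adjoin.
  exact: adjoinM.
exists 'X; last by rewrite hornerX.
by move=> i; rewrite coefX; case: (i == 1)%N => //; exact: sA.1.
Qed.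

(** Let [b] be the constant term of [q]. The relation for [x^-1], multiplied by [x ^+ n.+1],
    expresses [(1 - b) x ^+ n.+1] by lower powers with coefficients in [J]. Substituting this into
    [1 - b] times the relation for [x] removes its leading term. *)
Lemma valuation_reduction B J x (p q : {poly L}) :
  is_subring B -> is_proper_ideal B J -> x != 0 ->
  (forall i, J p`_i) -> (forall i, J q`_i) -> p.[x] = 1 -> q.[x^-1] = 1 ->
  (size q <= size p)%N ->
  exists p' : {poly L}, [/\ forall i, J p'`_i, p'.[x] = 1 & (size p' < size p)%N].
Proof.
move=> [sB [B1 BM]] [sJ [JB [J1 BJ]]] x0 pJ qJ px qx qp.
have [n np] : exists n, size p = n.+2.
  case E : (size p) => [|[|n]]; last by exists n.
    by move/eqP: E; rewrite size_poly_eq0 => /eqP p0; move/eqP: px; rewrite p0 horner0 eq_sym oner_eq0.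
  have /size1_polyC pc : (size p <= 1)%N by rewrite E.
  by case: J1; rewrite -px pc hornerC; exact: pJ.
set a := p`_n.+1; set b := q`_0.
pose p0 := \poly_(i < n.+1) p`_i; pose r := \poly_(i < n.+1) q`_(n.+1 - i).
have pE : p.[x] = p0.[x] + a * x ^+ n.+1.
  rewrite horner_poly (@horner_coef_wide _ n.+2) ?np //.
  by rewrite big_ord_recr.
have rE : r.[x] = x ^+ n.+1 * (1 - b).
  rewrite horner_poly -qx (@horner_coef_wide _ n.+2) -?np //.
  rewrite np [in RHS]big_ord_recl expr0 mulr1 addrAC subrr add0r mulr_sumr.
  rewrite (reindex_inj rev_ord_inj); apply: eq_bigr => -[i ilt] _ /=.
  rewrite subSS subSn ?leq_subr // subKn // mulrCA; congr (_ * _).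
  rewrite /bump add1n exprVn -[in x ^+ n.+1](subnK ilt) exprD -mulrA mulfV ?mulr1 //.
  by rewrite expf_neq0.
exists (b%:P + (1 - b) *: p0 + a *: r); split.
- move=> i; rewrite !coefD !coefZ !coef_poly coefC.
  have J0 := sJ.1.
  apply: subgroupD => //; first apply: subgroupD => //.
  + by case: (i == 0)%N => //; exact: qJ.
  + by apply: BJ; [apply: sB.2 => //; exact/JB/qJ|case: ifP].
  + by apply: BJ; [exact/JB/pJ|case: ifP].
- rewrite !hornerE rE mulrA mulrC -[a * _ * _]mulrC; move: px; rewrite pE => e.
  rewrite [p0.[x] * _]mulrC -addrA -mulrDr e; ring.
- rewrite np ltnS; apply: leq_trans (size_polyD _ _) _.
  rewrite geq_max; apply/andP; split; last first.
    exact: leq_trans (size_scale_leq _ _) (size_poly _ _).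
  apply: leq_trans (size_polyD _ _) _; rewrite geq_max.
  rewrite (leq_trans (size_polyC_leq1 _)) //=.
  exact: leq_trans (size_scale_leq _ _) (size_poly _ _).
Qed.

(** Infinite descent on the sum of the sizes, shortening the longer relation each time. *)
Lemma valuation_dichotomy B J x : is_subring B -> is_proper_ideal B J -> x != 0 ->
  ~ (adjoin J x 1 /\ adjoin J x^-1 1).
Proof.
move=> sB sJ x0 [[p pJ /esym px] [q qJ /esym qx]].
have [N] : exists N, (size p + size q <= N)%N by exists (size p + size q)%N.
elim: N x x0 p q pJ qJ px qx => [|N IH] x x0 p q pJ qJ px qx.
  rewrite leqn0 addn_eq0 size_poly_eq0 => /andP[/eqP p0 _].
  by move/eqP: px; rewrite p0 horner0 eq_sym oner_eq0.
move=> h; have [qp|/ltnW pq] := leqP (size q) (size p).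
  have [p' [p'J p'x sp]] := valuation_reduction sB sJ x0 pJ qJ px qx qp.
  by apply: (IH x x0 p' q) => //; lia.
have xV0 : x^-1 != 0 by rewrite invr_eq0.
have px' : p.[x^-1^-1] = 1 by rewrite invrK.
have [q' [q'J q'x sq]] := valuation_reduction sB sJ xV0 qJ pJ qx px' pq.
by apply: (IH x x0 p q') => //; lia.
Qed.

(** Take a maximal pair [(B, J)] of a ring and a proper ideal containing [A] and [I]. If 1 is not in
    [J[x]], then [B[x]] with [J[x]] is again such a pair, so [x] lies in [B]; by
    [valuation_dichotomy] this happens for [x] or for [x^-1]. *)
Lemma chevalley A I : is_subring A -> is_proper_ideal A I ->
  exists O, [/\ is_subring O, A `<=` O, forall x, x != 0 -> O x \/ O x^-1 &
    forall x, I x -> x != 0 -> ~ O x^-1].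
Proof.
move=> sA sI.
(* A ring and an ideal are coded as one set of tagged elements, so that inclusion of sets orders the
   pairs. Taking the union with [base] makes the empty chain harmless in Zorn's lemma. *)
pose rg (X : set (bool * L)) : set L := [set x | X (true, x)].
pose id_ (X : set (bool * L)) : set L := [set x | X (false, x)].
pose good X := is_subring (rg X) /\ is_proper_ideal (rg X) (id_ X).
pose base : set (bool * L) := [set bx | if bx.1 then A bx.2 else I bx.2].
have good_base : good base by [].
have [X [XP Xmax]] : exists X, good (X `|` base) /\
    (forall Y, X `<` Y -> ~ good (Y `|` base)).
  apply: (@Zorn_bigcup _ [set X | good (X `|` base)]) => G GP tot.
  pose U := \bigcup_(X in G) X.
  have two x y : (U `|` base) x -> (U `|` base) y ->
      exists Z, [/\ good Z, Z x, Z y & Z `<=` U `|` base].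
    have sub Z : G Z -> Z `|` base `<=` U `|` base.
      by move=> GZ z [Zz|]; [left; exists Z|right].
    move=> [[Z GZ Zx]|bx] [[Z' GZ' Zy]|bY].
    - have [ZZ'|Z'Z] := tot _ _ GZ GZ'.
        by exists (Z' `|` base); split; [exact: GP|left; exact: ZZ'|left|exact: sub].
      by exists (Z `|` base); split; [exact: GP|left|left; exact: Z'Z|exact: sub].
    - by exists (Z `|` base); split; [exact: GP|left|right|exact: sub].
    - by exists (Z' `|` base); split; [exact: GP|right|left|exact: sub].
    - by exists base; split=> // z; right.
  rewrite /= -/U; split.
    split; last split.
    + split; first by right; exact: sA.1.1.
      by move=> x y /two h /h[Z [[[gZ _] _] Zx Zy]]; apply; exact: gZ.2.
    + by right; exact: sA.2.1.
    + by move=> x y /two h /h[Z [[[_ [_ gZ]] _] Zx Zy]]; apply; exact: gZ.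
  split; last split; last split.
  + split; first by right; exact: sI.1.1.
    by move=> x y /two h /h[Z [[_ [gZ _]] Zx Zy]]; apply; exact: gZ.2.
  + by move=> x Ux; have [Z [[_ [_ [gZ _]]] Zx _]] := two _ _ Ux Ux; apply; exact: gZ.
  + move=> U1; have [Z [[_ [_ [_ [gZ _]]]] Zx _ _]] := two _ _ U1 U1.
    exact: gZ.
  + by move=> x y /two h /h[Z [[_ [_ [_ [_ gZ]]]] Zx Zy]]; apply; exact: gZ.
set Z := X `|` base in XP; have [sB sJ] := XP.
have maxZ Y : Z `<=` Y -> good Y -> Y `<=` Z.
  move=> ZY gY; apply: contrapT => nYZ; apply: (Xmax Y).
    split; first by move=> z Xz; apply: ZY; left.
    by move=> YX; apply: nYZ => y /YX; left.
  suff -> : Y `|` base = Y by [].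
  by apply/seteqP; split=> y; [case=> // ?; apply: ZY; right|left].
have ext x : ~ adjoin (id_ Z) x 1 -> rg Z x.
  move=> n1; pose Y : set (bool * L) :=
    [set bx | if bx.1 then adjoin (rg Z) x bx.2 else adjoin (id_ Z) x bx.2].
  have [aB ax] := adjoin_subring x sB.
  apply: (maxZ Y) => //.
    by move=> [[] y] Zy /=; apply: sub_adjoin => //; [exact: sB.1|exact: sJ.1].
  split=> //; split; first by apply: adjoin_subgroup; exact: sJ.1.
  split; first by move=> y [p pJ yE]; exists p => // i; exact/sJ.2.1/pJ.
  by split=> //; apply: adjoinM; [exact: sJ.1|exact: sJ.2.2.2].
exists (rg Z); split=> //.
- by move=> a Aa; right.
- move=> x x0; apply: contrapT => h.
  apply: (valuation_dichotomy sB sJ x0); split; apply: contrapT => /ext hx; apply: h.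
    by left.
  by right.
- move=> x Ix x0 OxV; apply: (sJ.2.2.1); rewrite -(mulVf x0).
  by apply: sJ.2.2.2 => //; right.
Qed.

End Chevalley.

Section PlaceOfValring.
Variables (F : finFieldType) (K : fieldType) (k : {rmorphism F -> K}).
Variables (O : set K) (sO : is_subring O) (kO : forall c, O (k c)).
Hypothesis dichO : forall x, x != 0 -> O x \/ O x^-1.

Let OD x y : O x -> O y -> O (x + y). Proof. exact: (subgroupD sO.1). Qed.
Let OB x y : O x -> O y -> O (x - y). Proof. exact: sO.1.2. Qed.
Let OM x y : O x -> O y -> O (x * y). Proof. exact: sO.2.2. Qed.
Let O1 : O 1. Proof. exact: sO.2.1. Qed.
Let O0 : O 0. Proof. exact: sO.1.1. Qed.

Let OX x i : O x -> O (x ^+ i).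
Proof. by move=> Ox; elim: i => [|i IH]; rewrite ?expr0 // exprS; exact: OM. Qed.

Let not_OM x y : x != 0 -> ~ O x -> ~ O y -> ~ O (x * y).
Proof.
move=> x0 nx ny Oxy; have [//|OxV] := dichO x0.
by apply: ny; rewrite -(mulKf x0 y); exact: OM.
Qed.

Let nonunit_1B y : y != 0 -> ~ O y^-1 -> 1 - y != 0 /\ O (1 - y)^-1.
Proof.
move=> y0 ny; have y1 : 1 - y != 0.
  by rewrite subr_eq0; apply/eqP => y1; apply: ny; rewrite -y1 invr1.
split=> //; have yy0 : (1 - y) / y != 0 by rewrite mulf_neq0 ?invr_eq0.
have [] := dichO yy0.
  rewrite mulrBl mulfV // mul1r => h; case: ny.
  by rewrite -[y^-1](subrK 1); exact: OD.
rewrite invf_div => h; have -> : (1 - y)^-1 = y / (1 - y) + 1 by field.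
exact: OD.
Qed.

Section Uniformizer.
Variables (s : K) (n : nat) (w : 'I_n -> K) (sw : rat_basis k s w) (Os : O s).

Let evalO f : O (evalK k s f).
Proof.
rewrite (evalK_wide _ _ (leqnn _)); apply: subgroup_sum => [|i _]; first exact: sO.1.
by apply: OM; [exact: kO|exact: OX].
Qed.

Let divides_poly z : z != 0 -> O z ->
  exists f u, [/\ f != 0, O u & evalK k s f = z * u].
Proof.
move=> z0 Oz; have [P [P0 Pz]] := rat_alg_coef0 sw z0.
exists P`_0, (- \sum_(i < size P) evalK k s P`_i.+1 * z ^+ i); split=> //.
  apply: (subgroupN sO.1); apply: subgroup_sum => [|i _]; first exact: sO.1.
  by apply: OM; [exact: evalO|exact: OX].
move: Pz; rewrite (@horner_coef_wide _ (size P).+1); last first.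
  by rewrite (leq_trans (size_poly _ _)).
rewrite big_ord_recl coef_map expr0 mulr1 => /eqP; rewrite addr_eq0 => /eqP -> /=.
rewrite mulrN mulr_sumr; congr (- _).
by apply: eq_bigr => i _; rewrite coef_map exprS mulrCA.
Qed.

(** A substitute for the Noetherian property. If [y i / y j] is outside [O], then [1 - y j / y i] is
    a unit, so a congruence between [y i] and [y j] modulo the polynomial would make [y i] divisible
    by it; likewise with [i] and [j] exchanged. Failing divisibility, the terms are pairwise
    incongruent, and there are more of them than [index_multiples] allows. *)
Let chain_bound f (y : nat -> K) : f != 0 -> (forall i, O (y i) /\ y i != 0) ->
  (forall i j, (i < j)%N -> ~ O (y i / y j) \/ ~ O (y j / y i)) ->
  exists i, O (y i / evalK k s f).
Proof.
move=> f0 Oy ch; apply: contrapT => hn.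
have [D fD] : exists D, size f = D.+1.
  by exists (size f).-1; rewrite prednK // lt0n size_poly_eq0.
have x0 : evalK k s f != 0 by rewrite (evalK_eq0 sw).
have step a b u : a != 0 -> b != 0 -> ~ O (a / b) ->
    (a - b) = evalK k s f * u -> O u -> O (a / evalK k s f).
  move=> a0 b0 nab e Ou; have c0 : b / a != 0 by rewrite mulf_neq0 ?invr_eq0.
  have [|d0 Od] := @nonunit_1B (b / a) c0; first by rewrite invf_div.
  rewrite (_ : a / _ = u * (1 - b / a)^-1); first exact: OM.
  apply: (mulIf x0); rewrite divfK // mulrAC [u * _]mulrC -e.
  by apply: (mulIf d0); rewrite divfK // mulrBr mulr1 mulrCA divff // mulr1.
pose M := (#|F| ^ (n * D)).+1.
have ne i j u : (i < j)%N -> O u -> y i - y j = evalK k s f * u -> False.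
  move=> ij Ou e; have [h|h] := ch i j ij; apply: hn.
    by exists i; apply: step h e Ou; apply: (Oy _).2.
  exists j; apply: (step _ _ (- u) _ _ h); try exact: (Oy _).2.
    by rewrite mulrN -e opprB.
  exact: (subgroupN sO.1).
suff : index_ge O (multiples O (evalK k s f)) M.
  move=> /(index_multiples sw sO.1 _ fD); rewrite ltnn => h.
  by have : false by apply: h => z Oz; exact: OM.
exists [seq y i | i <- iota 0 M]; split.
- by rewrite size_map size_iota.
- rewrite map_inj_in_uniq ?iota_uniq // => i j _ _ e.
  have [ij|ij|//] := ltngtP i j.
    by case: (ne i j 0 ij) => //; rewrite e subrr mulr0.
  by case: (ne j i 0 ij) => //; rewrite e subrr mulr0.
- by move=> _ /mapP[i _ ->]; exact: (Oy i).1.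
- move=> _ _ /mapP[i _ ->] /mapP[j _ ->] [u Ou e].
  have [ij|ij|-> //] := ltngtP i j.
    by case: (ne i j u ij).
  case: (ne j i (- u) ij) => //; first exact: (subgroupN sO.1).
  by rewrite mulrN e opprB.
Qed.

Hypothesis nontriv : exists i, [/\ i != 0, O i & ~ O i^-1].

(** If no nonunit divided all the others, principal ideals could be enlarged forever, starting from
    a polynomial [x] in [s] that is a nonunit. No later generator is divisible by [x], against
    [chain_bound]. *)
Let ex_uniformizer : exists p, [/\ p != 0, O p, ~ O p^-1 &
  forall y, y != 0 -> O y -> ~ O y^-1 -> O (y / p)].
Proof.
apply: contrapT => hn.
have /boolp.choice[g gP] : forall p, exists y, p != 0 -> O p -> ~ O p^-1 ->
    [/\ y != 0, O y, ~ O y^-1 & ~ O (y / p)].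
  move=> p; apply: contrapT => hp; apply: hn; exists p; split.
  - by apply: contrapT => p0; apply: hp; exists 0 => /p0.
  - by apply: contrapT => p0; apply: hp; exists 0 => ? /p0.
  - by move=> p0; apply: hp; exists 0 => ? ? /(_ p0).
  - move=> y y0 Oy ny; apply: contrapT => nyp; apply: hp; exists y => _ _ _.
    by split.
have [z [z0 Oz nz]] := nontriv; have [f [u [f0 Ou e]]] := divides_poly z0 Oz.
set x := evalK k s f in e.
have x0 : x != 0 by rewrite (evalK_eq0 sw).
have nx : ~ O x^-1.
  move=> Ox; apply: nz; have u0 : u != 0 by apply: contraNneq x0 => u0; rewrite e u0 mulr0.
  by rewrite (_ : z^-1 = u / x); [exact: OM|rewrite e; field; rewrite ?z0 ?u0].
have yP i : [/\ iter i g x != 0, O (iter i g x) & ~ O (iter i g x)^-1].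
  elim: i => [|i [a b c]]; first by split=> //; exact: evalO.
  by have [] := gP _ a b c.
have ch i j : ~ O (iter (i + j.+1) g x / iter i g x).
  elim: j => [|j IH].
    by rewrite addn1; have [a b c] := yP i; have [] := gP _ a b c.
  rewrite addnS; set a := iter (i + j.+1) g x; have [a0 Oa na] := yP (i + j.+1)%N.
  have [_ _ _ nga] := gP _ a0 Oa na.
  have i0 : iter i g x != 0 by have [] := yP i.
  rewrite (_ : _ / _ = (iter (i + j.+1).+1 g x / a) * (a / iter i g x)).
    apply: not_OM => //; rewrite mulf_neq0 ?invr_eq0 //.
    by have [] := yP (i + j.+1).+1.
  by rewrite mulrA divfK.
have [||i] := @chain_bound f (fun i => iter i.+1 g x) f0.
- by move=> i; have [] := yP i.+1.
- move=> i j ij; right; have := ch i.+1 (j - i.+1)%N.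
  by rewrite -subSn // addnC subnK // ltnW.
- by have := ch 0%N i.
Qed.

(** The powers of [p] form a descending chain, so by [chain_bound] no nonzero element is divisible
    by all of them; dividing by the last power that divides leaves a unit. *)
Let ex_exponent : exists p, [/\ p != 0, O p, ~ O p^-1 &
  forall x, x != 0 -> exists e : int, O (x / p ^ e) /\ O (x / p ^ e)^-1].
Proof.
have [p [p0 Op np pP]] := ex_uniformizer; exists p; split=> //.
have npX i : ~ O (p ^- i.+1).
  elim: i => [|i IH]; rewrite ?expr1 // exprS invfM.
  by apply: not_OM => //; rewrite invr_eq0.
have bounded z : z != 0 -> exists i, ~ O (z / p ^+ i).
  move=> z0; apply: contrapT => hn.
  have {}hn i : O (z / p ^+ i) by apply: contrapT => h; apply: hn; exists i.
  have Oz : O z by have := hn 0%N; rewrite expr0 divr1.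
  have [f [u [f0 Ou e]]] := divides_poly z0 Oz.
  have x0 : z * u != 0 by rewrite -e (evalK_eq0 sw).
  have u0 : u != 0 by apply: contraNneq x0 => ->; rewrite mulr0.
  have [||i] := @chain_bound f (fun i => p ^+ i) f0.
  - by move=> i; rewrite expf_neq0 //; split=> //; exact: OX.
  - move=> i j ij; left; rewrite -(subnK ij) addnS exprS exprD.
    have pi0 : p ^+ i != 0 by rewrite expf_neq0.
    have pj0 : p ^+ (j - i.+1) != 0 by rewrite expf_neq0.
    have := npX (j - i.+1)%N; congr (~ O _); rewrite exprS.
    by field; rewrite ?p0 ?pi0 ?pj0.
  - have pi0 : p ^+ i != 0 by rewrite expf_neq0.
    rewrite e => h; apply: np; have := OM (OM h Ou) (hn i.+1).
    by congr O; rewrite exprS; field; rewrite ?p0 ?u0 ?z0 ?pi0.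
have pos x : x != 0 -> O x -> exists e : nat, O (x / p ^+ e) /\ O (x / p ^+ e)^-1.
  move=> x0 Ox; have [i] := bounded x x0.
  elim: i => [|i IH ni]; first by rewrite expr0 divr1.
  have [Oi|] := pselect (O (x / p ^+ i)); last exact: IH.
  exists i; split=> //; apply: contrapT => nO; apply: ni.
  rewrite exprSr invfM mulrA; apply: pP => //.
  by rewrite mulf_neq0 ?invr_eq0 ?expf_neq0.
move=> x x0; have [Ox|Ox] := dichO x0.
  by have [e he] := pos x x0 Ox; exists e%:Z.
have xV0 : x^-1 != 0 by rewrite invr_eq0.
have [e [h1 h2]] := pos _ xV0 Ox; exists (- e%:Z).
have -> : x / p ^ (- e%:Z) = (x^-1 / p ^+ e)^-1.
  by rewrite -invr_expz -exprnP invfM !invrK.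
by rewrite invrK.
Qed.

Lemma place_of_valring : exists P : place K, forall x, x != 0 -> O x <-> 0 <= P x.
Proof.
have [p [p0 Op np pP]] := ex_exponent.
have unitX e : O (p ^ e) -> O (p ^ e)^-1 -> e = 0.
  have aux (i : nat) : ~ O (p ^- i.+1).
    elim: i => [|i IH]; rewrite ?expr1 // exprS invfM.
    by apply: not_OM => //; rewrite invr_eq0.
  case: e => [[|i]|i] //.
    by move=> _ /aux.
  by rewrite NegzE -exprnN => /aux.
have /boolp.choice[v vP] : forall x, exists e : int, if x == 0 then e = 0 else
    O (x / p ^ e) /\ O (x / p ^ e)^-1.
  by move=> x; have [_|/pP //] := eqVneq x 0; exists 0.
have vP' x : x != 0 -> O (x / p ^ v x) /\ O (x / p ^ v x)^-1.
  by move=> x0; have := vP x; rewrite (negPf x0).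
have pe0 (e : int) : p ^ e != 0 by rewrite expfz_neq0.
have v_uniq x e : x != 0 -> O (x / p ^ e) -> O (x / p ^ e)^-1 -> v x = e.
  move=> x0 h1 h2; have [h3 h4] := vP' x x0.
  apply/eqP; rewrite -subr_eq0; apply/eqP/unitX.
    rewrite [p ^ _](_ : _ = (x / p ^ e) * (x / p ^ v x)^-1); first exact: OM.
    by rewrite expfzDr // -invr_expz; field; rewrite ?x0 ?pe0.
  rewrite [_^-1](_ : _ = (x / p ^ e)^-1 * (x / p ^ v x)); first exact: OM.
  by rewrite expfzDr // -invr_expz; field; rewrite ?x0 ?pe0.
have O_ge0 x : x != 0 -> O x <-> 0 <= v x.
  move=> x0; have [h3 h4] := vP' x x0; split=> [Ox|].
    rewrite leNgt; apply/negP; case E : (v x) => [//|i] _; move: h3 h4.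
    rewrite E NegzE -exprnN invrK => h3 h4.
    have := OM Ox h4; rewrite invfM mulrA divff // mul1r.
    have -> : p ^- i.+1 = p ^ (- i.+1%:Z) by rewrite exprnN.
    move=> h5; have : - i.+1%:Z = 0 by apply: unitX => //; rewrite -invr_expz invrK; exact: OX.
    by lia.
  case E : (v x) => [i|//] _; move: h3; rewrite E => h3.
  by rewrite -(divfK (pe0 i) x); apply: OM => //; exact: OX.
have vM x y : x != 0 -> y != 0 -> v (x * y) = v x + v y.
  move=> x0 y0; have [a b] := vP' x x0; have [c d] := vP' y y0.
  have e : x * y / p ^ (v x + v y) = (x / p ^ v x) * (y / p ^ v y).
    by rewrite expfzDr //; field; rewrite ?pe0.
  by apply: v_uniq; rewrite ?mulf_neq0 // e ?invfM; apply: OM => //; rewrite -invfM.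
have vN : normalized_valuation v.
  split=> //.
  - by have := vP 0; rewrite eqxx.
  - have half x y : x != 0 -> y != 0 -> x + y != 0 -> v x <= v y -> v x <= v (x + y).
      move=> x0 y0 xy0 le; have : O (1 + y / x).
        apply: OD => //; apply/O_ge0; first by rewrite mulf_neq0 ?invr_eq0.
        have := vM (y / x) x (mulf_neq0 y0 (invr_neq0 x0)) x0; rewrite divfK // => e.
        by lia.
      have e : x + y = x * (1 + y / x) by field.
      have h0 : 1 + y / x != 0 by apply: contraNneq xy0 => h; rewrite e h mulr0.
      by move=> /O_ge0 -/(_ h0); rewrite [in X in _ -> X]e vM //; lia.
    move=> x y x0 y0 xy0; rewrite ge_min.
    have [le|/ltW le] := lerP (v x) (v y); first by rewrite half.
    by rewrite orbC addrC half // addrC.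
  - exists p => //; apply: v_uniq; rewrite ?expr1z ?divff ?invr1 //.
by exists (Place (introT (asboolP _) vN)).
Qed.

End Uniformizer.

Lemma place_of_valuation_ring (s : K) (n : nat) (w : 'I_n -> K) :
  rat_basis k s w -> (exists i, [/\ i != 0, O i & ~ O i^-1]) ->
  exists P : place K, forall x, x != 0 -> O x <-> 0 <= P x.
Proof.
move=> sw nt; have [Os|Os] := dichO (rat_neq0 sw).
  exact: place_of_valring sw Os nt.
exact: place_of_valring (rat_basisV sw) Os nt.
Qed.

End PlaceOfValring.

Lemma bounded_finite (T : choiceType) (A : T -> Prop) (B : nat) :
  (forall s : seq T, uniq s -> (forall x, x \in s -> A x) -> (size s <= B)%N) ->
  exists s : seq T, uniq s /\ forall x, A x <-> x \in s.
Proof.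
move=> h; suff H j (s : seq T) : uniq s -> (forall x, x \in s -> A x) ->
    (B - size s <= j)%N -> exists s : seq T, uniq s /\ forall x, A x <-> x \in s.
  exact: (H B [::] _ _ (leq_subr _ _)).
elim: j s => [|j IH] s us sA le.
  exists s; split=> // x; split; last exact: sA.
  move=> Ax; apply: contraT => xs.
  suff : (size (x :: s) <= B)%N by rewrite /=; lia.
  apply: h => /=; first by rewrite xs.
  by move=> y; rewrite in_cons => /orP[/eqP->//|/sA].
have [[x [Ax xs]]|hn] := pselect (exists x, A x /\ x \notin s); last first.
  exists s; split=> // x; split; last exact: sA.
  by move=> Ax; apply: contraT => xs; case: hn; exists x.
apply: (IH (x :: s)) => /=; first by rewrite xs.
  by move=> y; rewrite in_cons => /orP[/eqP->//|/sA].
by lia.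
Qed.

(** Each representative for [A'] is replaced by an element of [A] whose image lies in its class; a
    representative whose class is not met gets 0, which does no harm in a covering list. *)
Lemma index_le_comap (V W : zmodType) (phi : V -> W) (A B : set V) (A' B' : set W) c :
  is_subgroup B' -> (forall x y, phi (x - y) = phi x - phi y) ->
  (forall x, A x -> A' (phi x)) ->
  (forall x y, A x -> A y -> B' (phi (x - y)) -> B (x - y)) ->
  index_le A' B' c -> index_le A B c.
Proof.
move=> sB' phiB AA BB [s [sc sP]].
have /boolp.choice[g gP] : forall y, exists x,
    (exists x', A x' /\ B' (phi x' - y)) -> A x /\ B' (phi x - y).
  move=> y; have [[x h]|hn] := pselect (exists x', A x' /\ B' (phi x' - y)).
    by exists x.
  by exists 0.
exists [seq g y | y <- s]; split; first by rewrite size_map.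
move=> x Ax; have [y ys hy] := sP _ (AA x Ax).
exists (g y); first exact: map_f.
have [|Ag hg] := gP y; first by exists x.
apply: BB => //; rewrite phiB.
by have := sB'.2 _ _ hy hg; rewrite opprB addrA subrK.
Qed.

(** * Residue degrees and finiteness of zeros and poles *)

Section PlacesOfFunctionField.
Variables (F : finFieldType) (K : fieldType) (k : {rmorphism F -> K}).
Implicit Types (P Q : place K) (x y z : K).

Definition localring P : set K := [set x | ord_ge P 0 x].
Definition localideal P : set K := [set x | ord_ge P 1 x].

Lemma place_const P c : P (k c) = 0.
Proof.
have [->|c0] := eqVneq c 0; first by rewrite rmorph0 place0.
have : P (k c ^+ #|F|) = P (k c) by rewrite -rmorphXn expf_card.
rewrite placeX; case: #|F| (finNzRing_gt1 F) => [//|[//|q]] _.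
rewrite mulrS => /eqP; rewrite -subr_eq0 addrAC subrr add0r mulrn_eq0 /=.
by move/eqP.
Qed.

Lemma ord_ge_const P c : ord_ge P 0 (k c).
Proof. by rewrite /ord_ge place_const lexx orbT. Qed.

Lemma localring_subring P : is_subring (localring P).
Proof.
split; first exact: ord_ge_subgroup.
split; first by rewrite /localring /= /ord_ge place1 lexx orbT.
by move=> x y xO yO; have := ord_geM xO yO; rewrite addr0.
Qed.

Lemma ord_geM0 P N x y : ord_ge P 0 x -> ord_ge P N y -> ord_ge P N (x * y).
Proof. by move=> hx hy; have := ord_geM hx hy; rewrite add0r. Qed.

Lemma ord_geX P x i : ord_ge P 0 x -> ord_ge P 0 (x ^+ i).
Proof.
move=> hx; elim: i => [|i IH]; rewrite ?exprS; last exact: ord_geM0.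
exact: (localring_subring P).2.1.
Qed.

Lemma ord_ge_eval P s f : ord_ge P 0 s -> ord_ge P 0 (evalK k s f).
Proof.
move=> hs; rewrite (evalK_wide _ _ (leqnn _)); apply: ord_ge_sum => i _.
by apply: ord_geM0; [exact: ord_ge_const|exact: ord_geX].
Qed.

Section Basis.
Variables (s : K) (n : nat) (w : 'I_n -> K) (sw : rat_basis k s w).

(** The constant coefficient of an equation of [x] is a multiple of [x] wherever [s] and [x] are
    integral. It does not depend on the place, so the zeros of [x] at which [s] is integral are
    zeros of one polynomial in [s]. *)
Lemma place_zero_poly x : x != 0 -> exists2 f : {poly F}, f != 0 &
  forall P, ord_ge P 0 s -> ord_ge P 1 x -> ord_ge P 1 (evalK k s f).
Proof.
move=> x0; have [R [R0 Rx]] := rat_alg_coef0 sw x0.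
exists R`_0 => // P Ps Px.
move: Rx; rewrite (@horner_coef_wide _ (size R).+1); last first.
  by rewrite (leq_trans (size_poly _ _)).
rewrite big_ord_recl coef_map expr0 mulr1 => /eqP; rewrite addr_eq0 => /eqP -> /=.
rewrite ord_geN; apply: ord_ge_sum => i _; rewrite /bump /= coef_map exprS mulrCA.
rewrite mulrC; apply: ord_geM0 => //.
by apply: ord_geM0; [exact: ord_ge_eval|apply: ord_geX; apply: ord_geW Px].
Qed.

Lemma place_nonneg_zero P : ord_ge P 0 s ->
  exists2 f : {poly F}, f != 0 & ord_ge P 1 (evalK k s f).
Proof.
move=> Ps; have [p p0 Pp] := place_uniformizer P.
have [f f0 fP] := place_zero_poly p0; exists f => //.
by apply: fP => //; rewrite ord_geE // Pp.
Qed.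

Lemma localring_index_bounded_nonneg P : ord_ge P 0 s -> exists B, forall m,
  index_ge (localring P) (localideal P) m -> (m <= B)%N.
Proof.
move=> Ps; have [f f0 Pf] := place_nonneg_zero Ps.
have [D fD] : exists D, size f = D.+1.
  by exists (size f).-1; rewrite prednK // lt0n size_poly_eq0.
exists (#|F| ^ (n * D))%N => m h.
apply: (index_multiples sw (ord_ge_subgroup P 0) _ fD).
  by move=> y; apply: ord_geM0; apply: ord_ge_eval.
apply: index_geW h => // _ [u Ou <-]; rewrite mulrC; exact: ord_geM0.
Qed.

End Basis.

Section Finite.
Variables (s : K) (n : nat) (w : 'I_n -> K) (sw : rat_basis k s w).

Lemma localring_index_bounded P : exists B, forall m,
  index_ge (localring P) (localideal P) m -> (m <= B)%N.
Proof.
have [Ps|Ps] := boolP (ord_ge P 0 s).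
  exact: localring_index_bounded_nonneg sw _ Ps.
apply: (localring_index_bounded_nonneg (rat_basisV sw)).
rewrite ord_geE ?invr_eq0 ?(rat_neq0 sw) // placeV.
by move: Ps; rewrite ord_geE ?(rat_neq0 sw) //; lia.
Qed.

Variable deg : place K -> nat.
Hypothesis deg_ge : forall P, index_ge (localring P) (localideal P) (#|F| ^ deg P).
Hypothesis deg_le : forall P, index_le (localring P) (localideal P) (#|F| ^ deg P).

Let q_gt1 : (1 < #|F|)%N := finNzRing_gt1 F.

Lemma deg_gt0 P : (0 < deg P)%N.
Proof.
have h : index_ge (localring P) (localideal P) 2.
  have sO := localring_subring P.
  have n1 : ~ ord_ge P 1 (1 : K) by rewrite ord_geE ?oner_neq0 // place1.
  exists [:: 0; 1]; split=> //.
  - by rewrite /= inE eq_sym oner_neq0.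
  - move=> x; rewrite !inE => /orP[] /eqP ->; [exact: sO.1.1|exact: sO.2.1].
  - move=> x y; rewrite !inE => /orP[] /eqP -> /orP[] /eqP -> //= hxy.
      by case: n1; move: hxy; rewrite /localideal /= sub0r ord_geN.
    by case: n1; move: hxy; rewrite /localideal /= subr0.
have := index_ge_le (ord_ge_subgroup P 1) h (deg_le P).
by case: (deg P).
Qed.

(** [T] lists the places at which a condition is imposed, and [U] is an effective divisor written as
    a list, a multiplicity being a required order. *)
Definition semilocal (T U : seq (place K)) : set K :=
  [set y | forall P, P \in T -> ord_ge P (count_mem P U)%:Z y].

Lemma semilocal_subgroup T U : is_subgroup (semilocal T U).
Proof.
by split=> [P _|x y hx hy P PT]; [exact: ord_ge0|apply: ord_geB; [exact: hx|exact: hy]].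
Qed.

(** A factor [e] that is a unit at [P] and has high zeros on the rest of [T] gives the elements
    [p ^+ a * r] the required order there, while their classes at [P] stay distinct. *)
Lemma semilocal_step T U P : P \in T ->
  index_ge (semilocal T U) (semilocal T (P :: U)) (#|F| ^ deg P).
Proof.
move=> PT; have [R [<- uR RO Rinj]] := deg_ge P.
have [p p0 Pp] := place_uniformizer P; set a := count_mem P U.
have pa0 : p ^+ a != 0 by rewrite expf_neq0.
pose B := (\sum_(Q <- T) \sum_(r <- R) `|(Q (p ^+ a * r))%R|)%N.
have BP Q r : Q \in T -> r \in R -> (`|(Q (p ^+ a * r))%R| <= B)%N.
  move=> QT rR; rewrite /B (big_rem Q) //=; apply: leq_trans (leq_addr _ _).
  by rewrite (big_rem r) //= leq_addr.
(* [M] covers the order required at [Q] together with any pole of [p ^+ a * r] there; being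
   positive, it also makes [e] a unit at [P]. *)
have [M hM] : exists M, (0 < M)%N /\ forall Q, (count_mem Q U + B <= M)%N.
  exists (size U + B).+1; split=> // Q.
  by rewrite leqW // leq_add2r; exact: count_size.
have [|e [eP eQ]] := @weak_approx _ P [seq Q <- T | Q != P] M.
  by rewrite mem_filter eqxx.
have [e0 Pe] : e != 0 /\ P e = 0.
  rewrite -[e](subrK 1) addrC; apply: place1Dpos; apply: ord_geW eP; have := hM.1; lia.
exists [seq p ^+ a * r * e | r <- R]; split.
- by rewrite size_map.
- rewrite map_inj_uniq // => r r'; rewrite -!mulrA => /(mulfI pa0).
  exact: (mulIf e0).
- move=> _ /mapP[r rR ->] Q QT; have [->|QP] := eqVneq Q P.
    rewrite mulrAC mulrC; apply: ord_geM0; first exact: RO.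
    by rewrite ord_geE ?mulf_neq0 // placeM // placeX Pp Pe addr0 natz.
  have [r0|r0] := eqVneq r 0; first by rewrite r0 mulr0 mul0r ord_ge0.
  rewrite ord_geE ?mulf_neq0 // placeM ?mulf_neq0 //.
  have := eQ Q; rewrite mem_filter QP QT ord_geE // => /(_ isT) hQ.
  have hB : - B%:Z <= Q (p ^+ a * r) by have := BP Q r QT rR; lia.
  by apply: le_trans (lerD hB hQ); have := hM.2 Q; lia.
- move=> _ _ /mapP[r rR ->] /mapP[r' rR' ->] /(_ P PT).
  rewrite /= eqxx -mulrBl -mulrBr => h.
  suff -> : r = r' by [].
  apply: Rinj => //; rewrite /localideal /=.
  have [->|d0] := eqVneq (r - r') 0; first exact: ord_ge0.
  move: h; rewrite !ord_geE ?mulf_neq0 // !placeM ?mulf_neq0 // placeX Pp Pe natz -/a.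
  by rewrite addr0 addnC PoszD lerD2l.
Qed.

Lemma semilocal_index T U : {subset U <= T} ->
  index_ge (semilocal T [::]) (semilocal T U) (#|F| ^ (\sum_(P <- U) deg P)).
Proof.
elim: U => [_|P U IH UT].
  rewrite big_nil; exists [:: 0]; split=> //.
    by move=> x; rewrite inE => /eqP ->; exact: (semilocal_subgroup _ _).1.
  by move=> x y; rewrite !inE => /eqP -> /eqP ->.
rewrite big_cons addnC expnD.
have PT : P \in T by apply: UT; rewrite mem_head.
have mono V W : (forall Q, count_mem Q V <= count_mem Q W)%N ->
    semilocal T W `<=` semilocal T V.
  by move=> VW y hy Q QT; apply: ord_geW (hy Q QT); rewrite lez_nat.
apply: (@index_ge_trans _ _ (semilocal T U)); try exact: semilocal_subgroup.
- by apply: mono => Q.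
- by apply: mono => Q; rewrite /= leq_addl.
- by apply: IH => Q QU; apply: UT; rewrite in_cons QU orbT.
- exact: semilocal_step.
Qed.

(** The multiples of [f] in the semilocal ring of [T] vanish on [T], so their index is at least
    [#|F|] to the sum of the degrees, while [index_multiples] bounds it by [#|F| ^ (n * D)]. *)
Lemma zeros_bound (f : {poly F}) D (T : seq (place K)) : size f = D.+1 ->
  (forall P, P \in T -> ord_ge P (count_mem P T)%:Z (evalK k s f)) ->
  (\sum_(P <- T) deg P <= n * D)%N.
Proof.
move=> fD hT; rewrite -(leq_exp2l _ _ q_gt1).
have h0 P : P \in T -> ord_ge P 0 (evalK k s f) by move=> /hT; apply: ord_geW.
apply: (index_multiples sw (semilocal_subgroup T [::]) _ fD).
  by move=> y hy P PT; apply: ord_geM0; [exact: h0|exact: hy].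
apply: index_geW (semilocal_index (fun P => id)) => // _ [u Ou <-] P PT.
by rewrite mulrC; apply: ord_geM0; [exact: Ou|exact: hT].
Qed.

Lemma finite_zeros_poly (f : {poly F}) : f != 0 ->
  exists T : seq (place K), forall P, ord_ge P 1 (evalK k s f) -> P \in T.
Proof.
move=> f0; have [D fD] : exists D, size f = D.+1.
  by exists (size f).-1; rewrite prednK // lt0n size_poly_eq0.
have [T uT hT|T [_ TP]] :=
    @bounded_finite _ (fun P => ord_ge P 1 (evalK k s f) : Prop) (n * D).
  apply: leq_trans (@zeros_bound f D T fD _).
    rewrite -sum1_size !big_seq leq_sum // => P _; exact: deg_gt0.
  by move=> P PT; rewrite count_uniq_mem // PT; apply: hT.
by exists T => P /TP.
Qed.

End Finite.

Section Divisors.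
Variables (s : K) (n : nat) (w : 'I_n -> K) (sw : rat_basis k s w).
Variable deg : place K -> nat.
Hypothesis deg_ge : forall P, index_ge (localring P) (localideal P) (#|F| ^ deg P).
Hypothesis deg_le : forall P, index_le (localring P) (localideal P) (#|F| ^ deg P).

Lemma finite_poles : exists T : seq (place K), forall P, P s < 0 -> P \in T.
Proof.
have [|T TP] := finite_zeros_poly (rat_basisV sw) deg_ge deg_le (f := 'X).
  by rewrite polyX_eq0.
exists T => P Ps; apply: TP; rewrite evalKX ord_geE ?invr_eq0 ?(rat_neq0 sw) //.
by rewrite placeV; lia.
Qed.

Lemma finite_zeros x : x != 0 ->
  exists T : seq (place K), forall P, 0 < P x -> P \in T.
Proof.
move=> x0; have [f f0 fP] := place_zero_poly sw x0.
have [T TP] := finite_poles; have [U UP] := finite_zeros_poly sw deg_ge deg_le f0.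
exists (T ++ U) => P Px; rewrite mem_cat.
have [Ps|Ps] := ltP (P s) 0; first by rewrite TP.
by rewrite UP ?orbT //; apply: fP; rewrite ord_geE ?(rat_neq0 sw).
Qed.

Lemma finite_support x : exists T : seq (place K), forall P, P x != 0 -> P \in T.
Proof.
have [->|x0] := eqVneq x 0; first by exists [::] => P; rewrite place0 eqxx.
have [T TP] := finite_zeros x0.
have [|U UP] := @finite_zeros x^-1; first by rewrite invr_eq0.
exists (T ++ U) => P Px; rewrite mem_cat.
have [Ps|Ps|Ps] := ltgtP (P x) 0; last by rewrite Ps in Px.
  by rewrite UP ?orbT // placeV; lia.
by rewrite TP.
Qed.

End Divisors.
End PlacesOfFunctionField.

(** * Divisors and their coefficients *)

Lemma divisor_of_fun (K : fieldType) (v : place K -> int) (T : seq (place K)) :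
  (forall P, v P != 0 -> P \in T) -> exists D : divisor K, forall P, coeff P D = v P.
Proof.
move=> vT; exists (\sum_(P <- undup T) << v P *g P >>) => P.
rewrite raddf_sum /=; have [PT|PT] := boolP (P \in T).
  rewrite (bigD1_seq P) ?mem_undup ?undup_uniq //= coeffU eqxx mulr1.
  rewrite big1 ?addr0 // => Q QP; by rewrite coeffU (negPf QP) mulr0.
rewrite big_seq big1 => [|Q].
  by apply/esym/eqP; apply: contraNT PT => /vT.
rewrite mem_undup coeffU => QT; case: eqP => [e|_]; last by rewrite mulr0.
by rewrite -e QT in PT.
Qed.

Section DivisorBasics.
Variable K : fieldType.
Implicit Types (P Q : place K) (D E : divisor K).

Definition sumdiv (T : seq (place K)) : divisor K := \sum_(P <- T) << P >>.

Lemma coeff_sumdiv T P : coeff P (sumdiv T) = count_mem P T.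
Proof.
rewrite /sumdiv; elim: T => [|Q T IH]; first by rewrite big_nil coeff0.
by rewrite big_cons coeffD IH /= coeffU mul1r PoszD; case: eqP.
Qed.

Lemma div_ext D E : (forall P, coeff P D = coeff P E) -> D = E.
Proof. by move=> h; apply/eqP/freeg_eqP. Qed.

Lemma effectiveP D : (forall P, 0 <= coeff P D) -> exists T, D = sumdiv T.
Proof.
move=> D0; exists (flatten [seq nseq `|coeff P D| P | P <- dom D]).
apply: div_ext => P; rewrite coeff_sumdiv count_flatten -map_comp sumnE big_map.
have [PD|PD] := boolP (P \in dom D).
  rewrite (bigD1_seq P) ?uniq_dom //= count_nseq /= eqxx mul1n big1 ?addn0.
    by have := D0 P; lia.
  by move=> Q QP; rewrite /= count_nseq /= (negPf QP).
rewrite coeff_outdom // big_seq big1 // => Q QD; rewrite /= count_nseq /=.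
by case: eqP QD PD => // -> ->.
Qed.

(* The default value 0 is never reached on a function field. *)
Definition pdiv (x : K) : divisor K :=
  xget 0 [set D | forall P, coeff P D = P x].

End DivisorBasics.

(** * Riemann's theorem *)

Section RiemannInequality.
Variables (F : finFieldType) (K : fieldType) (k : {rmorphism F -> K}).
Variables (s : K) (n : nat) (w : 'I_n -> K) (sw : rat_basis k s w).
Variable deg : place K -> nat.
Hypothesis deg_ge : forall P, index_ge (localring P) (localideal P) (#|F| ^ deg P).
Hypothesis deg_le : forall P, index_le (localring P) (localideal P) (#|F| ^ deg P).
Implicit Types (P Q : place K) (x y z : K) (D E : divisor K).

Definition fdeg (D : divisor K) : int :=
  fglift (fun P : place K => (deg P)%:Z : int^o) D.

Fact fdeg_zmod_morphism : zmod_morphism fdeg.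
Proof.
have := @lift_is_additive int (place K) int^o (fun P => (deg P)%:Z : int^o).
exact.
Qed.

HB.instance Definition _ :=
  GRing.isZmodMorphism.Build (divisor K) int fdeg fdeg_zmod_morphism.

Lemma fdegU P : fdeg << P >> = deg P.
Proof. by rewrite /fdeg liftU scale1r. Qed.

Lemma fdeg_sumdiv T : fdeg (sumdiv T) = (\sum_(P <- T) deg P)%N.
Proof.
rewrite /sumdiv; elim: T => [|P T IH]; first by rewrite !big_nil raddf0.
by rewrite !big_cons raddfD /= IH fdegU.
Qed.

Lemma ex_div x : exists D : divisor K, forall P, coeff P D = P x.
Proof.
have [T TP] := finite_support sw deg_ge deg_le x.
exact: divisor_of_fun TP.
Qed.

Lemma coeff_pdiv P x : coeff P (pdiv x) = P x.
Proof.
have [D hD] := ex_div x; rewrite /pdiv.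
by case: xgetP => [D' _ hD'|/(_ D) []].
Qed.

Lemma pdivM x y : x != 0 -> y != 0 -> pdiv (x * y) = pdiv x + pdiv y.
Proof. by move=> x0 y0; apply: div_ext => P; rewrite coeffD !coeff_pdiv placeM. Qed.

Lemma pdivV x : pdiv x^-1 = - pdiv x.
Proof. by apply: div_ext => P; rewrite coeffN !coeff_pdiv placeV. Qed.

Lemma pdivX x i : pdiv (x ^+ i) = pdiv x *+ i.
Proof. by apply: div_ext => P; rewrite coeffMn !coeff_pdiv placeX. Qed.

Definition RR D : set K := [set x | forall P, ord_ge P (- coeff P D) x].

Lemma RR_subgroup D : is_subgroup (RR D).
Proof.
by split=> [P|x y hx hy P]; [exact: ord_ge0|apply: ord_geB; [exact: hx|exact: hy]].
Qed.

(** Multiplication by [a], of order [coeff P D + 1] at [P], sends the larger space into the local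
    ring and detects [RR D] by vanishing at [P]. *)
Lemma RR_step D P : index_le (RR (D + << P >>)) (RR D) (#|F| ^ deg P).
Proof.
have [p p0 Pp] := place_uniformizer P.
pose a := p ^ (coeff P D + 1).
have a0 : a != 0 by rewrite expfz_neq0.
have Pa : P a = coeff P D + 1 by rewrite placeXz Pp mul1r.
have coefP : coeff P (D + << P >>) = coeff P D + 1 by rewrite coeffD coeffU eqxx mul1r.
apply: (@index_le_comap _ _ (fun x => x * a) _ _ (localring P) (localideal P)) => //.
- exact: ord_ge_subgroup.
- by move=> x y; rewrite mulrBl.
- move=> x /(_ P); rewrite coefP /localring /= => hx.
  have := ord_geM hx (_ : ord_ge P (coeff P D + 1) a).
  by rewrite addNr; apply; rewrite ord_geE // Pa.
- move=> x y hx hy; rewrite /localideal /= => hxy Q.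
  have [->|QP] := eqVneq Q P.
    have [->|d0] := eqVneq (x - y) 0; first exact: ord_ge0.
    move: hxy; rewrite !ord_geE ?mulf_neq0 // placeM // Pa; lia.
  have := (RR_subgroup (D + << P >>)).2 _ _ hx hy Q.
  by rewrite coeffD coeffU eq_sym (negPf QP) mulr0 addr0.
Qed.

Lemma index_le_refl (V : zmodType) (A : set V) : is_subgroup A -> index_le A A 1.
Proof.
by move=> sA; exists [:: 0]; split=> // x Ax; exists 0; rewrite ?inE // subr0.
Qed.

Lemma RR_chain D T :
  index_le (RR (D + sumdiv T)) (RR D) (#|F| ^ (\sum_(P <- T) deg P)).
Proof.
rewrite /sumdiv; elim: T => [|P T IH].
  by rewrite !big_nil addr0; apply: index_le_refl; exact: RR_subgroup.
rewrite !big_cons expnD [<< P >> + _]addrC addrA.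
exact: index_le_trans (RR_step _ _) IH.
Qed.

Lemma RR_shift D x m : x != 0 ->
  index_ge (RR D) [set 0] m -> index_ge (RR (D - pdiv x)) [set 0] m.
Proof.
move=> x0 [r [rm ur rD rinj]]; exists [seq y * x | y <- r]; split.
- by rewrite size_map.
- by rewrite map_inj_uniq //; apply: mulIf.
- move=> _ /mapP[y /rD yD ->] P.
  rewrite coeffB coeff_pdiv opprB addrC; apply: ord_geM (yD P) _.
  by rewrite ord_geE.
- by move=> _ _ /mapP[y _ ->] /mapP[z _ ->] /= /eqP; rewrite subr_eq0 => /eqP.
Qed.

(** At a zero of [x] the nonzero term of lowest degree has strictly smaller order than all the
    others. *)
Lemma transcendental_zero P x f : x != 0 -> 0 < P x -> f != 0 -> evalK k x f != 0.
Proof.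
move=> x0 Px; elim/poly_ind: f => [|f c IH]; first by rewrite eqxx.
have [->|c0] := eqVneq c 0.
  rewrite addr0 mulf_eq0 polyX_eq0 orbF => /IH f0.
  by rewrite rmorphM /= evalKX mulf_neq0.
move=> _; rewrite rmorphD rmorphM /= evalKX evalKC addrC.
have kc0 : k c != 0 by rewrite fmorph_eq0.
have [|//] := @placeDl _ P (k c) (evalK k x f * x) kc0.
rewrite place_const add0r; apply: ord_geM0; last by rewrite ord_geE //.
by apply: ord_ge_eval; rewrite ord_geE //; lia.
Qed.

(** [chevalley] is applied to the ring of polynomials in [z] and the ideal generated by [z], which
    the hypothesis makes proper. *)
Lemma place_with_zero z : z != 0 -> (forall f, z * evalK k z f != 1) ->
  exists P : place K, 0 < P z.
Proof.
move=> z0 hz.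
pose A : set K := [set evalK k z f | f in [set: {poly F}]].
pose I : set K := [set z * evalK k z f | f in [set: {poly F}]].
have sA : is_subring A.
  split; [split|split].
  - by exists 0; rewrite // rmorph0.
  - by move=> _ _ [f _ <-] [g _ <-]; exists (f - g); rewrite // rmorphB.
  - by exists 1; rewrite // rmorph1.
  - by move=> _ _ [f _ <-] [g _ <-]; exists (f * g); rewrite // rmorphM.
have sI : is_proper_ideal A I.
  split; last split; last split.
  - split; first by exists 0; rewrite // rmorph0 mulr0.
    by move=> _ _ [f _ <-] [g _ <-]; exists (f - g); rewrite // rmorphB mulrBr.
  - by move=> _ [f _ <-]; exists ('X * f); rewrite // rmorphM /= evalKX.
  - by move=> [f _ /eqP]; apply/negP; exact: hz.
  - by move=> _ _ [f _ <-] [g _ <-]; exists (f * g); rewrite // rmorphM mulrCA.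
have [O [sO AO dich nI]] := chevalley sA sI.
have Iz : I z by exists 1; rewrite // rmorph1 mulr1.
have nz := nI z Iz z0.
have kO c : O (k c) by apply: AO; exists c%:P; rewrite // evalKC.
have [|P PO] := place_of_valuation_ring sO kO dich sw.
  by exists z; split=> //; have [] := dich z z0.
exists P; rewrite ltNge; apply/negP => Pz; apply: nz; apply/PO; rewrite ?invr_eq0 //.
by rewrite placeV; lia.
Qed.

Lemma exists_place : exists P : place K, 0 < P s.
Proof.
apply: place_with_zero (rat_neq0 sw) _ => f; rewrite -[X in X * _](evalKX k).
rewrite -rmorphM -subr_eq0 -(rmorph1 (evalK k s)) -rmorphB (evalK_eq0 sw).
rewrite subr_eq0; apply/eqP => /(congr1 (horner_eval 0)).
by rewrite /horner_eval !hornerE => /eqP; rewrite eq_sym oner_eq0.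
Qed.

Lemma exists_pole P x : 0 < P x -> exists Q, Q x < 0.
Proof.
move=> Px; have x0 : x != 0 by apply: contraTneq Px => ->; rewrite place0.
have [||Q Qx] := @place_with_zero x^-1; rewrite ?invr_eq0 //; last first.
  by exists Q; move: Qx; rewrite placeV; lia.
move=> f; apply/negP => /eqP e; set m := size f.
(* Multiplied by [x ^+ m], a relation [1 = x^-1 * f(x^-1)] becomes a monic equation of degree [m]
   for [x], which a zero at [P] forbids. *)
pose g : {poly F} := \poly_(i < m) f`_(m.-1 - i).
have gx : x ^+ m = evalK k x g.
  rewrite -[LHS]mul1r -e (evalK_wide k x (n := m)) ?size_poly //.
  rewrite (evalK_wide k _ (leqnn (size f))) mulr_sumr mulr_suml.
  rewrite (reindex_inj rev_ord_inj); apply: eq_bigr => -[i im] _ /=.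
  have im' : (i <= m.-1)%N by rewrite -ltnS prednK // (leq_ltn_trans _ im).
  rewrite coef_poly im mulrCA -!mulrA (_ : m - i.+1 = m.-1 - i)%N; last by lia.
  congr (_ * _); rewrite mulrA -exprS exprVn.
  have -> : m = ((m.-1 - i).+1 + i)%N by lia.
  by rewrite addnK /= exprD mulrA mulVf ?mul1r // expf_neq0.
have h0 : 'X^m - g != 0.
  apply/eqP => /(congr1 (fun p : {poly F} => p`_m)).
  rewrite coefB coefXn eqxx coef_poly ltnn subr0 coef0 => /eqP.
  by rewrite oner_eq0.
have := transcendental_zero x0 Px h0.
by rewrite rmorphB rmorphXn /= evalKX gx subrr eqxx.
Qed.

Lemma RR0_place P x : RR 0 x -> x != 0 -> P x = 0.
Proof.
move=> hx x0; have h0 Q : 0 <= Q x by have := hx Q; rewrite coeff0 oppr0 ord_geE.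
apply/eqP; rewrite eq_le h0 andbT leNgt; apply/negP => /exists_pole[Q Qx].
by have := h0 Q; lia.
Qed.

(** A nonzero function without poles has no zeros, so [RR 0] embeds into a single residue field. *)
Lemma RR0_finite : exists d : nat, index_le (RR 0) [set 0] (#|F| ^ d).
Proof.
have [P _] := exists_place; exists (deg P).
apply: (@index_le_comap _ _ id _ _ (localring P) (localideal P)) => //.
- exact: ord_ge_subgroup.
- by move=> x /(_ P); rewrite coeff0 oppr0.
- move=> x y hx hy hxy; apply/eqP; apply: contraT => d0.
  have := RR0_place P ((RR_subgroup 0).2 _ _ hx hy) d0.
  move: hxy; rewrite /localideal /= ord_geE //; lia.
Qed.

End RiemannInequality.

Section RiemannTheorem.
Variables (F : finFieldType) (K : fieldType) (k : {rmorphism F -> K}).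
Variables (s : K) (n : nat) (w : 'I_n -> K) (sw : rat_basis k s w).
Variable deg : place K -> nat.
Hypothesis deg_ge : forall P, index_ge (localring P) (localideal P) (#|F| ^ deg P).
Hypothesis deg_le : forall P, index_le (localring P) (localideal P) (#|F| ^ deg P).
Implicit Types (P Q : place K) (x y z : K) (D E : divisor K).

Let q_gt1 : (1 < #|F|)%N := finNzRing_gt1 F.
Let degP_gt0 := deg_gt0 deg_le.
Local Notation coeff_pdiv := (coeff_pdiv sw deg_ge deg_le).
Local Notation pdivV := (pdivV sw deg_ge deg_le).
Local Notation pdivX := (pdivX sw deg_ge deg_le).
Local Notation fdeg := (fdeg deg).

Let ex_poles x : exists D : divisor K, forall P, coeff P D = Num.max 0 (- P x).
Proof.
have [T TP] := finite_support sw deg_ge deg_le x.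
apply: (@divisor_of_fun _ _ T) => P h; apply: TP; apply: contraNneq h => ->.
by rewrite oppr0 maxxx.
Qed.

Definition poles x : divisor K := projT1 (cid (ex_poles x)).

Lemma coeff_poles P x : coeff P (poles x) = Num.max 0 (- P x).
Proof. by rewrite /poles; case: cid => D /= ->. Qed.

Lemma coeff_poles_ge0 P x : 0 <= coeff P (poles x).
Proof. by rewrite coeff_poles le_max lexx. Qed.

Lemma ord_ge_poles P x : ord_ge P (- coeff P (poles x)) x.
Proof.
rewrite /ord_ge coeff_poles; apply/orP; right.
by rewrite lerNl le_max lexx orbT.
Qed.

Let H := poles s.
Let C0 := \sum_(i < n) poles (w i).

Let coeffC0_ge0 P : 0 <= coeff P C0.
Proof. by rewrite raddf_sum sumr_ge0 // => i _; exact: coeff_poles_ge0. Qed.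

(** The elements are the combinations of the [w i] with polynomials of degree at most [m] in [s] as
    coefficients; [C0] allows for the poles of the [w i]. *)
Lemma RR_lower m : index_ge (RR (H *+ m + C0)) [set 0] (#|F| ^ (n * m.+1)).
Proof.
pose poly_of (c : {ffun 'I_m.+1 -> F}) : {poly F} := \poly_(l < m.+1) c (inord l).
pose elt (c : {ffun 'I_n -> {ffun 'I_m.+1 -> F}}) := \sum_i evalK k s (poly_of (c i)) * w i.
have elt_inj : injective elt.
  move=> c d e; have h : \sum_i evalK k s (poly_of (c i) - poly_of (d i)) * w i = 0.
    under eq_bigr do rewrite rmorphB mulrBl.
    by rewrite sumrB -/(elt c) -/(elt d) e subrr.
  apply/ffunP => i; apply/ffunP => l.
  have /eqP := rat_free sw h i; rewrite subr_eq0 => /eqP/(congr1 (fun p : {poly F} => p`_l)).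
  by rewrite !coef_poly ltn_ord inord_val.
exists [seq elt c | c <- enum {ffun 'I_n -> {ffun 'I_m.+1 -> F}}]; split.
- by rewrite size_map -cardE !card_ffun !card_ord -expnM mulnC.
- by rewrite map_inj_uniq // enum_uniq.
- move=> _ /mapP[c _ ->] P; apply: ord_ge_sum => i _.
  rewrite coeffD opprD; apply: ord_geM; last first.
    apply: ord_geW (ord_ge_poles P (w i)); rewrite lerN2 raddf_sum (bigD1 i) //=.
    by rewrite lerDl sumr_ge0 // => j _; exact: coeff_poles_ge0.
  rewrite (@evalK_wide _ _ k s _ m.+1) ?size_poly //; apply: ord_ge_sum => l _.
  apply: ord_geM0; first exact: ord_ge_const.
  rewrite ord_geE ?expf_neq0 ?(rat_neq0 sw) // placeX coeffMn.
  have := ord_ge_poles P s; rewrite ord_geE ?(rat_neq0 sw) // => h.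
  have := coeff_poles_ge0 P s; have lm : (l <= m)%N by rewrite -ltnS.
  rewrite -/H in h *; move: h; set a := coeff P H; set b := P s => h a0.
  rewrite -mulNrn; apply: (@le_trans _ _ (- a *+ l)); last by rewrite lerMn2r h orbT.
  by rewrite !mulNrn lerN2 ler_wpMn2l.
- by move=> _ _ /mapP[c _ ->] /mapP[d _ ->] /= /eqP; rewrite subr_eq0 => /eqP.
Qed.

Lemma fdeg_poles_ge : n%:Z <= fdeg H.
Proof.
have [d d0] := RR0_finite sw deg_le.
have [T TH] := effectiveP (fun P => coeff_poles_ge0 P s).
have [U UC] := effectiveP coeffC0_ge0.
rewrite -/H in TH; rewrite TH fdeg_sumdiv lez_nat leqNgt; apply/negP => lt.
set h := (\sum_(P <- T) deg P)%N in lt.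
pose c := (\sum_(P <- U) deg P)%N.
(* Comparing [RR_lower] with [RR_chain] gives [n * m.+1 <= h * m + c + d]; for [m = d + c] the right
   side is [h.+1 * m], at most [n * m] if [h < n]. *)
pose m := (d + c)%N.
pose V := flatten (nseq m T) ++ U.
have VE : sumdiv V = H *+ m + C0.
  rewrite /sumdiv /V big_cat big_flatten big_nseq /= UC TH; congr (_ + _).
  by elim: (m) => [|j IH]; rewrite ?mulr0n // iterS IH mulrS.
have VD : (\sum_(P <- V) deg P = h * m + c)%N.
  rewrite /V big_cat big_flatten big_nseq /=; congr (_ + _)%N.
  by elim: (m) => [|j IH]; rewrite ?muln0 // iterS IH mulnS.
have := index_le_trans (RR_chain deg_le 0 V) d0.
rewrite add0r VE VD -expnD => hle.
have := index_ge_le (subgroup_set0 K) (RR_lower m) hle.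
rewrite leq_exp2l // /m; nia.
Qed.

Lemma fdeg_poles_le : fdeg H <= n%:Z.
Proof.
have [T TH] := effectiveP (fun P => coeff_poles_ge0 P s).
rewrite -/H in TH; rewrite TH fdeg_sumdiv lez_nat.
have := zeros_bound (rat_basisV sw) deg_ge (f := 'X) (T := T) (size_polyX _).
rewrite muln1; apply => P PT; rewrite evalKX ord_geE ?invr_eq0 ?(rat_neq0 sw) //.
have : (0 < count_mem P T)%N by rewrite -has_count has_pred1.
have := coeff_sumdiv T P; rewrite -TH coeff_poles placeV => e.
move: e; set a := P s; set c := count_mem P T; move=> e c0.
have : Num.max 0 (- a) = - a by move: e; case: (lerP 0 (- a)); lia.
by move=> <-; rewrite e.
Qed.

Lemma place_eval_unit P x (f : {poly F}) : ord_ge P 1 x -> f`_0 != 0 -> P (evalK k x f) = 0.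
Proof.
move=> Px; elim/poly_ind: f => [|f c _]; first by rewrite coef0 eqxx.
rewrite coefD coefMX coefC add0r /= => c0.
rewrite rmorphD rmorphM /= evalKX evalKC addrC.
have kc0 : k c != 0 by rewrite fmorph_eq0.
rewrite -[RHS](place_const k P c); apply: (placeDl kc0 _).2.
rewrite place_const add0r; apply: ord_geM0 => //.
by apply: ord_ge_eval; apply: ord_geW Px.
Qed.

Lemma place_eval_pole P (f : {poly F}) (D : nat) : P s < 0 -> size f = D.+1 ->
  P (evalK k s f) = P s *+ D.
Proof.
move=> Ps fD; have s0 := rat_neq0 sw.
have f0 : f != 0 by rewrite -size_poly_eq0 fD.
have := evalK_revp sw (m := D) (f := f); rewrite fD => /(_ (leqnn _)) e.
have := @place_eval_unit P s^-1 (revp D f).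
rewrite ord_geE ?invr_eq0 // placeV e placeM ?invr_eq0 ?expf_neq0 //; last first.
  by rewrite (evalK_eq0 sw).
rewrite placeV placeX coef_poly subn0 /=.
have -> : f`_D != 0.
  by move: f0; rewrite -lead_coef_eq0 lead_coefE fD.
have -> : (1 <= - P s) by lia.
by move=> /(_ isT isT) /eqP; rewrite addrC subr_eq0 => /eqP.
Qed.

(** Adding [D] times the poles of [s] to the divisor of [f(s)] leaves an effective divisor, of
    degree at most [n * D] by [zeros_bound], and what was added has degree exactly [n * D]. *)
Lemma fdeg_poly_le0 (f : {poly F}) : f != 0 -> fdeg (pdiv (evalK k s f)) <= 0.
Proof.
move=> f0; have [D fD] : exists D : nat, size f = D.+1.
  by exists (size f).-1; rewrite prednK // lt0n size_poly_eq0.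
have fs0 : evalK k s f != 0 by rewrite (evalK_eq0 sw).
pose Z := pdiv (evalK k s f) + H *+ D.
have coefZ P : coeff P Z = if P s < 0 then 0 else P (evalK k s f).
  rewrite /Z coeffD coeffMn coeff_pdiv coeff_poles; case: ltP => Ps.
    rewrite (place_eval_pole Ps fD) (_ : Num.max 0 (- P s) = - P s).
      by rewrite mulNrn subrr.
    by apply/max_idPr; lia.
  rewrite (_ : Num.max 0 (- P s) = 0) ?mul0rn ?addr0 //.
  by apply/max_idPl; lia.
have pos P : 0 <= P s -> 0 <= P (evalK k s f).
  move=> Ps; have := @ord_ge_eval _ _ k P s f.
  by rewrite !ord_geE ?(rat_neq0 sw) // => ->.
have [T TZ] : exists T, Z = sumdiv T.
  by apply: effectiveP => P; rewrite coefZ; case: ltP => // /pos.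
have : fdeg Z <= (n * D)%N.
  rewrite TZ fdeg_sumdiv lez_nat.
  apply: (zeros_bound sw deg_ge fD) => P PT.
  have : (0 < count_mem P T)%N by rewrite -has_count has_pred1.
  rewrite ord_geE //; have := coeff_sumdiv T P; rewrite -TZ coefZ.
  by case: ltP => _ e; last rewrite e //; move: e; case: (count_mem P T).
rewrite /Z raddfD raddfMn /=.
have -> : fdeg H = n by apply/eqP; rewrite eq_le fdeg_poles_le fdeg_poles_ge.
by rewrite -mulr_natr natz -PoszM gerDr.
Qed.

(** A polynomial in [s] with zeros at the places of [D] where [s] is integral reduces the positive
    part of [D] to poles of [s], and these are covered by a multiple of [H]. *)
Lemma dominated D : exists (f : {poly F}) m, f != 0 /\
  forall P, coeff P (D - pdiv (evalK k s f)) <= coeff P (H *+ m + C0).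
Proof.
have /boolp.choice[g gP] : forall P, exists f : {poly F}, f != 0 /\
    (ord_ge P 0 s -> ord_ge P 1 (evalK k s f)).
  move=> P; have [Ps|Ps] := boolP (ord_ge P 0 s).
    by have [f f0 hf] := place_nonneg_zero sw Ps; exists f.
  by exists 1; rewrite oner_eq0.
pose f := \prod_(P <- dom D) g P ^+ `|coeff P D|.
have f0 : f != 0.
  by rewrite /f prodf_seq_neq0; apply/allP => P _ /=; rewrite expf_neq0 // (gP P).1.
have fs0 : evalK k s f != 0 by rewrite (evalK_eq0 sw).
have key P : 0 <= P s -> coeff P D <= P (evalK k s f).
  move=> Ps; have hs : ord_ge P 0 s by rewrite ord_geE ?(rat_neq0 sw).
  have [PD|PD] := boolP (P \in dom D); last first.
    rewrite coeff_outdom //; have := @ord_ge_eval _ _ k P s f hs.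
    by rewrite ord_geE.
  rewrite -ord_geE // /f (big_rem P) //= rmorphM rmorphXn /= mulrC.
  apply: ord_geM0; first exact: ord_ge_eval.
  have gs0 : evalK k s (g P) != 0 by rewrite (evalK_eq0 sw) (gP P).1.
  rewrite ord_geE ?expf_neq0 // placeX.
  have := (gP P).2 hs; rewrite ord_geE // => h1.
  apply: (@le_trans _ _ (1 *+ `|coeff P D|)); first by rewrite natz; lia.
  by rewrite lerMn2r h1 orbT.
pose E := D - pdiv (evalK k s f).
exists f, (\sum_(P <- dom E) `|coeff P E|)%N; split=> // P.
have hC := coeffC0_ge0 P; rewrite [leRHS]coeffD coeffMn.
have hH := coeff_poles_ge0 P s.
have [Ps|Ps] := ltP (P s) 0; last first.
  have := key P Ps; rewrite coeffB coeff_pdiv.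
  have := mulrn_wge0 (\sum_(P <- dom E) `|coeff P E|)%N hH; rewrite -/H; lia.
have h1 : 1 <= coeff P H by rewrite coeff_poles; lia.
apply: (@le_trans _ _ (coeff P H *+ (\sum_(P <- dom E) `|coeff P E|)%N)); last by lia.
apply: (@le_trans _ _ (1 *+ (\sum_(P <- dom E) `|coeff P E|)%N)); last first.
  by rewrite lerMn2r h1 orbT.
rewrite natz -/E; have [PE|PE] := boolP (P \in dom E); last by rewrite coeff_outdom.
rewrite (big_rem P) //= PoszD; have := abszE (coeff P E); lia.
Qed.

(** Replace [D] by an equivalent [D'] below [H *+ m + C0]. Descending to [D'], the lower bound at
    the larger divisor loses at most a factor [#|F|] per unit of degree. As [H] has degree [n], the
    dependence on [m] cancels and the degree of [C0] is left as [c]. *)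
Lemma riemann : exists c : nat, forall D (e : nat), e%:Z + c%:Z <= fdeg D ->
  index_ge (RR D) [set 0] (#|F| ^ e).
Proof.
have [U UC] := effectiveP coeffC0_ge0.
exists (\sum_(P <- U) deg P)%N => D e le.
have [f [m [f0 hf]]] := dominated D.
set D' := D - pdiv (evalK k s f) in hf.
have fs0 : evalK k s f != 0 by rewrite (evalK_eq0 sw).
have [T TE] : exists T, H *+ m + C0 - D' = sumdiv T.
  by apply: effectiveP => P; rewrite coeffB subr_ge0.
have TE' : H *+ m + C0 = D' + sumdiv T by rewrite -TE [RHS]addrC subrK.
have := RR_lower m; rewrite TE' => hge.
have hsub : [set 0] `<=` RR D' by move=> x /= ->; exact: (RR_subgroup D').1.
have [l hl lge] := index_ge_split (RR_subgroup D') hsub hge (RR_chain deg_le D' T).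
have dH : fdeg H = n by apply/eqP; rewrite eq_le fdeg_poles_le fdeg_poles_ge.
have eD : (\sum_(P <- T) deg P)%:Z = (n * m)%N%:Z + (\sum_(P <- U) deg P)%N%:Z - fdeg D'.
  rewrite -!fdeg_sumdiv -TE -UC raddfB raddfD raddfMn /= dH.
  by rewrite -mulr_natr natz -PoszM.
have dD' : fdeg D <= fdeg D'.
  by rewrite /D' raddfB /= lerDl oppr_ge0 fdeg_poly_le0.
have el : (#|F| ^ e <= l)%N.
  rewrite -(@leq_pmul2l (#|F| ^ (\sum_(P <- T) deg P))) ?expn_gt0 ?(ltnW q_gt1) //.
  apply: leq_trans hl; rewrite -expnD leq_exp2l //.
  have n0 := rat_pos sw; nia.
have := RR_shift sw deg_ge deg_le (invr_neq0 fs0) (index_gew el lge).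
by rewrite pdivV opprK subrK.
Qed.

(** If the divisor of [y] had positive degree, its multiples would have Riemann-Roch spaces of
    unbounded size, although each is [RR 0] up to multiplication by a power of [y]. *)
Lemma fdeg_pdiv x : x != 0 -> fdeg (pdiv x) = 0.
Proof.
have [c hc] := riemann; have [d d0] := RR0_finite sw deg_le.
have le0 y : y != 0 -> fdeg (pdiv y) <= 0.
  move=> y0; rewrite leNgt; apply/negP => pos.
  have := hc (pdiv y *+ (c + d.+1)) d.+1; rewrite raddfMn /=.
  have -> : d.+1%:Z + c%:Z <= fdeg (pdiv y) *+ (c + d.+1).
    apply: (@le_trans _ _ (1 *+ (c + d.+1))); first by rewrite natz; lia.
    by rewrite lerMn2r; apply/orP; right; lia.
  move=> /(_ isT) /(RR_shift sw deg_ge deg_le (expf_neq0 (c + d.+1) y0)).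
  rewrite pdivX subrr => h; have := index_ge_le (subgroup_set0 K) h d0.
  by rewrite leq_exp2l // ltnn.
move=> x0; apply/eqP; rewrite eq_le le0 //.
by have := le0 x^-1; rewrite invr_eq0 pdivV raddfN oppr_le0 => ->.
Qed.

(** The [#|F| ^ d.+1] polynomials of degree at most [d] in [s] cannot all differ modulo [P] when
    [deg P <= d], so [P] is a pole of [s] or a zero of one of finitely many differences. *)
Lemma finite_places_of_degree d :
  exists T : seq (place K), forall P, (deg P <= d)%N -> P \in T.
Proof.
pose poly_of (c : {ffun 'I_d.+1 -> F}) : {poly F} := \poly_(l < d.+1) c (inord l).
have /boolp.choice[Z ZP] : forall f : {poly F}, exists T : seq (place K),
    f != 0 -> forall P, ord_ge P 1 (evalK k s f) -> P \in T.
  move=> f; have [->|f0] := eqVneq f 0; first by exists [::].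
  by have [T TP] := finite_zeros_poly sw deg_ge deg_le f0; exists T.
have [T TP] := finite_poles sw deg_ge deg_le.
exists (T ++ flatten [seq Z (poly_of c - poly_of c') |
  c <- enum {ffun 'I_d.+1 -> F}, c' <- enum {ffun 'I_d.+1 -> F}]).
move=> P Pd; rewrite mem_cat; have [Ps|Ps] := ltP (P s) 0; first by rewrite TP.
apply/orP; right.
have hs : ord_ge P 0 s by rewrite ord_geE ?(rat_neq0 sw).
suff [c [c' [cc' h]]] : exists c c', c != c' /\ ord_ge P 1 (evalK k s (poly_of c - poly_of c')).
  apply/flattenP; exists (Z (poly_of c - poly_of c')).
    by apply/allpairsP; exists (c, c'); rewrite /= !mem_enum.
  apply: ZP => //; rewrite subr_eq0; apply: contraNneq cc' => e; apply/eqP/ffunP => l.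
  move: e => /(congr1 (fun p : {poly F} => p`_l)).
  by rewrite !coef_poly ltn_ord inord_val.
apply: contrapT => hn.
have inj c c' : ord_ge P 1 (evalK k s (poly_of c) - evalK k s (poly_of c')) -> c = c'.
  rewrite -rmorphB => h; apply/eqP; apply: contraT => cc'; case: hn.
  by exists c, c'.
have : index_ge (localring P) (localideal P) (#|F| ^ d.+1).
  exists [seq evalK k s (poly_of c) | c <- enum {ffun 'I_d.+1 -> F}]; split.
  - by rewrite size_map -cardE !card_ffun !card_ord.
  - rewrite map_inj_uniq ?enum_uniq // => c c' e; apply: inj.
    by rewrite e subrr ord_ge0.
  - by move=> _ /mapP[c _ ->]; exact: ord_ge_eval.
  - by move=> _ _ /mapP[c _ ->] /mapP[c' _ ->] /inj ->.
move=> h; have := index_ge_le (ord_ge_subgroup P 1) h (deg_le P).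
by rewrite leq_exp2l // => h'; have := leq_trans h' Pd; rewrite ltnn.
Qed.

Lemma finite_effective d : exists S : seq (divisor K), forall D,
  (forall P, 0 <= coeff P D) -> fdeg D <= d%:Z -> D \in S.
Proof.
have [Tl TlP] := finite_places_of_degree d.
have [S SP] : exists S : nat -> seq (divisor K), forall j (T : seq (place K)),
    size T = j -> {subset T <= Tl} -> sumdiv T \in S j.
  pose S := fix S j : seq (divisor K) := if j is j'.+1 then
    [seq << P >> + D | P <- Tl, D <- S j'] else [:: 0].
  exists S; elim=> [|j IH] T.
    by move=> /size0nil -> _; rewrite /sumdiv big_nil inE.
  case: T => // P T [sT] TT; rewrite /sumdiv big_cons; apply/allpairsP.
  exists (P, sumdiv T); split=> //=; first by apply: TT; rewrite mem_head.
  by apply: IH => // Q QT; apply: TT; rewrite in_cons QT orbT.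
exists (flatten [seq S j | j <- iota 0 d.+1]) => D /effectiveP[T ->].
rewrite fdeg_sumdiv lez_nat => dT; apply/flattenP; exists (S (size T)).
  rewrite map_f // mem_iota /= add0n ltnS; apply: leq_trans dT.
  by rewrite -sum1_size leq_sum.
apply: SP => // P PT; apply: TlP; apply: leq_trans dT.
by rewrite (big_rem P) //= leq_addr.
Qed.

Lemma finite_class_group : exists S : seq (divisor K), forall D, fdeg D = 0 ->
  exists E x, [/\ E \in S, x != 0 & D = E + pdiv x].
Proof.
have [c hc] := riemann; have [P _] := exists_place sw.
have [S SP] := finite_effective (c.+1 * deg P).
(* [c.+1] copies of [P] raise the degree of [D] past the constant of [riemann], which gives a
   nonzero function; [D + mP] is therefore equivalent to an effective divisor of fixed degree. *)
pose mP : divisor K := << P >> *+ c.+1.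
have dmP : fdeg mP = (c.+1 * deg P)%N by rewrite raddfMn /= fdegU -mulr_natr natz -PoszM mulnC.
exists [seq E - mP | E <- S] => D D0.
have [|r [rq ur rD _]] := hc (D + mP) 1%N.
  by rewrite raddfD /= D0 dmP; have := degP_gt0 P; nia.
have [y y0 Dy] : exists2 y, y != 0 & RR (D + mP) y.
  case: r rq ur rD => [|a [|b r]] /= rq; try by move: q_gt1; rewrite -[#|F|]expn1 -rq.
  rewrite inE negb_or => /andP[/andP[ab _] _] h.
  have [a0|a0] := eqVneq a 0; last by exists a => //; apply: h; rewrite mem_head.
  by exists b; [rewrite -a0 eq_sym|apply: h; rewrite !inE eqxx orbT].
exists (D + mP + pdiv y - mP), y^-1; split; rewrite ?invr_eq0 //.
  apply/mapP; exists (D + mP + pdiv y) => //; apply: SP.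
    by move=> Q; have := Dy Q; rewrite ord_geE // [coeff Q (_ + pdiv y)]coeffD coeff_pdiv; lia.
  by rewrite !raddfD /= D0 fdeg_pdiv // addr0 add0r dmP.
by rewrite pdivV [D + mP + _]addrAC !addrK.
Qed.

End RiemannTheorem.

(** A free family of maximal length is taken; it spans. Lengths are bounded because a free family of
    length [d] has [#|F| ^ d] distinct combinations. *)
Lemma finite_lmod_basis (F : finFieldType) (V : lmodType F) (B : nat) :
  (forall r : seq V, uniq r -> (size r <= B)%N) ->
  exists d (v : 'I_d -> V), is_basis [set: V] v.
Proof.
move=> hB.
pose free d := `[< exists v : 'I_d -> V,
  forall c : 'I_d -> F, \sum_i c i *: v i = 0 -> forall i, c i = 0 >].
have free0 : exists d, free d.
  by exists 0%N; apply/asboolP; exists (fun=> 0) => c _ [].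
have bound d : free d -> (d <= B)%N.
  move=> /asboolP[v hv].
  pose r := [seq \sum_i c i *: v i | c : {ffun 'I_d -> F}].
  have := hB r; rewrite size_map -cardE card_ffun card_ord => h.
  apply: leq_trans (h _); first by rewrite ltnW // ltn_expl // finNzRing_gt1.
  rewrite map_inj_uniq ?enum_uniq // => c c' e; apply/ffunP => i; apply/eqP.
  rewrite -subr_eq0; apply/eqP; apply: (hv (fun i => c i - c' i)).
  by under eq_bigr do rewrite scalerBl; rewrite sumrB e subrr.
have [d /asboolP[v hv] dmax] := ex_maxnP free0 bound.
exists d, v; split=> // x _; apply: contrapT => nx.
suff /dmax : free d.+1 by rewrite ltnn.
apply/asboolP; exists (fun i => oapp v x (unlift ord0 i)) => c.
rewrite big_ord_recl unlift_none /=.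
under eq_bigr do rewrite liftK /=.
move=> e; have c0 : c ord0 = 0.
  apply/eqP; apply: contraT => c0; case: nx.
  exists (fun i => - ((c ord0)^-1 * c (fintype.lift ord0 i))).
  apply: (scalerI c0); rewrite scaler_sumr; move/eqP: e; rewrite addr_eq0 => /eqP ->.
  rewrite -sumrN; apply: eq_bigr => i _.
  by rewrite !scaleNr scalerN scalerA mulrA mulfV // mul1r.
move: e; rewrite c0 scale0r add0r => /hv h i.
by have [j ->|->] := unliftP ord0 i.
Qed.

(** * Residue degrees over the rational function field *)

Section PlaceDegree.
Variables (F : finFieldType) (K : fieldExtType {fraction {poly F}}).
Implicit Types (f g : {poly F}) (x y : K) (P : place K).

Local Notation evalK := (evalK (constK K)).
Definition tvar : K := in_alg K (tofrac 'X).

Lemma evalK_tvar f : evalK tvar f = in_alg K (tofrac f).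
Proof.
rewrite (evalK_wide _ _ (leqnn _)) -[f in RHS]coefK poly_def !rmorph_sum; apply: eq_bigr => i _.
by rewrite -mul_polyC !rmorphM !rmorphXn.
Qed.

Lemma rat_basis_tvar : exists n (w : 'I_n -> K), rat_basis (constK K) tvar w.
Proof.
pose b := vbasis {:K}; exists (\dim {:K}), (fun i => b`_i).
have bb : basis_of {:K} b := vbasisP _.
split.
- by rewrite lt0n dimv_eq0; apply/eqP => e; have := memvf (1 : K); rewrite e memv0 oner_eq0.
- move=> c; under eq_bigr do rewrite evalK_tvar mulr_algl.
  have /freeP fb := basis_free bb; move=> /fb h i; apply/eqP.
  by rewrite -tofrac_eq0 h.
- move=> y; have [g [c [g0 gc]]] := fraction_common_denom (fun i => coord b i y).
  exists g, c; split=> //; rewrite {1}(coord_basis bb (memvf y)) mulr_sumr.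
  apply: eq_bigr => i _; rewrite !evalK_tvar -gc.
  by rewrite !mulr_algl scalerA.
- move=> y; have /polyOver1P[q qE] := minPolyOver 1%AS y.
  have [g [c [g0 gc]]] := fraction_common_denom (fun i : 'I_(size q) => q`_i).
  pose P : {poly {poly F}} := \poly_(i < size q) oapp c 0 (insub i).
  have PE : map_poly (evalK tvar) P = (in_alg K (tofrac g))%:P * map_poly (in_alg K) q.
    apply/polyP => k; rewrite coef_map coefCM coef_map coef_poly.
    have [kq|qk] := ltnP k (size q); last by rewrite nth_default // [X in _ * X]raddf0 mulr0 raddf0.
    by rewrite insubT /= evalK_tvar -gc [LHS]rmorphM.
  exists P; split.
    apply/eqP => P0; move/eqP: PE; rewrite P0 rmorph0 eq_sym mulf_eq0.
    rewrite polyC_eq0 fmorph_eq0 tofrac_eq0 (negPf g0) /= -qE.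
    by rewrite (negPf (monic_neq0 (monic_minPoly _ _))).
  by rewrite PE hornerM -qE minPolyxx mulr0.
Qed.

Section Residue.
Variable P : place K.

Definition lift_residue (r : residue_over P) : K :=
  val (generic_quotient.repr r : valring P).

Definition red (x : valring P) : residue_over P :=
  \pi_({ideal_quot (in_maxideal (P := P))}) x.

Lemma redK r : red (generic_quotient.repr r) = r.
Proof. exact: reprK. Qed.

Lemma red_eq (x y : valring P) : red x = red y <-> ord_ge P 1 (val x - val y).
Proof.
rewrite /red; split=> [/eqP|h]; first by rewrite -Quotient.idealrBE.
by apply/eqP; rewrite -Quotient.idealrBE.
Qed.

Lemma lift_residueP (r r' : residue_over P) :
  ord_ge P 1 (lift_residue r - lift_residue r') -> r = r'.
Proof. by move=> h; rewrite -(redK r) -(redK r'); apply/red_eq. Qed.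

Lemma lift_residue_local r : ord_ge P 0 (lift_residue r).
Proof. by rewrite /lift_residue; apply: valP. Qed.

Lemma place_degP : exists v : 'I_(place_deg P) -> residue_over P,
  is_basis [set: residue_over P] v.
Proof.
have [n [w sw]] := rat_basis_tvar.
have [B hB] := localring_index_bounded sw P.
have [r ur|d [v vb]] := @finite_lmod_basis F (residue_over P) B; last first.
  rewrite /place_deg; case: xgetP => [d' -> [v' hv']|/(_ d) []]; first by exists v'.
  by exists v.
apply: hB; exists [seq lift_residue u | u <- r]; split.
- by rewrite size_map.
- rewrite map_inj_uniq // => u u' e; apply: lift_residueP.
  by rewrite e subrr ord_ge0.
- by move=> _ /mapP[x _ ->]; exact: lift_residue_local.
- by move=> _ _ /mapP[x _ ->] /mapP[y _ ->] /lift_residueP ->.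
Qed.

Lemma place_deg_ge : index_ge (localring P) (localideal P) (#|F| ^ place_deg P).
Proof.
have [v [_ vfree _]] := place_degP.
exists [seq lift_residue (\sum_i c i *: v i) | c : {ffun 'I_(place_deg P) -> F}]; split.
- by rewrite size_map -cardE card_ffun card_ord.
- rewrite map_inj_uniq ?enum_uniq // => c c' e; apply/ffunP => i; apply/eqP.
  rewrite -subr_eq0; apply/eqP; apply: (vfree (fun i => c i - c' i)).
  under eq_bigr do rewrite scalerBl.
  rewrite sumrB; apply/eqP; rewrite subr_eq0; apply/eqP/lift_residueP.
  by rewrite e subrr ord_ge0.
- by move=> _ /mapP[x _ ->]; exact: lift_residue_local.
- by move=> _ _ /mapP[x _ ->] /mapP[y _ ->] /lift_residueP ->.
Qed.

Lemma place_deg_le : index_le (localring P) (localideal P) (#|F| ^ place_deg P).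
Proof.
have [v [_ _ vspan]] := place_degP.
exists [seq lift_residue (\sum_i c i *: v i) | c : {ffun 'I_(place_deg P) -> F}]; split.
  by rewrite size_map -cardE card_ffun card_ord.
move=> x xO; pose x' : valring P := Sub x xO.
have [c hc] := vspan (red x') I.
exists (lift_residue (\sum_i c i *: v i)).
  apply/mapP; exists [ffun i => c i]; rewrite ?mem_enum //.
  by congr lift_residue; apply: eq_bigr => i _; rewrite ffunE.
rewrite -hc; have /red_eq : red x' = red (generic_quotient.repr (red x')) by rewrite redK.
by rewrite SubK.
Qed.

End Residue.
End PlaceDegree.

(** * Finite subgroups; kernels and images *)

Section FiniteSubgroup.
Variables (V : zmodType) (S : seq V) (S0 : 0 \in S).
Hypothesis SB : forall x y, x \in S -> y \in S -> x - y \in S.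

(** The closure proofs are arguments of the type so that the group structure declared below can
    depend on them. *)
Definition finsub of 0 \in S & (forall x y, x \in S -> y \in S -> x - y \in S) : Type :=
  seq_sub S.
Local Notation T := (finsub S0 SB).

HB.instance Definition _ := Finite.on T.

Fact finsub_oppr (x : T) : - ssval x \in S.
Proof. by rewrite -sub0r SB // ssvalP. Qed.

Fact finsub_addr (x y : T) : ssval x + ssval y \in S.
Proof. by rewrite -[ssval y]opprK SB ?ssvalP ?finsub_oppr. Qed.

Definition finsub_zero : T := SeqSub S0.
Definition finsub_opp (x : T) : T := SeqSub (finsub_oppr x).
Definition finsub_add (x y : T) : T := SeqSub (finsub_addr x y).

Fact finsub_addA : associative finsub_add.
Proof. by move=> x y z; apply: val_inj; rewrite /= addrA. Qed.
Fact finsub_addC : commutative finsub_add.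
Proof. by move=> x y; apply: val_inj; rewrite /= addrC. Qed.
Fact finsub_add0 : left_id finsub_zero finsub_add.
Proof. by move=> x; apply: val_inj; rewrite /= add0r. Qed.
Fact finsub_addN : left_inverse finsub_zero finsub_opp finsub_add.
Proof. by move=> x; apply: val_inj; rewrite /= addNr. Qed.

HB.instance Definition _ :=
  GRing.isZmodule.Build T finsub_addA finsub_addC finsub_add0 finsub_addN.

Lemma finsub_valN (x : T) : ssval (- x) = - ssval x.
Proof. by []. Qed.

End FiniteSubgroup.

Lemma card_kernel_image (T : finZmodType) (f : T -> T) : {morph f : x y / x + y} ->
  (#|[set x | f x == 0%R]%SET| * #|[set f x | x in [set: T]]%SET|)%N = #|T|.
Proof.
move=> fD.
have fM : {in [set: T]%SET &, {morph f : x y / (x * y)%g}} by move=> x y _ _; exact: fD.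
pose phi := Morphism fM.
have -> : [set x | f x == 0]%SET = ('ker phi)%g.
  by apply/setP => x; rewrite !inE.
have -> : [set f x | x in [set: T]]%SET = (phi @* [set: T]%SET)%g.
  by rewrite morphimEdom.
by rewrite card_morphim finset.setIid Lagrange ?finset.subsetT //= ?cardsT.
Qed.

(** * Herbrand quotient of an involution *)

Section Herbrand.
Variables (V : zmodType) (sg : V -> V) (dg : V -> int).
Hypothesis sgB : forall x y, sg (x - y) = sg x - sg y.
Hypothesis sgK : forall x, sg (sg x) = x.
Hypothesis dgB : forall x y, dg (x - y) = dg x - dg y.
Hypothesis dg_sg : forall x, dg (sg x) = dg x.
Hypothesis finite0 : exists S : seq V, forall x, dg x = 0 -> x \in S.
Hypothesis nontriv : exists x, dg x != 0.

Definition is_norm x := exists y, x = y + sg y.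

Let sg0 : sg 0 = 0. Proof. by have := sgB 0 0; rewrite !subrr. Qed.
Let sgN x : sg (- x) = - sg x. Proof. by rewrite -[- x]sub0r sgB sg0 sub0r. Qed.
Let sgD x y : sg (x + y) = sg x + sg y. Proof. by rewrite -[y in LHS]opprK sgB sgN opprK. Qed.
Let dg0 : dg 0 = 0. Proof. by have := dgB 0 0; rewrite !subrr. Qed.
Let dgN x : dg (- x) = - dg x. Proof. by rewrite -[- x]sub0r dgB dg0 sub0r. Qed.
Let dgD x y : dg (x + y) = dg x + dg y. Proof. by rewrite -[y in LHS]opprK dgB dgN opprK. Qed.
Let dgMn x i : dg (x *+ i) = dg x *+ i.
Proof. by elim: i => [|i IH]; rewrite ?mulr0n ?dg0 // !mulrS dgD IH. Qed.

Lemma min_degree : exists (d : V) (g : nat),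
  [/\ (0 < g)%N, dg d = g & forall x, (g %| dg x)%Z].
Proof.
pose A g := `[< (0 < g)%N /\ exists x, dg x = g%:Z >].
have exA : exists g, A g.
  have [x x0] := nontriv; exists `|dg x|%N; apply/asboolP; split.
    by rewrite absz_gt0.
  have [h|h] := lerP 0 (dg x); first by exists x; lia.
  by exists (- x); rewrite dgN; lia.
have [g /asboolP[g0 [d dE]] gmin] := ex_minnP exA.
exists d, g; split=> // x; apply/dvdz_mod0P.
have r0 : (0 <= dg x %% g)%Z by rewrite modz_ge0 //; lia.
have rg : ((dg x %% g)%Z < g) by rewrite ltz_pmod.
have zE (y : V) (z : int) : dg (y *~ z) = dg y * z.
  by case: z => i; rewrite ?NegzE -?pmulrn ?nmulrn ?dgN dgMn; lia.
have e : dg (x - d *~ (dg x %/ g)%Z) = (dg x %% g)%Z.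
  by rewrite dgB zE dE {1}(divz_eq (dg x) g); lia.
have [//|/eqP nz] := eqVneq (dg x %% g)%Z 0; exfalso.
have /gmin : A `|(dg x %% g)%Z|%N.
  apply/asboolP; split; first by rewrite absz_gt0; apply/eqP.
  by exists (x - d *~ (dg x %/ g)%Z); rewrite e; lia.
by lia.
Qed.

Let S := undup [seq x <- projT1 (cid finite0) | dg x == 0].

Let SP x : (x \in S) = (dg x == 0).
Proof.
rewrite mem_undup mem_filter; case: eqP => //= /(projT2 (cid finite0)) h.
exact: h.
Qed.

Let S0 : 0 \in S. Proof. by rewrite SP dg0. Qed.
Let SB x y : x \in S -> y \in S -> x - y \in S.
Proof. by rewrite !SP dgB => /eqP -> /eqP ->. Qed.

Local Notation T := (finsub S0 SB).

Let TP (x : T) : dg (ssval x) = 0. Proof. by apply/eqP; rewrite -SP ssvalP. Qed.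
Let toT x (h : dg x = 0) : T := SeqSub (etrans (SP x) (introT eqP h)).

Let f_sub (x : T) : dg (ssval x - sg (ssval x)) = 0.
Proof. by rewrite dgB dg_sg subrr. Qed.
Let g_sub (x : T) : dg (ssval x + sg (ssval x)) = 0.
Proof. by rewrite dgD dg_sg TP addr0. Qed.

Let f (x : T) : T := toT (f_sub x).
Let g (x : T) : T := toT (g_sub x).

Let fD : {morph f : x y / x + y}.
Proof. by move=> x y; apply: val_inj; rewrite /= sgD opprD addrACA. Qed.
Let gD : {morph g : x y / x + y}.
Proof. by move=> x y; apply: val_inj; rewrite /= sgD addrACA. Qed.

Let kerf := [set x | f x == 0]%SET.
Let kerg := [set x | g x == 0]%SET.
Let imf := [set f x | x in [set: T]%SET]%SET.
Let img := [set g x | x in [set: T]%SET]%SET.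

Let card_eq : (#|kerf| * #|imf| = #|kerg| * #|img|)%N.
Proof. by rewrite (card_kernel_image fD) (card_kernel_image gD). Qed.

Let val_eq0 (x : T) : (x == 0) = (ssval x == 0).
Proof. by []. Qed.

Let imf_kerg : imf \subset kerg.
Proof.
apply/fintype.subsetP => _ /imsetP[x _ ->]; rewrite inE val_eq0 /= sgB sgK.
by rewrite addrA subrK subrr.
Qed.

Let img_kerf : img \subset kerf.
Proof.
apply/fintype.subsetP => _ /imsetP[x _ ->]; rewrite inE val_eq0 /= sgD sgK.
by rewrite [sg _ + _]addrC subrr.
Qed.

Let imf0 : 0 \in imf.
Proof. by apply/imsetP; exists 0 => //; apply: val_inj; rewrite /= sg0 subrr. Qed.

Let img0 : 0 \in img.
Proof. by apply/imsetP; exists 0 => //; apply: val_inj; rewrite /= sg0 addr0. Qed.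

Let imgP (x : T) : x \in img <-> is_norm (ssval x).
Proof.
split=> [/imsetP[y _ ->]|[y xE]]; first by exists (ssval y).
have y0 : dg y = 0 by move: (TP x); rewrite xE dgD dg_sg; lia.
by apply/imsetP; exists (toT y0) => //; apply: val_inj.
Qed.

Let kerfP (x : T) : (x \in kerf) = (sg (ssval x) == ssval x).
Proof. by rewrite inE val_eq0 /= subr_eq0 eq_sym. Qed.

Let kerg_imf : (#|kerf| <= #|img|)%N -> kerg = imf.
Proof.
move=> le; apply/esym/eqP; rewrite eqEcard imf_kerg /=.
have p1 : (0 < #|img|)%N by apply/card_gt0P; exists 0.
by rewrite -(leq_pmul2r p1) -card_eq mulnC leq_mul2l le orbT.
Qed.

(** In degree 0, [card_eq] gives [ker (1 - sg)] modulo [im (1 + sg)] and [ker (1 + sg)] modulo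
    [im (1 - sg)] the same size. The rest is governed by a class [d] of minimal positive degree [n]:
    norms have degree an even multiple of [n], and the question is whether [d - sg d] already comes
    from degree 0. *)
Lemma herbrand : (exists m, sg m = m /\ ~ is_norm m) /\
  ((forall m1 m2, sg m1 = m1 -> sg m2 = m2 -> ~ is_norm m1 -> ~ is_norm m2 ->
      is_norm (m1 - m2)) ->
   forall m, m + sg m = 0 -> exists y, m = y - sg y).
Proof.
have [d [n [n0 dn dvn]]] := min_degree.
have eta0 : dg (d - sg d) = 0 by rewrite dgB dg_sg subrr.
have degree0 m : m + sg m = 0 -> dg m = 0.
  move=> /(congr1 dg); rewrite dgD dg_sg dg0. lia.
have kergP m (m0 : m + sg m = 0) : toT (degree0 m m0) \in kerg.
  by rewrite inE val_eq0 /= m0.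
have imfE m (m0 : m + sg m = 0) : kerg = imf -> exists y, m = y - sg y.
  move=> e; have := kergP m m0; rewrite e => /imsetP[y _ /(congr1 (@ssval _ _))] /= ->.
  by exists (ssval y).
have odd_degree m : dg m = n%:Z \/ dg m = - n%:Z -> ~ is_norm m.
  move=> dm [y yE]; move: dm; rewrite yE dgD dg_sg => dm.
  have /dvdzP[q qE] := dvn y; move: dm; rewrite qE => -[] dm.
    have : (q + q - 1) * n%:Z = 0 by rewrite mulrBl mulrDl dm mul1r subrr.
    by move/eqP; rewrite mulf_eq0 => /orP[]; lia.
  have : (q + q + 1) * n%:Z = 0 by rewrite !mulrDl dm mul1r addNr.
  by move/eqP; rewrite mulf_eq0 => /orP[]; lia.
(* If [d - sg d] comes from degree 0, then [d] can be corrected to an invariant class [d'] of degree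
   [n], which is not a norm. An invariant class of degree 0 that is not a norm would, under the
   congruence hypothesis, differ from [d'] by a norm of degree [- n]; so all of them are norms. *)
have [eta_im|eta_im] := boolP (toT eta0 \in imf).
  have [y /= dy] : exists y : T, d - sg d = ssval y - sg (ssval y).
    by move: eta_im => /imsetP[y _ /(congr1 (@ssval _ _))] /= ->; exists y.
  pose d' := d - ssval y.
  have d'n : dg d' = n by rewrite /d' dgB TP subr0.
  have sd' : sg d' = d'.
    move/eqP: dy; rewrite subr_eq => /eqP dy; rewrite /d' sgB {2}dy.
    by rewrite [RHS]addrAC [_ - _ - ssval y]addrAC subrr add0r addrC.
  have nd' : ~ is_norm d' by apply: odd_degree; left.
  split; first by exists d'.
  move=> h m m0; apply: (imfE m m0); apply: kerg_imf; apply: subset_leq_card.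
  apply/fintype.subsetP => x; rewrite kerfP => /eqP sx; apply/imgP; apply: contrapT => nx.
  have := h _ _ sx sd' nx nd'; apply: odd_degree; right.
  by rewrite dgB TP d'n sub0r.
have eta_kerg : toT eta0 \in kerg.
  by rewrite inE val_eq0 /= sgB sgK addrA subrK subrr.
(* Now [ker (1 + sg)] is larger than [im (1 - sg)], so some invariant class of degree 0 is not a
   norm. *)
split.
  apply: contrapT => hn; move: eta_im; rewrite -kerg_imf ?eta_kerg //.
  apply: subset_leq_card; apply/fintype.subsetP => x; rewrite kerfP => /eqP sx.
  by apply/imgP; apply: contrapT => nx; apply: hn; exists (ssval x).
move=> h m m0.
have le2 : (#|kerf| <= 2 * #|img|)%N.
  have [sub|/subsetPn[x xf xg]] := boolP (kerf \subset img).
    by apply: leq_trans (subset_leq_card sub) _; rewrite mul2n -addnn leq_addr.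
  have : kerf \subset img :|: [set x + y | y in img]%SET.
    apply/fintype.subsetP => z zf; rewrite finset.in_setU.
    have [//|zg] := boolP (z \in img); apply/orP; right.
    apply/imsetP; exists (z - x); last by rewrite addrC subrK.
    apply/imgP; apply: h; try by apply/eqP; rewrite -kerfP.
      by move=> /imgP; rewrite (negPf zg).
    by move=> /imgP; rewrite (negPf xg).
  move=> /subset_leq_card le; apply: leq_trans le _.
  rewrite (leq_trans (leq_card_setU _ _).1) // mul2n -addnn leq_add2l.
  exact: leq_imset_card.
(* Since [ker (1 - sg)] is at most twice as large as the norms, [card_eq] leaves room in
   [ker (1 + sg)] for [imf] and one further coset. This is the coset of [d - sg d], which has the
   required form with an element of nonzero degree. *)
have two : [set toT eta0 + y | y in imf]%SET :&: imf = finset.set0.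
  apply/finset.setP => z; rewrite !inE; apply/negP => /andP[/imsetP[y yf ->] /imsetP[y' _ e]].
  move: eta_im => /imsetP[]; move: yf => /imsetP[u _ uE]; exists (y' - u) => //.
  by apply: (addIr y); rewrite e uE -fD subrK.
have kE : kerg = [set toT eta0 + y | y in imf]%SET :|: imf.
  apply/esym/eqP; rewrite eqEcard; apply/andP; split.
    apply/fintype.subsetP => z; rewrite finset.in_setU => /orP[/imsetP[y yf ->]|]; last first.
      exact: (fintype.subsetP imf_kerg).
    have := fintype.subsetP imf_kerg _ yf; move: eta_kerg; rewrite !inE gD.
    by move=> /eqP -> /eqP ->; rewrite addr0.
  rewrite cardsU two cards0 subn0 card_imset; last exact: addrI.
  have p1 : (0 < #|img|)%N by apply/card_gt0P; exists 0.
  rewrite -(leq_pmul2r p1) -card_eq addnn -mul2n mulnAC leq_mul2r.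
  by rewrite le2 orbT.
have := kergP m m0; rewrite kE finset.in_setU => /orP[/imsetP[_ /imsetP[y _ ->]]|/imsetP[y _]].
  move=> /(congr1 (@ssval _ _)) /= ->; exists (d + ssval y).
  by rewrite sgD opprD addrACA.
by move=> /(congr1 (@ssval _ _)) /= ->; exists (ssval y).
Qed.

End Herbrand.

(** * Existence of Smith presentations *)

Section FiniteAbelian.
Variable T : finZmodType.

Lemma mem_cycle_cyc (x y : T) : y \in <[x]>%g <-> cyc x y.
Proof.
split=> [/cycleP[i ->]|[[i|i] _ <-]].
- by exists i%:Z.
- exact: mem_cycle.
- by rewrite NegzE mulrNz -pmulrn -FinRing.zmodVgE groupV -FinRing.zmodXgE mem_cycle.
Qed.

Lemma finite_smith : exists (m : nat) (x : 'I_m -> T) (d : 'I_m -> nat),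
  smith_presentation [set: T] x d.
Proof.
have [b bG bord] := abelian_structure (FinRing.zmod_abelian [set: T]%SET).
(* [abelian_structure] lists the generators so that each order is divisible by the next, the reverse
   of a Smith presentation. *)
pose x (i : 'I_(size b)) : T := tnth (in_tuple b) (rev_ord i).
have xG : \big[dprod/1%g]_i <[x i]>%g = [set: T]%SET.
  rewrite (reindex_inj rev_ord_inj) -bG (big_tnth _ _ b).
  by apply: eq_bigr => i _; rewrite /x rev_ordK.
exists (size b), x, (fun i => #[x i]%g); split.
- move=> i; split=> [||e /andP[e0 ed] xe].
  + exact: order_gt0.
  + by have := expg_order (x i); rewrite FinRing.zmodXgE.
  + have : (#[x i]%g %| e)%N by rewrite order_dvdn FinRing.zmodXgE xe.
    by move=> /(dvdn_leq e0); rewrite leqNgt ed.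
- split=> [y|c cC c0 i].
    split=> // _; have [c [cC -> _]] := mem_bigdprod xG (finset.in_setT y).
    by exists c => // i; apply/mem_cycle_cyc; exact: cC.
  have [c' [_ _ cU]] := mem_bigdprod xG (finset.in_setT (0 : T)).
  have h1 : c i = c' i.
    by apply: (cU c) => // j _; apply/mem_cycle_cyc.
  have h2 : 0 = c' i.
    apply: (cU (fun=> 0)) => //; first by move=> j _; exact: group1.
    by rewrite big1_eq.
  by rewrite h1 -h2.
- move=> i j ij; have := abelian_type_dvdn_sorted [set: T]%SET; rewrite -bord => bs.
  have ordE (l : 'I_(size b)) : #[x l]%g = nth 0%N (map (@order T) b) (rev_ord l).
    by rewrite /x (nth_map 0) ?ltn_ord // (tnth_nth 0).
  rewrite !ordE; apply: (sorted_leq_nth _ _ _ bs).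
  + by move=> u v w /= vu wv; apply: dvdn_trans wv _.
  + by move=> u /=.
  + by rewrite inE size_map.
  + by rewrite inE size_map.
  + by rewrite /= leq_sub2l.
Qed.

End FiniteAbelian.

Lemma smith_of_finite (V : zmodType) (A : set V) : A 0 ->
  (forall x y, A x -> A y -> A (x - y)) ->
  (exists S : seq V, forall x, A x -> x \in S) ->
  exists (m : nat) (x : 'I_m -> V) (d : 'I_m -> nat), smith_presentation A x d.
Proof.
move=> A0 AB [S0 hS].
pose S := undup [seq x <- S0 | `[< A x >]].
have SP x : x \in S <-> A x.
  rewrite mem_undup mem_filter; split=> [/andP[/asboolP]|Ax] //.
  by rewrite hS // andbT; apply/asboolP.
have S_0 : 0 \in S by apply/SP.
have S_B x y : x \in S -> y \in S -> x - y \in S.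
  by move=> /SP Ax /SP Ay; apply/SP/AB.
pose T := finsub S_0 S_B.
have [m [x [d [xd [xspan xfree] dd]]]] := finite_smith T.
have valMn (y : T) i : ssval (y *+ i) = ssval y *+ i.
  by elim: i => [|i IH]; rewrite // !mulrS -IH.
have valMz (y : T) i : ssval (y *~ i) = ssval y *~ i.
  by case: i => i; rewrite ?NegzE ?mulrNz -?pmulrn ?finsub_valN valMn.
have val_sum (c : 'I_m -> T) : ssval (\sum_i c i) = \sum_i ssval (c i).
  exact: (big_morph (@ssval _ _) (id1 := 0) (fun _ _ => erefl)).
exists m, (fun i => ssval (x i)), d; split=> //.
- move=> i; have [d0 xd0 xmin] := xd i; split=> //.
    by rewrite -valMn xd0.
  by move=> e he xe; apply: (xmin e he); apply: val_inj; rewrite /= valMn.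
- split=> [y|c cC c0].
    split=> [/SP Sy|[c cC ->]].
      have [c cC yE] := (xspan (SeqSub Sy : T)).1 Logic.I.
      exists (fun i => ssval (c i)).
        by move=> i; have [z _ zE] := cC i; exists z; rewrite // -zE valMz.
      by rewrite -val_sum -yE.
    apply/SP; have /boolp.choice[c' c'P] : forall i, exists u : T, c i = ssval u.
      by move=> i; have [z _ <-] := cC i; exists (x i *~ z); rewrite valMz.
    by under eq_bigr do rewrite c'P; rewrite -val_sum ssvalP.
  have /boolp.choice[c' c'P] : forall i, exists u : T, cyc (x i) u /\ c i = ssval u.
    move=> i; have [z _ <-] := cC i; exists (x i *~ z); rewrite valMz; split=> //.
    by exists z.
  move=> i; rewrite (c'P i).2 (xfree c') //; first by move=> j; exact: (c'P j).1.
  apply: val_inj; rewrite /= val_sum -[RHS]c0; apply: eq_bigr => j _.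
  by rewrite (c'P j).2.
Qed.

(** * Function fields over a finite field *)

Section FunctionFields.
Variables (F : finFieldType) (K : fieldType) (k : {rmorphism F -> K}).
Variable deg : place K -> nat.
Implicit Types (x y : K) (P : place K) (D : divisor K).

(** The constants of the field may be larger than the image of [F], and [deg] is relative to [F];
    the quadratic extension is thus covered on the same footing as [K]. *)
Definition function_field : Prop :=
  [/\ exists s n (w : 'I_n -> K), rat_basis k s w,
      forall P, index_ge (localring P) (localideal P) (#|F| ^ deg P) &
      forall P, index_le (localring P) (localideal P) (#|F| ^ deg P)].

Hypothesis ff : function_field.

Lemma ff_coeff_pdiv P x : coeff P (pdiv x) = P x.
Proof. by have [[s [n [w sw]]] hge hle] := ff; have := coeff_pdiv sw hge hle P x. Qed.

Lemma half_pdiv x : (forall P : place K, (2 %| P x)%Z) ->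
  exists D : divisor K, pdiv x = D *+ 2.
Proof.
move=> x_even; have [D DE] : exists D : divisor K, forall P, coeff P D = (P x %/ 2)%Z.
  apply: (@divisor_of_fun _ _ (dom (pdiv x))) => P h.
  by rewrite mem_dom ff_coeff_pdiv; apply: contraNneq h => ->; rewrite div0z.
exists D; apply: div_ext => P; rewrite coeffMn DE ff_coeff_pdiv.
by have /dvdzP[q ->] := x_even P; rewrite mulzK // mulr2n; lia.
Qed.

Lemma ff_pdivM x y : x != 0 -> y != 0 -> pdiv (x * y) = pdiv x + pdiv y.
Proof. by have [[s [n [w sw]]] hge hle] := ff; exact: (pdivM sw hge hle). Qed.

Lemma ff_pdivV x : pdiv x^-1 = - pdiv x.
Proof. by have [[s [n [w sw]]] hge hle] := ff; have := pdivV sw hge hle x; exact. Qed.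

Lemma ff_pdivX x i : pdiv (x ^+ i) = pdiv x *+ i.
Proof. by have [[s [n [w sw]]] hge hle] := ff; have := pdivX sw hge hle x i; exact. Qed.

Lemma ff_fdeg_pdiv x : x != 0 -> fdeg deg (pdiv x) = 0.
Proof. by have [[s [n [w sw]]] hge hle] := ff; exact: (fdeg_pdiv sw hge hle). Qed.

Lemma ff_finite_class_group : exists S : seq (divisor K), forall D, fdeg deg D = 0 ->
  exists E x, [/\ E \in S, x != 0 & D = E + pdiv x].
Proof. by have [[s [n [w sw]]] hge hle] := ff; exact: (finite_class_group sw hge hle). Qed.

Lemma ff_place : exists P : place K, (0 < deg P)%N.
Proof.
have [[s [n [w sw]]] hge hle] := ff; have [P _] := exists_place sw.
by exists P; exact: deg_gt0 hle P.
Qed.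

(** All powers of [x] lie in the finite space [RR 0], so two of them coincide. *)
Lemma ff_units x : x != 0 -> (forall P : place K, P x = 0) ->
  exists2 i : nat, (0 < i)%N & x ^+ i = 1.
Proof.
move=> x0 Px; have [[s [n [w sw]]] hge hle] := ff.
have [d hd] := RR0_finite sw hle; apply: contrapT => hn.
have inj i j : x ^+ i = x ^+ j -> i = j.
  wlog ij : i j / (i <= j)%N.
    by move=> h e; have [/h|/ltnW/h h'] := leqP i j; [exact|exact/esym/h'/esym].
  move=> e; apply/eqP; apply: contraT => ne; case: hn; exists (j - i)%N.
    by rewrite subn_gt0 ltn_neqAle ne.
  apply: (mulfI (expf_neq0 i x0)).
  by rewrite mulr1 -exprD subnKC.
have : index_ge (RR (0 : divisor K)) [set 0] (#|F| ^ d).+1.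
  exists [seq x ^+ i | i <- iota 0 (#|F| ^ d).+1]; split.
  - by rewrite size_map size_iota.
  - by rewrite map_inj_uniq ?iota_uniq.
  - move=> _ /mapP[i _ ->] P; rewrite ord_geE ?expf_neq0 // placeX Px mul0rn.
    by rewrite coeff0 oppr0.
  - by move=> _ _ /mapP[i _ ->] /mapP[j _ ->] /= /eqP; rewrite subr_eq0 => /eqP.
by move=> h; have := index_ge_le (subgroup_set0 K) h hd; rewrite ltnn.
Qed.

Lemma pdiv_eqP x y : x != 0 -> y != 0 -> pdiv x = pdiv y ->
  exists2 u, (forall P : place K, P u = 0) & x = u * y.
Proof.
move=> x0 y0 e; exists (x / y); last by rewrite divfK.
by move=> P; rewrite place_div // -!ff_coeff_pdiv e subrr.
Qed.

End FunctionFields.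

(** * Action of an involution on places and divisors *)

Section Conjugation.
Variables (L : fieldType) (sg : {rmorphism L -> L}).
Hypothesis sgK : forall w, sg (sg w) = w.
Implicit Types (x y w : L) (Q R : place L) (D E : divisor L).

Fact conj_place_subproof (Q : place L) : `[< normalized_valuation (Q \o sg) >].
Proof.
have sg0 x : x != 0 -> sg x != 0 by rewrite fmorph_eq0.
apply/asboolP; split=> /=.
- by rewrite rmorph0 place0.
- by move=> x y x0 y0; rewrite rmorphM placeM ?sg0.
- by move=> x y x0 y0 xy0; rewrite rmorphD placeD ?sg0 // -rmorphD sg0.
- have [p p0 Qp] := place_uniformizer Q; exists (sg p); first exact: sg0.
  by rewrite sgK.
Qed.

Definition conj_place (Q : place L) : place L := Place (conj_place_subproof Q).

Lemma conj_placeE Q w : conj_place Q w = Q (sg w).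
Proof. by []. Qed.

Lemma conj_placeK Q : conj_place (conj_place Q) = Q.
Proof. by apply: place_ext => x _; rewrite !conj_placeE sgK. Qed.

Lemma ord_ge_conj Q N w : ord_ge (conj_place Q) N w = ord_ge Q N (sg w).
Proof. by rewrite /ord_ge conj_placeE fmorph_eq0. Qed.

Fact conj_div_subproof (D : divisor L) :
  exists E : divisor L, forall Q, coeff Q E = coeff (conj_place Q) D.
Proof.
apply: (@divisor_of_fun _ _ [seq conj_place Q | Q <- dom D]) => Q h.
by apply/mapP; exists (conj_place Q); rewrite ?conj_placeK // mem_dom.
Qed.

Definition conj_div (D : divisor L) : divisor L := projT1 (cid (conj_div_subproof D)).

Lemma coeff_conj_div Q D : coeff Q (conj_div D) = coeff (conj_place Q) D.
Proof. by rewrite /conj_div; case: cid => E /= ->. Qed.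

Lemma conj_divB D E : conj_div (D - E) = conj_div D - conj_div E.
Proof. by apply: div_ext => Q; rewrite coeffB !coeff_conj_div coeffB. Qed.

Lemma conj_divD D E : conj_div (D + E) = conj_div D + conj_div E.
Proof. by apply: div_ext => Q; rewrite coeffD !coeff_conj_div coeffD. Qed.

Lemma conj_divK D : conj_div (conj_div D) = D.
Proof. by apply: div_ext => Q; rewrite !coeff_conj_div conj_placeK. Qed.

Lemma conj_divU Q : conj_div << Q >> = << conj_place Q >>.
Proof.
apply: div_ext => R; rewrite coeff_conj_div !coeffU !mul1r.
congr ((nat_of_bool _)%:R); apply/eqP/eqP => [->|<-]; by rewrite conj_placeK.
Qed.

Variables (F : finFieldType) (k : {rmorphism F -> L}) (deg : place L -> nat).
Hypothesis ff : function_field k deg.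

Lemma conj_pdiv w : conj_div (pdiv w) = pdiv (sg w).
Proof. by apply: div_ext => Q; rewrite coeff_conj_div !(ff_coeff_pdiv ff) conj_placeE. Qed.

Lemma deg_conj_place Q : deg (conj_place Q) = deg Q.
Proof.
have [_ hge hle] := ff.
suff le R : (deg R <= deg (conj_place R))%N.
  by apply/eqP; rewrite eqn_leq le andbT; have := le (conj_place Q); rewrite conj_placeK.
rewrite -(leq_exp2l _ _ (finNzRing_gt1 F)).
apply: (index_ge_le (ord_ge_subgroup (conj_place R) 1) _ (hle _)).
have [s [ss us sR sinj]] := hge R; exists [seq sg x | x <- s]; split.
- by rewrite size_map.
- by rewrite map_inj_uniq //; apply: fmorph_inj.
- by move=> _ /mapP[x xs ->]; rewrite /localring /= ord_ge_conj sgK; exact: sR.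
- move=> _ _ /mapP[x xs ->] /mapP[y ys ->].
  rewrite /localideal /= ord_ge_conj -rmorphB sgK => h.
  by rewrite (sinj x y).
Qed.

Lemma fdeg_conj_div D : fdeg deg (conj_div D) = fdeg deg D.
Proof.
rewrite -[D]freeg_sumE.
have sumE (I : Type) (r : seq I) (f : I -> divisor L) :
    conj_div (\sum_(i <- r) f i) = \sum_(i <- r) conj_div (f i).
  apply: (big_morph conj_div conj_divD).
  by apply: div_ext => Q; rewrite coeff_conj_div !coeff0.
rewrite sumE !raddf_sum; apply: eq_bigr => Q _ /=.
have -> : conj_div << coeff Q D *g Q >> = << coeff Q D *g conj_place Q >>.
  apply: div_ext => R; rewrite coeff_conj_div !coeffU.
  congr (_ * (nat_of_bool _)%:R); apply/eqP/eqP => [->|<-]; by rewrite conj_placeK.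
by rewrite /fdeg !liftU deg_conj_place.
Qed.

End Conjugation.

(** * Degree on the divisor class group *)

Section PicardGroup.
Variables (F : finFieldType) (K : fieldType) (k : {rmorphism F -> K}).
Variable deg : place K -> nat.
Hypothesis ff : function_field k deg.
Implicit Types (x y : K) (P : place K) (D E : divisor K) (c : Pic K).

Lemma divclass_surj c : exists D, c = divclass D.
Proof. by exists (generic_quotient.repr c); rewrite /divclass reprK. Qed.

Lemma divclassB D E : divclass (D - E) = divclass D - divclass E.
Proof. exact: (raddfB (\pi_(@Quotient.quot (divisor K) (@principal K)))). Qed.

Lemma divclassD D E : divclass (D + E) = divclass D + divclass E.
Proof. exact: (raddfD (\pi_(@Quotient.quot (divisor K) (@principal K)))). Qed.

Lemma divclass0 : divclass (0 : divisor K) = 0.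
Proof. exact: (raddf0 (\pi_(@Quotient.quot (divisor K) (@principal K)))). Qed.

Lemma divclassMn D i : divclass (D *+ i) = divclass D *+ i.
Proof.
elim: i => [|i IH]; first by rewrite !mulr0n divclass0.
by rewrite !mulrS divclassD IH.
Qed.

Lemma divclassP D E : divclass D = divclass E <-> exists2 x, x != 0 & D = E + pdiv x.
Proof.
rewrite /divclass; split=> [/eqP|[x x0 ->]].
  rewrite -Quotient.idealrBE => /asboolP[x [x0 xD]]; exists x => //.
  apply: div_ext => P; rewrite coeffD (ff_coeff_pdiv ff) -xD coeffB.
  by rewrite addrC subrK.
apply/eqP; rewrite -Quotient.idealrBE addrAC subrr add0r; apply/asboolP.
by exists x; split=> // P; rewrite (ff_coeff_pdiv ff).
Qed.

Lemma divclass_pdiv x : x != 0 -> divclass (pdiv x) = 0.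
Proof. by move=> x0; rewrite -divclass0; apply/divclassP; exists x; rewrite ?add0r. Qed.

Definition picdeg (c : Pic K) : int := fdeg deg (generic_quotient.repr c).

Lemma picdegE D : picdeg (divclass D) = fdeg deg D.
Proof.
rewrite /picdeg; set E := generic_quotient.repr _.
have /divclassP[x x0 ->] : divclass E = divclass D by rewrite /E /divclass reprK.
by rewrite raddfD /= (ff_fdeg_pdiv ff) // addr0.
Qed.

Lemma picdegB c d : picdeg (c - d) = picdeg c - picdeg d.
Proof.
have [D ->] := divclass_surj c; have [E ->] := divclass_surj d.
by rewrite -divclassB !picdegE raddfB.
Qed.

Lemma pic_finite0 : exists S : seq (Pic K), forall c, picdeg c = 0 -> c \in S.
Proof.
have [S hS] := ff_finite_class_group ff; exists [seq divclass E | E <- S] => c.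
have [D ->] := divclass_surj c; rewrite picdegE => /hS[E [x [ES x0 ->]]].
by apply/mapP; exists E => //; apply/divclassP; exists x.
Qed.

Lemma pic_nontrivial : exists c : Pic K, picdeg c != 0.
Proof.
have [P P0] := ff_place ff; exists (divclass << P >>).
by rewrite picdegE fdegU; lia.
Qed.

End PicardGroup.

(** * Divisor classes of a quadratic extension *)

Section QuadraticExtension.
Variables (F : finFieldType) (K L : fieldType).
Variables (kK : {rmorphism F -> K}) (kL : {rmorphism F -> L}) (io : {rmorphism K -> L}).
Variables (degK : place K -> nat) (degL : place L -> nat).
Hypothesis ffK : function_field kK degK.
Hypothesis ffL : function_field kL degL.
Hypothesis io_k : forall c, io (kK c) = kL c.
Variables (sg : {rmorphism L -> L}) (la : K) (r : L).
Hypothesis rr : r ^+ 2 = io la.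
Hypothesis coord : forall w, exists a b, w = io a + io b * r.
Hypothesis sg_io : forall a, sg (io a) = io a.
Hypothesis sg_r : sg r = - r.
Hypothesis two_neq0 : (2%:R : K) != 0.
Hypothesis la_even : forall P : place K, (2 %| P la)%Z.
Hypothesis la_nsq : forall a, a ^+ 2 != la.
Implicit Types (a b x y z : K) (u w : L) (P : place K) (Q R : place L).

Let la0 : la != 0.
Proof. by have := la_nsq 0; rewrite expr0n /= eq_sym. Qed.

Let io0 a : a != 0 -> io a != 0.
Proof. by rewrite fmorph_eq0. Qed.

Let r_neq0 : r != 0.
Proof. by apply: contraNneq (io0 la0) => r0; rewrite -rr r0 expr0n. Qed.

Let sgE a b : sg (io a + io b * r) = io a - io b * r.
Proof. by rewrite rmorphD rmorphM /= !sg_io sg_r mulrN. Qed.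

Let sgK w : sg (sg w) = w.
Proof.
have [a [b ->]] := coord w; rewrite sgE rmorphB rmorphM /= !sg_io sg_r.
by rewrite mulrN opprK.
Qed.

Let sg0 w : w != 0 -> sg w != 0.
Proof. by rewrite fmorph_eq0. Qed.

Let traceE w : exists a, w + sg w = io a.
Proof.
have [a [b ->]] := coord w; exists (a + a); rewrite sgE rmorphD.
by rewrite addrACA subrr addr0.
Qed.

Let normE w : exists a, w * sg w = io a.
Proof.
have [a [b ->]] := coord w; exists (a ^+ 2 - la * b ^+ 2); rewrite sgE.
by rewrite rmorphB rmorphXn rmorphM /= rmorphXn -rr; ring.
Qed.

Let place2 P : P 2%:R = 0.
Proof. by rewrite -(rmorph_nat kK) (place_const kK). Qed.

Section Restriction.
Variable Q : place L.

Let vD x y : x != 0 -> y != 0 -> x + y != 0 ->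
  Num.min (Q (io x)) (Q (io y)) <= Q (io (x + y)).
Proof. by move=> x0 y0 xy0; rewrite rmorphD placeD ?io0 // -rmorphD io0. Qed.

(** If [Q] were trivial on [K], an element [w] with [Q w = 1] and trace [t] would have norm
    [t w - w ^ 2], of positive order although it lies in [K]. *)
Let v_nontrivial : exists2 y, y != 0 & Q (io y) != 0.
Proof.
apply: contrapT => hn.
have triv y : y != 0 -> Q (io y) = 0.
  by move=> y0; apply/eqP; apply: contraT => h; case: hn; exists y.
have [w w0 Qw] := place_uniformizer Q.
have [t tE] := traceE w; have [N NE] := normE w.
have N0 : N != 0 by rewrite -(fmorph_eq0 io) -NE mulf_neq0 ?sg0.
suff : ord_ge Q 1 (io N) by rewrite ord_geE ?io0 // triv.
have hw : ord_ge Q 1 w by rewrite ord_geE // Qw.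
have -> : io N = io t * w - w * w by rewrite -NE -tE; ring.
apply: ord_geB.
  apply: ord_geM0 => //; have [->|t0] := eqVneq t 0; first by rewrite rmorph0 ord_ge0.
  by rewrite ord_geE ?io0 // triv.
by apply: ord_geM0 => //; apply: ord_geW hw.
Qed.

(** The values of [Q] on [K] form a subgroup of the integers; [e] is its least positive element, and
    dividing by it normalizes the restriction. *)
Let ramification : exists (e : nat) P, (0 < e)%N /\ forall x, Q (io x) = P x * e%:Z.
Proof.
pose A e := `[< (0 < e)%N /\ exists2 y, y != 0 & Q (io y) = e%:Z >].
have exA : exists e, A e.
  have [y y0 Qy] := v_nontrivial; exists `|Q (io y)|%N; apply/asboolP; split.
    by rewrite absz_gt0.
  have [h|h] := lerP 0 (Q (io y)); first by exists y => //; rewrite gez0_abs.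
  by exists y^-1; rewrite ?invr_eq0 // fmorphV placeV ltz0_abs.
have [e /asboolP[e0 [y y0 Qy]] emin] := ex_minnP exA.
have ez : e%:Z != 0 by lia.
have dvd x : (e %| Q (io x))%Z.
  have [->|x0] := eqVneq x 0; first by rewrite rmorph0 place0 dvdz0.
  apply/dvdz_mod0P; have [//|nz] := eqVneq (Q (io x) %% e)%Z 0; exfalso.
  have lt : ((Q (io x) %% e)%Z < e) by rewrite ltz_pmod.
  have ge : (0 <= Q (io x) %% e)%Z by rewrite modz_ge0.
  have /emin : A `|(Q (io x) %% e)%Z|%N; last by lia.
  apply/asboolP; split; first by rewrite absz_gt0.
  exists (x / y ^ (Q (io x) %/ e)%Z); first by rewrite mulf_neq0 ?invr_eq0 ?expfz_neq0.
  rewrite fmorph_div fmorphXz place_div ?expfz_neq0 ?io0 // placeXz Qy.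
  by rewrite {1}(divz_eq (Q (io x)) e) [e%:Z * _]mulrC addrAC subrr add0r gez0_abs.
pose v x := (Q (io x) %/ e)%Z.
have vE x : Q (io x) = v x * e%:Z by rewrite divzK.
have vN : normalized_valuation v.
  split.
  - by rewrite /v rmorph0 place0 div0z.
  - move=> x x' x0 x'0; apply: (mulIf ez); rewrite mulrDl -!vE rmorphM.
    by rewrite placeM ?io0.
  - move=> x x' x0 x'0 xx'0; have := vD x0 x'0 xx'0.
    by rewrite !vE -minr_pMl ?ler_pM2r //; lia.
  - by exists y => //; apply: (mulIf ez); rewrite -vE Qy mul1r.
by exists e, (Place (introT (asboolP _) vN)).
Qed.

(* The valuations of K are unramified in L because la is a unit up to squares. *)
Lemma restriction : exists P, forall x, Q (io x) = P x.
Proof.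
have [e [P [e0 QP]]] := ramification; exists P => x; rewrite QP.
suff -> : e = 1%N by rewrite mulr1.
apply/eqP; apply: contraT => e1.
have ez : (0 : int) < e by lia.
have ne1 q : q * e%:Z != 1.
  apply/eqP => h; have : (e %| 1)%Z by apply/dvdzP; exists q.
  by rewrite dvdz1 => /eqP; lia.
have ordQ y : ord_ge P 0 y -> ord_ge Q 0 (io y).
  by rewrite /ord_ge fmorph_eq0 QP pmulr_lge0.
have [p p0 Pp] := place_uniformizer P.
have /dvdzP[h hE] := la_even P.
(* As [la] has even order [h * 2], dividing its root by [p ^ h] gives a unit [r'] that still
   generates [L] over [K]. *)
pose c := p ^ (- h); have c0 : c != 0 by rewrite expfz_neq0.
have Pc : P c = - h by rewrite placeXz Pp mul1r.
pose r' := r * io c.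
have r'2 : r' ^+ 2 = io (la * c ^+ 2) by rewrite exprMn rr rmorphM rmorphXn.
have lac0 : la * c ^+ 2 != 0 by rewrite mulf_neq0 ?expf_neq0.
have Qr' : Q r' = 0.
  have : Q (r' ^+ 2) = 0.
    by rewrite r'2 QP placeM ?expf_neq0 // placeX hE Pc; lia.
  by rewrite placeX; lia.
have [w w0 Qw] := place_uniformizer Q.
have [a [b0 wE]] := coord w; pose b := b0 / c.
have wE' : w = io a + io b * r'.
  by rewrite wE /r' /b fmorph_div; field; exact: (io0 c0).
(* Dividing by the coordinate [z] of smaller order makes both coordinates of [w'] integral and one
   of them 1. Its order [1 - P z * e] is nonnegative, and nonzero when [e > 1], hence positive; the
   conjugate [u] is then a unit because 2 and [r'] are. So the norm of [w'] has order [1 - P z * e],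
   which would have to be a multiple of [e]. *)
have [z [z0 za zb zab]] : exists z, [/\ z != 0, ord_ge P (P z) a, ord_ge P (P z) b &
    z = a \/ z = b].
  have [a0|a0] := eqVneq a 0.
    have b0' : b != 0 by apply: contraNneq w0 => b0'; rewrite wE' a0 b0' !rmorph0 mul0r addr0.
    by exists b; rewrite b0' a0 ord_ge0 ord_geE //; split=> //; right.
  have [b0'|b0'] := eqVneq b 0.
    by exists a; rewrite a0 b0' ord_ge0 ord_geE //; split=> //; left.
  have [ab|/ltW ba] := lerP (P a) (P b).
    by exists a; rewrite a0 !ord_geE //; split=> //; left.
  by exists b; rewrite b0' !ord_geE //; split=> //; right.
have scale y : ord_ge P (P z) y -> ord_ge P 0 (y / z).
  have [->|y0] := eqVneq y 0; first by rewrite mul0r !ord_ge0.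
  by rewrite !ord_geE ?mulf_neq0 ?invr_eq0 // place_div // subr_ge0.
pose a' := a / z; pose b' := b / z; pose w' := w / io z.
have w'E : w' = io a' + io b' * r'.
  by rewrite /w' wE' /a' /b' !fmorph_div; field; rewrite !io0.
have w'0 : w' != 0 by rewrite mulf_neq0 ?invr_eq0 ?io0.
have Qw' : Q w' = 1 - P z * e%:Z by rewrite place_div ?io0 // Qw QP.
have Qw'1 : ord_ge Q 1 w'.
  rewrite ord_geE //; have : ord_ge Q 0 w'.
    rewrite w'E; apply: ord_geD; first exact/ordQ/scale.
    apply: ord_geM0; first exact/ordQ/scale.
    by rewrite /ord_ge Qr' lexx orbT.
  rewrite ord_geE // => ge; have : Q w' != 0.
    by rewrite Qw' subr_eq0 eq_sym ne1.
  by lia.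
pose u := io a' - io b' * r'.
have uE : sg w' = u.
  have sgr' : sg r' = - r' by rewrite /r' rmorphM /= sg_r sg_io mulNr.
  by rewrite w'E rmorphD rmorphM /= !sg_io sgr' mulrN.
have Q2 : Q 2%:R = 0 by rewrite -(rmorph_nat io) QP place2 mul0r.
have t0 : 2%:R != 0 :> L by rewrite -(rmorph_nat io) fmorph_eq0.
have r'0 : r' != 0 by rewrite mulf_neq0 ?r_neq0 ?io0.
have Qu : Q u = 0.
  case: zab => zE.
    have a1 : a' = 1 by rewrite /a' -zE divff.
    have -> : u = 2%:R - w' by rewrite /u w'E a1 rmorph1; ring.
    by rewrite -[RHS]Q2; apply: (placeDl t0 _).2; rewrite Q2 add0r ord_geN.
  have b1 : b' = 1 by rewrite /b' -zE divff.
  have -> : u = - (2%:R * r') + w' by rewrite /u w'E b1 rmorph1; ring.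
  have n0 : - (2%:R * r') != 0 by rewrite oppr_eq0 mulf_neq0.
  have Qn : Q (- (2%:R * r')) = 0 by rewrite placeN placeM // Q2 Qr'.
  by rewrite -[RHS]Qn; apply: (placeDl n0 _).2; rewrite Qn add0r.
have u0 : u != 0 by rewrite -uE sg0.
have [N NE] := normE w'.
have := QP N; rewrite -NE uE placeM // Qu Qw' addr0 => e3.
have := ne1 (P N + P z); rewrite mulrDl -e3 subrK.
by rewrite eqxx.
Qed.

End Restriction.

Definition res (Q : place L) : place K := projT1 (cid (restriction Q)).

Lemma resE Q x : Q (io x) = res Q x.
Proof. by rewrite /res; case: cid. Qed.

Lemma ord_ge_res Q N x : ord_ge Q N (io x) = ord_ge (res Q) N x.
Proof. by rewrite /ord_ge fmorph_eq0 resE. Qed.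

Local Notation cj := (conj_place sgK).

Lemma res_conj Q : res (cj Q) = res Q.
Proof. by apply: place_ext => x _; rewrite -!resE conj_placeE sg_io. Qed.

(** [chevalley] in [L] for the images of the local ring of [P] and of its ideal: the resulting
    valuation ring restricts to a ring containing that of [P], and [place_le_eq] gives equality. *)
Lemma place_above P : exists Q, res Q = P.
Proof.
pose A : set L := [set io x | x in [set x | ord_ge P 0 x]].
pose I : set L := [set io x | x in [set x | ord_ge P 1 x]].
have [s0P [s1P sMP]] := localring_subring P.
have sA : is_subring A.
  split; [split|split].
  - by exists 0; rewrite ?rmorph0 //; exact: ord_ge0.
  - by move=> _ _ [x Px <-] [y Py <-]; exists (x - y); rewrite ?rmorphB //; apply: ord_geB.
  - by exists 1; rewrite ?rmorph1.
  - by move=> _ _ [x Px <-] [y Py <-]; exists (x * y); rewrite ?rmorphM //; apply: ord_geM0.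
have sI : is_proper_ideal A I.
  split; last split; last split.
  - split; first by exists 0; rewrite ?rmorph0 //; exact: ord_ge0.
    by move=> _ _ [x Px <-] [y Py <-]; exists (x - y); rewrite ?rmorphB //; apply: ord_geB.
  - by move=> _ [x Px <-]; exists x => //; apply: ord_geW Px.
  - move=> [x Px] e; have x1 : x = 1 by apply: (fmorph_inj io); rewrite rmorph1.
    by move: Px; rewrite x1 /= ord_geE ?oner_neq0 // place1.
  - by move=> _ _ [x Px <-] [y Py <-]; exists (x * y); rewrite ?rmorphM //; apply: ord_geM0.
have [O [sO AO dich nI]] := chevalley sA sI.
have kO (c : F) : O (kL c) by apply: AO; exists (kK c); rewrite ?io_k //; exact: (ord_ge_const kK).
have [[s [n [w sw]]] _ _] := ffL.
have [p p0 Pp] := place_uniformizer P.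
have Ip : I (io p) by exists p; rewrite // /= ord_geE // Pp.
have [|Q QO] := place_of_valuation_ring sO kO dich sw.
  exists (io p); split; [exact: io0| |exact: nI Ip (io0 p0)].
  by apply: AO; exists p; rewrite //= ord_geE // Pp.
exists Q; apply/esym/place_le_eq => x x0 Px; rewrite -resE; apply/QO; first exact: io0.
by apply: AO; exists x; rewrite //= ord_geE.
Qed.

(** An element [w] vanishing at [R] and a unit at [Q] and its conjugate would have a norm that
    vanishes at [R] but not at [Q], though both places restrict to the same one. The conjugate of
    [R] joins the approximation to keep [sg w] integral at [R]. *)
Lemma res_fiber Q R : res Q = res R -> R = Q \/ R = cj Q.
Proof.
move=> e; apply: contrapT => hn.
have RQ : R != Q by apply/eqP => h; apply: hn; left.
have RcQ : R != cj Q by apply/eqP => h; apply: hn; right.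
have [|x [xR xS]] := @weak_approx _ R [seq T <- [:: Q; cj Q; cj R] | T != R] 1.
  by rewrite mem_filter eqxx.
pose w := 1 - x.
have wR : ord_ge R 1 w by rewrite -ord_geN /w opprB.
have unit T : T \in [:: Q; cj Q; cj R] -> T != R -> w != 0 /\ T w = 0.
  move=> TS TR; apply: place1Dpos; rewrite ord_geN; apply: xS.
  by rewrite mem_filter TR.
have [w0 Qw] : w != 0 /\ Q w = 0 by apply: unit; rewrite ?inE ?eqxx // eq_sym.
have [_ cQw] : w != 0 /\ cj Q w = 0 by apply: unit; rewrite ?inE ?eqxx ?orbT // eq_sym.
have cRw : ord_ge R 0 (sg w).
  rewrite -(ord_ge_conj sgK); have [cR|cR] := eqVneq (cj R) R.
    by rewrite cR; apply: ord_geW wR.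
  have [_ h] : w != 0 /\ cj R w = 0 by apply: unit; rewrite ?inE ?eqxx ?orbT.
  by rewrite /ord_ge h lexx orbT.
have [N NE] := normE w.
have N0 : N != 0 by rewrite -(fmorph_eq0 io) -NE mulf_neq0 ?sg0.
have h1 : Q (io N) = 0.
  by rewrite -NE placeM ?sg0 // Qw -(conj_placeE sgK) cQw.
have h2 : ord_ge R 1 (io N) by rewrite -NE mulrC; apply: ord_geM0.
by move: h2; rewrite ord_geE ?io0 // resE -e -resE h1.
Qed.

(** If [Q] were fixed, [x - r] and [x + r] would have equal order, hence both high order when
    [x ^ 2] is close to [la]; but their difference [2 r] has a fixed order. *)
Lemma split_place Q : (forall N : nat, exists x, ord_ge (res Q) N (x ^+ 2 - la)) -> cj Q != Q.
Proof.
move=> sq; apply/eqP => cQ.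
have r0 := r_neq0.
have t0 : 2%:R != 0 :> L by rewrite -(rmorph_nat io) fmorph_eq0.
have tr0 : 2%:R * r != 0 by rewrite mulf_neq0.
pose M := (`|(Q (2%:R * r))%R|.+1)%N.
have [x hx] := sq (M + M)%N.
have d0 : x ^+ 2 - la != 0 by rewrite subr_eq0 la_nsq.
have fE : io (x ^+ 2 - la) = (io x - r) * (io x + r).
  by rewrite rmorphB rmorphXn /= -rr; ring.
have /andP[m0 p0] : (io x - r != 0) && (io x + r != 0).
  by rewrite -negb_or -mulf_eq0 -fE fmorph_eq0.
have eq_mp : Q (io x - r) = Q (io x + r).
  by rewrite -[in LHS]cQ conj_placeE rmorphB /= sg_io sg_r opprK.
move: hx; rewrite -ord_ge_res fE ord_geE ?mulf_neq0 // placeM // eq_mp => hM.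
have hM' : M%:Z <= Q (io x + r) by lia.
have : ord_ge Q M (2%:R * r).
  have -> : 2%:R * r = (io x + r) - (io x - r) by ring.
  by apply: ord_geB; rewrite ord_geE // eq_mp.
by rewrite ord_geE // /M; lia.
Qed.

Fact lift_subproof (D : divisor K) : exists E : divisor L, forall Q,
  coeff Q E = coeff (res Q) D.
Proof.
have /boolp.choice[ab abP] := place_above.
apply: (@divisor_of_fun _ _ ([seq ab P | P <- dom D] ++ [seq cj (ab P) | P <- dom D])).
move=> Q; rewrite -mem_dom mem_cat => QD.
have [->|->] := @res_fiber (ab (res Q)) Q (abP _).
  by rewrite map_f ?abP.
by rewrite orbC (map_f (fun P => cj (ab P))) // res_conj abP.
Qed.

(** The conorm; coefficients are copied because no place ramifies. *)
Definition lift_div (D : divisor K) : divisor L := projT1 (cid (lift_subproof D)).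

Lemma coeff_lift_div Q D : coeff Q (lift_div D) = coeff (res Q) D.
Proof. by rewrite /lift_div; case: cid => E /= ->. Qed.

Lemma lift_divD D E : lift_div (D + E) = lift_div D + lift_div E.
Proof. by apply: div_ext => Q; rewrite coeffD !coeff_lift_div coeffD. Qed.

Lemma lift_div_sum (I : finType) (f : I -> divisor K) :
  lift_div (\sum_i f i) = \sum_i lift_div (f i).
Proof.
apply: (big_morph lift_div lift_divD).
by apply: div_ext => Q; rewrite coeff_lift_div !coeff0.
Qed.

Lemma lift_divMn D i : lift_div (D *+ i) = lift_div D *+ i.
Proof. by apply: div_ext => Q; rewrite coeff_lift_div !coeffMn coeff_lift_div. Qed.

Lemma lift_pdiv x : lift_div (pdiv x) = pdiv (io x).
Proof.
by apply: div_ext => Q; rewrite coeff_lift_div (ff_coeff_pdiv ffK) (ff_coeff_pdiv ffL) resE.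
Qed.

Local Notation cjd := (conj_div sgK).

Lemma conj_lift D : cjd (lift_div D) = lift_div D.
Proof. by apply: div_ext => Q; rewrite coeff_conj_div !coeff_lift_div res_conj. Qed.

(** An invariant divisor is constant on the fibres of [res], and without ramification that makes it
    a conorm. *)
Lemma conj_invariant (C : divisor L) : cjd C = C -> exists D, C = lift_div D.
Proof.
move=> cC; have /boolp.choice[ab abP] := place_above.
have [D DE] : exists D : divisor K, forall P, coeff P D = coeff (ab P) C.
  apply: (@divisor_of_fun _ _ [seq res Q | Q <- dom C]) => P h.
  by apply/mapP; exists (ab P); rewrite ?abP // mem_dom.
exists D; apply: div_ext => Q; rewrite coeff_lift_div DE.
have [e|e] := @res_fiber (ab (res Q)) Q (abP _); first by rewrite {1}e.
by rewrite {1}e -coeff_conj_div cC.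
Qed.

Lemma lift_split_place Q : cj Q != Q ->
  lift_div << res Q >> = << Q >> + cjd << Q >>.
Proof.
move=> ne; apply: div_ext => R.
rewrite conj_divU coeffD coeff_lift_div !coeffU !mul1r.
have [<-|QR] := eqVneq Q R; first by rewrite eqxx (negPf ne).
have [<-|cQR] := eqVneq (cj Q) R; first by rewrite res_conj eqxx.
case: eqP => // /res_fiber[] RE; first by rewrite RE eqxx in QR.
by rewrite RE eqxx in cQR.
Qed.

Hypothesis fullK : forall x, x != 0 -> (forall P, P x = 0) -> exists c : F, x = kK c.
Hypothesis nonsquare_ratio : forall c1 c2 : F, c1 != 0 -> c2 != 0 ->
  ~ (exists d, c1 = d ^+ 2) -> ~ (exists d, c2 = d ^+ 2) -> exists d, c1 / c2 = d ^+ 2.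
Hypothesis norm_surj : forall c0 c : F, ~ (exists d, c0 = d ^+ 2) ->
  exists a b : F, c = a ^+ 2 - c0 * b ^+ 2.

Let sgP (c : Pic L) : Pic L := divclass (cjd (generic_quotient.repr c)).

Let sgPE D : sgP (divclass D) = divclass (cjd D).
Proof.
rewrite /sgP; set E := generic_quotient.repr _.
have /(divclassP ffL)[w w0 ->] : divclass E = divclass D by rewrite /E /divclass reprK.
apply/(divclassP ffL); exists (sg w); first exact: sg0.
by rewrite conj_divD (conj_pdiv sgK ffL).
Qed.

Let sgPB c d : sgP (c - d) = sgP c - sgP d.
Proof.
have [D ->] := divclass_surj c; have [E ->] := divclass_surj d.
by rewrite -divclassB !sgPE conj_divB divclassB.
Qed.

Let sgPK c : sgP (sgP c) = c.
Proof. by have [D ->] := divclass_surj c; rewrite !sgPE conj_divK. Qed.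

Let picdeg_sgP c : picdeg degL (sgP c) = picdeg degL c.
Proof.
have [D ->] := divclass_surj c; rewrite sgPE !(picdegE ffL).
exact: fdeg_conj_div ffL D.
Qed.

Let herbrandL := herbrand sgPB sgPK (picdegB ffL) picdeg_sgP (pic_finite0 ffL)
  (pic_nontrivial ffL).

(** The constant attached to an invariant class. It is the obstruction to making [C] itself
    invariant by a principal divisor, which succeeds when [c] is the norm of a unit. *)
Let has_norm (C : divisor L) (c : F) :=
  exists w, [/\ w != 0, C - cjd C = pdiv w & w * sg w = kL c].

Let constL (c : F) Q : Q (kL c) = 0.
Proof. exact: place_const. Qed.

Let unit_pdiv w : (forall Q, Q w = 0) -> pdiv w = 0.
Proof. by move=> h; apply: div_ext => Q; rewrite (ff_coeff_pdiv ffL) h coeff0. Qed.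

(** The divisor of [w] is [C] minus its conjugate, so the norm of [w] has order 0 everywhere and is
    a constant of [K]. *)
Let ex_has_norm C : sgP (divclass C) = divclass C -> exists2 c : F, c != 0 & has_norm C c.
Proof.
rewrite sgPE => /esym/(divclassP ffL)[w w0 CE].
have [N NE] := normE w.
have N0 : N != 0 by rewrite -(fmorph_eq0 io) -NE mulf_neq0 ?sg0.
have wE : C - cjd C = pdiv w by rewrite {1}CE addrAC subrr add0r.
have PN P : P N = 0.
  have [Q <-] := place_above P; rewrite -resE -NE placeM ?sg0 //.
  rewrite -(conj_placeE sgK) -!(ff_coeff_pdiv ffL) -wE !coeffB !coeff_conj_div.
  by rewrite conj_placeK addrA subrK subrr.
have [c cE] := fullK N0 PN; exists c.
  by apply: contraNneq N0 => c0; rewrite cE c0 rmorph0.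
by exists w; split=> //; rewrite NE cE io_k.
Qed.

Variables (n : nat) (b : 'I_n -> place K).
Hypothesis b_approx : forall i (N : nat), exists x, ord_ge (b i) N (x ^+ 2 - la).
Hypothesis b_span : forall D : divisor K, exists (c : 'I_n -> nat) (E : divisor K) x,
  x != 0 /\ D = \sum_i << b i >> *+ c i + E *+ 2 + pdiv x.

(** Each [b i] splits, so its conorm is a place plus the conjugate place; the conorm of [E *+ 2] is
    that of [E] plus its conjugate, conorms being invariant. *)
Let norms_span (D : divisor K) : exists (C : divisor L) x,
  x != 0 /\ lift_div D = C + cjd C + lift_div (pdiv x).
Proof.
have [c [E [x [x0 ->]]]] := b_span D.
have /boolp.choice[Q QE] := fun i => place_above (b i).
exists (\sum_i << Q i >> *+ c i + lift_div E), x; split=> //.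
rewrite !lift_divD lift_div_sum; congr (_ + _).
rewrite conj_divD conj_lift addrACA; congr (_ + _).
have cj0 : cjd 0 = 0 by apply: div_ext => R; rewrite coeff_conj_div !coeff0.
rewrite (big_morph _ (conj_divD sgK) cj0) -big_split; apply: eq_bigr => i _ /=.
have cjMn D' k : cjd (D' *+ k) = cjd D' *+ k.
  by apply: div_ext => R; rewrite coeff_conj_div !coeffMn coeff_conj_div.
rewrite lift_divMn cjMn -mulrnDl -QE lift_split_place //.
by apply: split_place => N; rewrite QE.
Qed.

(** [1 + v] works unless it vanishes, and then [v = -1] is [r / sg r]. *)
Let hilbert90 v : v != 0 -> v * sg v = 1 -> exists2 u, u != 0 & v = u / sg u.
Proof.
move=> v0 vN; have [e|v1] := eqVneq (1 + v) 0.
  exists r; first exact: r_neq0.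
  rewrite sg_r invrN mulrN divff ?r_neq0 //; apply/eqP.
  by rewrite -addr_eq0 addrC e.
exists (1 + v) => //; have s1 : 1 + sg v != 0 by rewrite -(rmorph1 sg) -rmorphD sg0.
rewrite rmorphD rmorph1; apply: (mulIf s1); rewrite divfK //.
by rewrite mulrDr mulr1 vN addrC.
Qed.

(** Dividing [w] by [ka] gives norm 1, so Hilbert 90 makes [C] minus a principal divisor invariant.
    The result is a conorm, hence a norm up to a principal divisor by [norms_span]. *)
Let norm_const_is_norm C (c : F) (ka : L) : has_norm C c -> ka != 0 ->
  (forall Q, Q ka = 0) -> ka * sg ka = kL c -> is_norm sgP (divclass C).
Proof.
move=> [w [w0 wE wN]] ka0 kaP kaN.
have [||u u0 uE] := @hilbert90 (w / ka); first by rewrite mulf_neq0 ?invr_eq0.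
  rewrite fmorph_div mulf_div wN kaN divff // -kaN mulf_neq0 ?sg0 //.
have su0 := sg0 u0.
have inv : cjd (C - pdiv u) = C - pdiv u.
  rewrite conj_divB (conj_pdiv sgK ffL).
  have h : pdiv w = pdiv u - pdiv (sg u).
    rewrite -(ff_pdivV ffL) -(ff_pdivM ffL) ?invr_eq0 // -uE.
    by rewrite (ff_pdivM ffL) ?invr_eq0 // (ff_pdivV ffL) (unit_pdiv kaP) subr0.
  rewrite h in wE; move/eqP: wE; rewrite subr_eq => /eqP CE.
  by rewrite {2}CE addrAC [_ - _ - pdiv u]addrAC subrr add0r addrC.
have [D DE] := conj_invariant inv.
have [C1 [x [x0 xE]]] := norms_span D.
exists (divclass C1); rewrite sgPE -divclassD; apply/(divclassP ffL).
exists (io x * u); first by rewrite mulf_neq0 ?io0.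
rewrite (ff_pdivM ffL) ?io0 // addrA -lift_pdiv -xE -DE subrK.
by [].
Qed.

Let has_normB C1 C2 (c1 c2 : F) : has_norm C1 c1 -> has_norm C2 c2 ->
  has_norm (C1 - C2) (c1 / c2).
Proof.
move=> [w1 [w10 E1 N1]] [w2 [w20 E2 N2]]; exists (w1 / w2).
rewrite mulf_neq0 ?invr_eq0 // fmorph_div mulf_div N1 N2 -fmorph_div; split=> //.
rewrite (ff_pdivM ffL) ?invr_eq0 // (ff_pdivV ffL) -E1 -E2 conj_divB.
by rewrite !opprD !opprK addrACA.
Qed.

Lemma const_case (c0 : F) x : la = kK c0 * x ^+ 2 -> False.
Proof.
move=> laE; have x0 : x != 0.
  by apply: contraNneq la0 => x0; rewrite laE x0 expr0n mulr0.
have iox := io0 x0.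
have c0n : ~ exists d, c0 = d ^+ 2.
  by move=> [d dE]; move/eqP: (la_nsq (kK d * x)); rewrite laE dE exprMn rmorphXn.
have [[m [minv mn]] _] := herbrandL; apply: mn.
have [C CE] := divclass_surj m; rewrite CE in minv *.
have [c cn0 hc] := ex_has_norm minv.
have [a [a1 abE]] := norm_surj c c0n.
(* [t] is a square root of the constant [c0], so the norm form represented by [norm_surj] becomes
   the norm of [a + a1 t]. *)
pose t := r / io x.
have t2 : t ^+ 2 = kL c0.
  by rewrite expr_div_n rr laE rmorphM rmorphXn /= mulfK ?expf_neq0 // io_k.
have st : sg t = - t by rewrite /t fmorph_div sg_r sg_io mulNr.
have sgk d : sg (kL d) = kL d by rewrite -io_k sg_io.
pose ka := kL a + kL a1 * t.
have ska : sg ka = kL a - kL a1 * t by rewrite rmorphD rmorphM /= !sgk st mulrN.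
have kaN : ka * sg ka = kL c.
  by rewrite ska abE rmorphB rmorphXn rmorphM /= rmorphXn -t2 /ka; ring.
have ka0 : ka != 0.
  by apply: contraNneq cn0 => ka0; move/eqP: kaN; rewrite ka0 mul0r eq_sym fmorph_eq0.
have t0 Q : ord_ge Q 0 t.
  have : Q (t ^+ 2) = 0 by rewrite t2 constL.
  rewrite placeX => h; rewrite /ord_ge; apply/orP; right; lia.
(* [ka] and its conjugate are integral everywhere with constant product, so both have order 0. *)
have kage Q : 0 <= Q ka.
  rewrite -ord_geE //; apply: ord_geD; first exact: ord_ge_const.
  by apply: ord_geM0; first exact: ord_ge_const.
apply: (norm_const_is_norm hc ka0 _ kaN) => Q.
have : Q ka + Q (sg ka) = 0 by rewrite -placeM ?sg0 // kaN constL.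
by have := kage Q; have := kage (cj Q); rewrite conj_placeE; lia.
Qed.

Lemma geometric_case : (forall (c0 : F) x, la != kK c0 * x ^+ 2) -> False.
Proof.
move=> geom; have [_ H1] := herbrandL.
(* A square constant [d ^ 2] is the norm of [d]. So invariant classes that are not norms carry
   nonsquare constants, two of which have a square ratio: this is the congruence hypothesis of
   [herbrand]. *)
have nonsq C c : has_norm C c -> c != 0 -> ~ is_norm sgP (divclass C) ->
    ~ exists d, c = d ^+ 2.
  move=> hc c0 nC [d dE]; apply: nC; apply: (norm_const_is_norm hc (ka := kL d)).
  - by rewrite fmorph_eq0; apply: contraNneq c0 => d0; rewrite dE d0 expr0n.
  - by move=> Q; exact: constL.
  - by rewrite -io_k sg_io dE rmorphXn /= -io_k expr2.
have [D0 D0E] := half_pdiv ffK la_even.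
(* Half of the divisor of [la] lifts to the divisor of [r]; writing it as a norm up to [x] yields a
   class [C] killed by [1 + sg]. *)
have rE : lift_div D0 = pdiv r.
  apply: div_ext => Q.
  have : coeff Q (lift_div (D0 *+ 2)) = Q (r ^+ 2).
    by rewrite -D0E lift_pdiv (ff_coeff_pdiv ffL) rr.
  rewrite lift_divMn coeffMn placeX (ff_coeff_pdiv ffL) => /eqP.
  by rewrite eqr_pMn2r // => /eqP.
have [C [x [x0 xE]]] := norms_span D0.
have iox := io0 x0.
have CE : C + cjd C = pdiv (r / io x).
  rewrite (ff_pdivM ffL) ?r_neq0 ?invr_eq0 // (ff_pdivV ffL) -rE xE lift_pdiv.
  by rewrite addrK.
have C0 : divclass C + sgP (divclass C) = 0.
  by rewrite sgPE -divclassD CE (divclass_pdiv ffL) ?mulf_neq0 ?r_neq0 ?invr_eq0.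
have [m mE] : exists m, divclass C = m - sgP m.
  apply: H1 => // m1 m2; have [C1 ->] := divclass_surj m1; have [C2 ->] := divclass_surj m2.
  move=> i1 i2 n1 n2.
  have [c1 c10 h1] := ex_has_norm i1; have [c2 c20 h2] := ex_has_norm i2.
  have [d dE] := nonsquare_ratio c10 c20 (nonsq _ _ h1 c10 n1) (nonsq _ _ h2 c20 n2).
  have h12 := has_normB h1 h2; rewrite -divclassB.
  apply: contrapT => n12; apply: (nonsq _ _ h12 _ n12); last by exists d.
  by rewrite mulf_neq0 ?invr_eq0.
have [B BE] := divclass_surj m.
move: mE; rewrite BE sgPE -divclassB => /(divclassP ffL)[w w0 CwE].
have [N NE] := normE w.
have N0 : N != 0 by rewrite -(fmorph_eq0 io) -NE mulf_neq0 ?sg0.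
(* Writing [C] as [B - sg B] plus the divisor of [w] turns [C + sg C] into the divisor of the norm
   [N]. Hence [r] is a unit times an element of [K]; the square of that unit is a unit of [K], that
   is, a constant. *)
have : pdiv (r / io x) = pdiv (io N).
  rewrite -CE CwE conj_divD conj_divB conj_divK (conj_pdiv sgK ffL) -NE.
  rewrite (ff_pdivM ffL) ?sg0 // addrACA addrA [B - _ + _]addrA subrK subrr.
  by rewrite add0r.
have p1 : r / io x != 0 by rewrite mulf_neq0 ?r_neq0 ?invr_eq0.
move=> /(pdiv_eqP ffL p1 (io0 N0))[ka kaP kaE].
have z0 : x * N != 0 by rewrite mulf_neq0.
have kaE' : r = ka * io (x * N).
  by rewrite rmorphM /= mulrCA -kaE mulrC divfK.
pose y' := la / (x * N) ^+ 2.
have ka2 : ka ^+ 2 = io y'.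
  rewrite fmorph_div rmorphXn /= -rr kaE' exprMn mulfK //.
  by rewrite expf_neq0 // io0.
have y'0 : y' != 0 by rewrite mulf_neq0 ?invr_eq0 ?expf_neq0.
have Py P : P y' = 0.
  by have [Q <-] := place_above P; rewrite -resE -ka2 placeX kaP mul0rn.
have [c cE] := fullK y'0 Py.
have /eqP[] := geom c (x * N).
by rewrite -cE /y' divfK // expf_neq0.
Qed.

Lemma norms_span_contradiction : False.
Proof.
have [[c0 [x e]]|hn] := pselect (exists (c0 : F) x, la = kK c0 * x ^+ 2).
  exact: const_case e.
apply: geometric_case => c0 x; apply/eqP => e; apply: hn.
by exists c0, x.
Qed.

End QuadraticExtension.

(** * Squares in finite fields *)

Section FiniteSquares.
Variables (R : comNzRingType) (S : seq R).
Hypothesis SP : forall x : R, x \in S.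
Hypothesis invR : forall x : R, x != 0 -> exists y, x * y = 1.
Hypothesis two_neq0 : (2%:R : R) != 0.

Let mulf_eq0 (x y : R) : x * y = 0 -> x = 0 \/ y = 0.
Proof.
move=> xy; have [->|x0] := eqVneq x 0; [by left|right].
by have [z xz] := invR x0; rewrite -[y]mul1r -xz mulrAC xy mul0r.
Qed.

Let mul_neq0 (x y : R) : x != 0 -> y != 0 -> x * y != 0.
Proof. by move=> x0 y0; apply/eqP => /mulf_eq0[] /eqP; rewrite ?(negPf x0) ?(negPf y0). Qed.

Let mulI (x y z : R) : x != 0 -> x * y = x * z -> y = z.
Proof.
move=> x0 /eqP; rewrite -subr_eq0 -mulrBr => /eqP/mulf_eq0[/eqP|/eqP].
  by rewrite (negPf x0).
by rewrite subr_eq0 => /eqP.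
Qed.

Definition nonzero_elements : seq R := undup [seq x <- S | x != 0].
Definition nonzero_squares : seq R := undup [seq x ^+ 2 | x <- nonzero_elements].

Let unitsP x : (x \in nonzero_elements) = (x != 0).
Proof. by rewrite mem_undup mem_filter SP andbT. Qed.

Let squaresP x : x \in nonzero_squares -> exists2 y, y != 0 & x = y ^+ 2.
Proof. by rewrite mem_undup => /mapP[y]; rewrite unitsP => y0 ->; exists y. Qed.

Lemma size_nonzero_squares : (size nonzero_elements <= 2 * size nonzero_squares)%N.
Proof.
have /boolp.choice[rt rtP] : forall b, exists a : R, (b \in nonzero_squares) -> b = a ^+ 2.
  move=> b; have [/squaresP[a _ ->]|nb] := boolP (b \in nonzero_squares).
    by exists a.
  by exists 0.
have -> : (2 * size nonzero_squares = size ([seq rt b | b <- nonzero_squares] ++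
    [seq - rt b | b <- nonzero_squares]))%N.
  by rewrite size_cat !size_map mul2n addnn.
apply: uniq_leq_size; first exact: undup_uniq.
move=> a aU; have bS : a ^+ 2 \in nonzero_squares.
  by rewrite mem_undup; apply/mapP; exists a.
have : (a - rt (a ^+ 2)) * (a + rt (a ^+ 2)) = 0.
  by rewrite -subr_sqr -rtP // subrr.
rewrite mem_cat => /mulf_eq0[/eqP|/eqP].
  by rewrite subr_eq0 => /eqP e; apply/orP; left; apply/mapP; exists (a ^+ 2).
by rewrite addr_eq0 => /eqP e; apply/orP; right; apply/mapP; exists (a ^+ 2).
Qed.

(** Otherwise the nonzero squares and their multiples by [x] and by [y] are three disjoint sets of
    equal size, but there are at most twice as many nonzero elements as nonzero squares. Working
    with a ring with inverses covers the residue rings of places. *)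
Lemma nonsquareM (x y : R) : x != 0 -> y != 0 -> ~ (exists d, x = d ^+ 2) ->
  ~ (exists d, y = d ^+ 2) -> exists d, x * y = d ^+ 2.
Proof.
move=> x0 y0 nx ny; apply: contrapT => nxy.
have sq_uniq : uniq nonzero_squares := undup_uniq _.
have div (z a b : R) : a != 0 -> z * a ^+ 2 = b ^+ 2 -> exists d, z = d ^+ 2.
  move=> a0 e; have [c ac] := invR a0; exists (b * c).
  by rewrite exprMn -e -mulrA -exprMn ac expr1n mulr1.
pose l := nonzero_squares ++ [seq x * b | b <- nonzero_squares] ++
  [seq y * b | b <- nonzero_squares].
have ul : uniq l.
  rewrite !cat_uniq sq_uniq !map_inj_in_uniq //; last 2 first.
  - by move=> u v _ _; exact: mulI.
  - by move=> u v _ _; exact: mulI.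
  rewrite sq_uniq /= andbT; apply/andP; split.
    rewrite has_cat negb_or; apply/andP; split; apply/hasPn => _ /mapP[b /squaresP[a a0 ->] ->];
      apply/negP => /squaresP[c c0 e]; [apply: nx|apply: ny]; exact: div e.
  apply/hasPn => _ /mapP[b /squaresP[a a0 ->] ->].
  apply/negP => /mapP[b' /squaresP[c c0 ->] e]; apply: nxy.
  apply: (div _ a (x * c)) => //.
  by rewrite -mulrA e exprMn mulrA expr2.
have : (size l <= size nonzero_elements)%N.
  apply: uniq_leq_size => // z; rewrite unitsP !mem_cat => /or3P[/squaresP[a a0 ->]| |].
  - by rewrite expr2 mul_neq0.
  - by move=> /mapP[_ /squaresP[a a0 ->] ->]; rewrite expr2 !mul_neq0.
  - by move=> /mapP[_ /squaresP[a a0 ->] ->]; rewrite expr2 !mul_neq0.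
rewrite !size_cat !size_map => le; have := leq_trans le size_nonzero_squares.
rewrite mul2n -addnn -[X in (_ <= X)%N]add0n leq_add2r leqNgt.
have : 1 \in nonzero_squares.
  by rewrite mem_undup; apply/mapP; exists 1; rewrite ?expr1n // unitsP oner_eq0.
by case: nonzero_squares.
Qed.

End FiniteSquares.

Section FiniteFieldSquares.
Variable F : finFieldType.
Hypothesis two_neq0 : (2%:R : F) != 0.

Let invF (x : F) : x != 0 -> exists y, x * y = 1.
Proof. by move=> x0; exists x^-1; rewrite divff. Qed.

Let inE_enum (x : F) : x \in enum F. Proof. by rewrite mem_enum. Qed.

Lemma finfield_nonsquare_ratio (c1 c2 : F) : c1 != 0 -> c2 != 0 ->
  ~ (exists d, c1 = d ^+ 2) -> ~ (exists d, c2 = d ^+ 2) -> exists d, c1 / c2 = d ^+ 2.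
Proof.
move=> c10 c20 n1 n2.
have [d dE] := nonsquareM inE_enum invF c10 c20 n1 n2.
exists (d / c2); rewrite expr_div_n -dE; field; exact: c20.
Qed.

(** With 0 included, more than half of the elements are squares, so the squares and the elements
    [c + c0 b ^ 2] cannot be disjoint. *)
Lemma finfield_norm_surj (c0 c : F) : ~ (exists d, c0 = d ^+ 2) ->
  exists a b : F, c = a ^+ 2 - c0 * b ^+ 2.
Proof.
move=> n0; have c00 : c0 != 0.
  by apply/eqP => e; apply: n0; exists 0; rewrite expr0n.
pose A := 0 :: nonzero_squares (enum F).
have AP x : x \in A -> exists a, x = a ^+ 2.
  rewrite in_cons => /orP[/eqP ->|]; first by exists 0; rewrite expr0n.
  by rewrite mem_undup => /mapP[a _ ->]; exists a.
have uA : uniq A.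
  rewrite /= undup_uniq andbT mem_undup; apply/negP => /mapP[a].
  rewrite mem_undup mem_filter => /andP[a0 _] /eqP.
  by rewrite eq_sym expf_eq0 /= (negPf a0).
have size_units : size (nonzero_elements (enum F)) = #|F|.-1.
  rewrite /nonzero_elements undup_id; last by apply: filter_uniq; exact: enum_uniq.
  have := count_predC (pred1 (0 : F)) (enum F).
  rewrite count_uniq_mem ?enum_uniq // mem_enum -cardE => <-.
  by rewrite add1n size_filter.
pose B := [seq c + c0 * a | a <- A].
have [/hasP[x xB xA]|nAB] := boolP (has (mem A) B).
  have [a aE] := AP _ xA; move/mapP: xB => [y /AP[b ->] xE].
  by exists a, b; rewrite -aE xE addrK.
have : uniq (A ++ B).
  rewrite cat_uniq uA nAB map_inj_uniq // => u v /addrI; exact: mulfI.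
move=> /card_uniqP; have := max_card (mem (A ++ B)).
move=> le e; rewrite e size_cat size_map in le.
have := size_nonzero_squares inE_enum invF; rewrite size_units.
have {le} : ((size (nonzero_squares (enum F))).+1 + (size (nonzero_squares (enum F))).+1
  <= #|F|)%N by exact: le.
have := finNzRing_gt1 F; set N := size _; set q := #|F|; lia.
Qed.

(** If every element were a square, a choice of roots would be a bijection whose inverse is
    squaring, which identifies 1 and -1. *)
Lemma finfield_ex_nonsquare : exists z : F, z != 0 /\ ~ (exists y : F, y ^+ 2 = z).
Proof.
apply: contrapT => hn.
have /boolp.choice[g gP] : forall z : F, exists y, y ^+ 2 = z.
  move=> z; have [->|z0] := eqVneq z 0; first by exists 0; rewrite expr0n.
  by apply: contrapT => h; apply: hn; exists z.
have ginj : injective g by move=> u v e; rewrite -(gP u) e gP.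
have [h gh hg] := injF_bij ginj.
have : h 1 = h (-1) by rewrite -(gP (h 1)) -(gP (h (-1))) !hg sqrrN.
move=> /(congr1 g); rewrite !hg => /eqP; rewrite -subr_eq0 opprK.
by move: two_neq0; rewrite mulr2n => /negPf ->.
Qed.

End FiniteFieldSquares.

(** * Hensel's lemma and the quadratic symbol *)

Section Symbol.
Variables (F : finFieldType) (K : fieldType) (k : {rmorphism F -> K}).
Variable deg : place K -> nat.
Hypothesis ff : function_field k deg.
Hypothesis two_neq0 : (2%:R : F) != 0.
Variable P : place K.
Implicit Types (x y a : K).

Definition local_square x := exists y : completion P, y ^+ 2 = to_completion P x.

Lemma to_completionM x y : to_completion P (x * y) = to_completion P x * to_completion P y.
Proof.
rewrite /to_completion -[RHS]rmorphM; congr (\pi_ _ _).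
by apply: val_inj.
Qed.

Lemma local_squareX x : local_square (x ^+ 2).
Proof. by exists (to_completion P x); rewrite !expr2 to_completionM. Qed.

Lemma local_squareM x y : local_square x -> local_square y -> local_square (x * y).
Proof.
by move=> [u uE] [v vE]; exists (u * v); rewrite exprMn uE vE to_completionM.
Qed.

Lemma local_square_approx x : local_square x ->
  forall N : int, exists a, ord_ge P N (a ^+ 2 - x).
Proof.
move=> [y]; elim/quotW: y => u.
rewrite /to_completion => e N.
have : u ^+ 2 - Sub (fun=> x) (cst_in_cauchy P x) \in in_null (P := P).
  rewrite Quotient.idealrBE; apply/eqP; rewrite -e; exact: rmorphXn.
move=> /asboolP /(_ N)[n0 /(_ n0 (leqnn _)) h].
by exists (val u n0); move: h.
Qed.

Lemma hensel x a : x != 0 -> P x = 0 -> ord_ge P 1 (a ^+ 2 - x) -> local_square x.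
Proof.
move=> x0 Px ha.
have t0 : (2%:R : K) != 0 by rewrite -(rmorph_nat k) fmorph_eq0.
have P2 : P 2%:R = 0 by rewrite -(rmorph_nat k) (place_const k).
(* Newton iteration for [y ^ 2 - x]: the new error is the square of the correction, and the
   correction has the order of the old error because [2 y] is a unit. *)
pose next y := y - (y ^+ 2 - x) / (2%:R * y).
pose s n := iter n next a.
have unit y : ord_ge P 1 (y ^+ 2 - x) -> y != 0 /\ P y = 0.
  move=> hy; have [y20 Py2] : y ^+ 2 != 0 /\ P (y ^+ 2) = 0.
    rewrite -[y ^+ 2](subrK x) addrC -[RHS]Px; apply: placeDl => //.
    by rewrite Px add0r.
  have y0 : y != 0 by apply: contraNneq y20 => ->; rewrite expr0n.
  by split=> //; move: Py2; rewrite placeX; lia.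
have err n : ord_ge P n.+1%:Z (s n ^+ 2 - x).
  elim: n => [//|n IH]; have [y0 Py] : s n != 0 /\ P (s n) = 0.
    by apply: unit; apply: ord_geW IH.
  rewrite /s iterS -/(s n) /next.
  have -> : (s n - (s n ^+ 2 - x) / (2%:R * s n)) ^+ 2 - x =
      ((s n ^+ 2 - x) * (2%:R * s n)^-1) ^+ 2.
    by field; rewrite y0 t0.
  have h : ord_ge P n.+1%:Z ((s n ^+ 2 - x) * (2%:R * s n)^-1).
    rewrite -[n.+1%:Z]addr0; apply: ord_geM => //.
    by rewrite ord_geE ?invr_eq0 ?mulf_neq0 // placeV placeM // P2 Py.
  by rewrite expr2; apply: ord_geW (ord_geM h h); lia.
have step n : ord_ge P n.+1%:Z (s n.+1 - s n).
  have [y0 Py] : s n != 0 /\ P (s n) = 0.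
    by apply: unit; apply: ord_geW (err n).
  rewrite /s iterS -/(s n) /next addrAC subrr add0r ord_geN.
  rewrite -[n.+1%:Z]addr0; apply: ord_geM; first exact: err.
  by rewrite ord_geE ?invr_eq0 ?mulf_neq0 // placeV placeM // P2 Py.
have far n j : ord_ge P n.+1%:Z (s (n + j)%N - s n).
  elim: j => [|j IH]; first by rewrite addn0 subrr ord_ge0.
  rewrite addnS -[s (n + j).+1](subrK (s (n + j)%N)) -addrA; apply: ord_geD => //.
  by apply: ord_geW (step _); rewrite lez_nat ltnS leq_addr.
have sC : s \in in_cauchy P.
  apply/asboolP => N; exists `|N|%N => i j Ni Nj.
  have near l : (`|N| <= l)%N -> ord_ge P N (s l - s `|N|%N).
    by move=> le; rewrite -(subnKC le); apply: ord_geW (far _ _); lia.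
  have -> : s i - s j = (s i - s `|N|%N) - (s j - s `|N|%N).
    by rewrite opprB addrA subrK.
  by apply: ord_geB; exact: near.
exists (\pi_({ideal_quot (in_null (P := P))}) (Sub s sC : cauchyring P)).
rewrite /to_completion -[LHS]rmorphXn; apply/eqP.
rewrite -Quotient.idealrBE; apply/asboolP => N; exists `|N|%N => i Ni.
by apply: ord_geW (err i); lia.
Qed.

Lemma even_scale x : x != 0 -> (2 %| P x)%Z ->
  exists2 c, c != 0 & P (x * c ^+ 2) = 0.
Proof.
move=> x0 /dvdzP[q qE]; have [p p0 Pp] := place_uniformizer P.
exists (p ^ (- q)); first by rewrite expfz_neq0.
rewrite placeM ?expf_neq0 ?expfz_neq0 // placeX placeXz Pp qE mul1r.
by rewrite mulr2n; lia.
Qed.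

Lemma local_square_scale x c : c != 0 -> local_square (x * c ^+ 2) -> local_square x.
Proof.
move=> c0 h; have := local_squareM h (local_squareX c^-1).
by rewrite -mulrA -exprMn divff // expr1n mulr1.
Qed.

Lemma in_valringE x : (x \in in_valring P) = ord_ge P 0 x.
Proof. by []. Qed.

Let red (x : valring P) : residue P := \pi_({ideal_quot (in_maxideal (P := P))}) x.

Let red_eq (x y : valring P) : red x = red y <-> ord_ge P 1 (val x - val y).
Proof.
rewrite /red; split=> [/eqP|h]; first by rewrite -Quotient.idealrBE.
by apply/eqP; rewrite -Quotient.idealrBE.
Qed.

Let redM (x y : valring P) : red (x * y) = red x * red y.
Proof. exact: rmorphM. Qed.

Let red_surj (u : residue P) : exists v : valring P, u = red v.
Proof. by exists (generic_quotient.repr u); rewrite /red reprK. Qed.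

(** [hensel] lifts squares of the residue ring to local squares, so [x] and [y] have nonsquare
    residues and [nonsquareM] applies to these. *)
Lemma nonsquare_unitM x y : x != 0 -> y != 0 -> P x = 0 -> P y = 0 ->
  ~ local_square x -> ~ local_square y -> local_square (x * y).
Proof.
move=> x0 y0 Px Py nx ny.
have [_ _ /(_ P)[s [_ sP]]] := ff.
pose S : seq (residue P) := [seq oapp red 0 (insub z) | z <- s].
have SP (u : residue P) : u \in S.
  have [v ->] := red_surj u; have [z zs hz] := sP (val v) (valP v).
  apply/mapP; exists z => //.
  have zO : z \in in_valring P.
    have -> : z = val v - (val v - z) by rewrite opprB addrC subrK.
    rewrite in_valringE; apply: ord_geB; first exact: valP.
    by apply: ord_geW hz.
  by rewrite insubT /=; apply/red_eq; rewrite SubK.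
have inv (u : residue P) : u != 0 -> exists v, u * v = 1.
  have [v ->] := red_surj u; move=> v0.
  have nv : ~ ord_ge P 1 (val v).
    move=> h; move/eqP: v0; apply; rewrite /red -[RHS](rmorph0 (\pi_({ideal_quot (in_maxideal (P := P))}))).
    by apply/red_eq; rewrite rmorph0 subr0.
  have v1 : val v != 0 by apply/eqP => e; apply: nv; rewrite e ord_ge0.
  have vO : 0 <= P (val v) by rewrite -ord_geE //; exact: valP.
  have Pv : P (val v) = 0 by move/negP: nv; rewrite ord_geE //; lia.
  have wO : (val v)^-1 \in in_valring P.
    by rewrite in_valringE ord_geE ?invr_eq0 // placeV Pv.
  exists (red (Sub (val v)^-1 wO)); rewrite -redM.
  rewrite -[RHS](rmorph1 (\pi_({ideal_quot (in_maxideal (P := P))}))).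
  apply/red_eq; rewrite rmorphM rmorph1 /= divff // subrr; exact: ord_ge0.
have unitO z : z != 0 -> P z = 0 -> z \in in_valring P.
  by move=> z0 Pz; rewrite in_valringE ord_geE // Pz.
have lift z (z0 : z != 0) (Pz : P z = 0) :
    (exists d, red (Sub z (unitO z z0 Pz)) = d ^+ 2) -> local_square z.
  move=> [d dE]; have [a aE] := red_surj d.
  move: dE; rewrite aE expr2 -redM => /esym/red_eq; rewrite rmorphM /= -expr2.
  exact: hensel.
have ne0 z (z0 : z != 0) (Pz : P z = 0) : red (Sub z (unitO z z0 Pz)) != 0.
  apply/eqP; rewrite -(rmorph0 (\pi_({ideal_quot (in_maxideal (P := P))}))) => /red_eq.
  by rewrite rmorph0 subr0 /= ord_geE // Pz.
have [d dE] := nonsquareM SP inv (ne0 x x0 Px) (ne0 y y0 Py)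
  (fun h => nx (lift x x0 Px h)) (fun h => ny (lift y y0 Py h)).
have xy0 : x * y != 0 by rewrite mulf_neq0.
have Pxy : P (x * y) = 0 by rewrite placeM // Px Py.
apply: (lift _ xy0 Pxy); exists d; rewrite -dE -redM; congr red.
by apply: val_inj; rewrite rmorphM.
Qed.

Lemma nonsquare_evenM x y : x != 0 -> y != 0 -> (2 %| P x)%Z -> (2 %| P y)%Z ->
  ~ local_square x -> ~ local_square y -> local_square (x * y).
Proof.
move=> x0 y0 ex ey nx ny.
have [c c0 Pc] := even_scale x0 ex; have [d d0 Pd] := even_scale y0 ey.
have h := @nonsquare_unitM (x * c ^+ 2) (y * d ^+ 2).
apply: (@local_square_scale _ (c * d)); first by rewrite mulf_neq0.
rewrite exprMn mulrACA; apply: h => //; rewrite ?mulf_neq0 ?expf_neq0 //.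
  by move=> /(local_square_scale c0).
by move=> /(local_square_scale d0).
Qed.

Lemma symbol_even x : (2 %| P x)%Z ->
  symbol P x = (if `[< local_square x >] then 1 else -1).
Proof. by move=> ex; rewrite /symbol ex. Qed.

Lemma symbolM x y : x != 0 -> y != 0 -> (2 %| P x)%Z -> (2 %| P y)%Z ->
  symbol P (x * y) = symbol P x * symbol P y.
Proof.
move=> x0 y0 ex ey; have exy : (2 %| P (x * y)%R)%Z by rewrite placeM // rpredD.
rewrite !symbol_even //.
have quot u v : u != 0 -> local_square (u * v) -> local_square u -> local_square v.
  move=> u0 huv hu; have := local_squareM huv hu.
  by rewrite mulrAC -expr2 mulrC; exact: local_square_scale.
case: asboolP => hxy; case: asboolP => hx; case: asboolP => hy //; exfalso.
- exact: hy (quot _ _ x0 hxy hx).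
- by apply: hx; apply: (quot _ _ y0 _ hy); rewrite mulrC.
- exact: hxy (local_squareM hx hy).
- exact: hxy (nonsquare_evenM x0 y0 ex ey hx hy).
Qed.

Lemma symbolX2 x : symbol P (x ^+ 2) = 1.
Proof. by rewrite /symbol; case: asboolP => // -[]; exact: local_squareX. Qed.

Lemma symbol1 : symbol P 1 = 1.
Proof. by rewrite -(expr1n _ 2) symbolX2. Qed.

End Symbol.

(** * Abelian groups modulo 2 *)

Section Mod2Theory.
Variable V : zmodType.
Implicit Types x y : V.

Lemma class2B x y : class2 (x - y) = class2 x - class2 y.
Proof. exact: (raddfB (\pi_(@Quotient.quot V (@doubles V)))). Qed.

Lemma class20 : class2 (0 : V) = 0.
Proof. by rewrite -(subrr (0 : V)) class2B subrr. Qed.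

Lemma class2D x y : class2 (x + y) = class2 x + class2 y.
Proof. exact: (raddfD (\pi_(@Quotient.quot V (@doubles V)))). Qed.

Lemma class2Mn x i : class2 (x *+ i) = class2 x *+ i.
Proof.
elim: i => [|i IH]; first by rewrite !mulr0n class20.
by rewrite !mulrS class2D IH.
Qed.

Lemma class2_sum (I : Type) (s : seq I) (p : pred I) (f : I -> V) :
  class2 (\sum_(i <- s | p i) f i) = \sum_(i <- s | p i) class2 (f i).
Proof. exact: (big_morph _ class2D class20). Qed.

Lemma class2_surj (u : mod2 V) : exists x, u = class2 x.
Proof. by exists (generic_quotient.repr u); rewrite /class2 reprK. Qed.

Lemma class2_eq x y : class2 x = class2 y <-> exists z, x = y + z *+ 2.
Proof.
rewrite /class2; split=> [/eqP|[z ->]].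
  rewrite -Quotient.idealrBE => /asboolP[z zE]; exists z.
  by rewrite -zE addrC subrK.
apply/eqP; rewrite -Quotient.idealrBE addrAC subrr add0r; apply/asboolP.
by exists z.
Qed.

Lemma class2_eq0 x : class2 x = 0 <-> exists z, x = z *+ 2.
Proof.
rewrite -class20 class2_eq; split=> -[z zE]; exists z; first by rewrite zE add0r.
by rewrite add0r.
Qed.

Lemma class2Z (c : 'F_2) x : c *: class2 x = class2 (x *+ c).
Proof. by rewrite class2Mn. Qed.

Lemma class2Mz x (z : int) : class2 (x *~ z) = (z%:~R : 'F_2) *: class2 x.
Proof.
have e (i : nat) : class2 (x *+ i) = (i%:R : 'F_2) *: class2 x.
  by rewrite scaler_nat class2Mn.
case: z => i; first by rewrite -pmulrn e.
rewrite NegzE !mulrNz -!pmulrn scaleNr -e -[- (x *+ _)]sub0r class2B class20.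
by rewrite sub0r.
Qed.

Lemma F2_double (c : 'F_2) : (2 %| c)%N -> c = 0.
Proof. by case: c => [[|[|c]]] //= i _; apply: val_inj. Qed.

End Mod2Theory.

Lemma has_order_dvd (V : zmodType) (x : V) (d : nat) (z : int) : has_order x d ->
  x *~ z = 0 -> (d %| z)%Z.
Proof.
move=> [d0 xd dmin] xz; apply/dvdz_mod0P.
have r0 : (0 <= z %% d)%Z by rewrite modz_ge0 //; lia.
have rd : ((z %% d)%Z < d) by rewrite ltz_pmod //; lia.
have e : x *~ (z %% d)%Z = 0.
  move: xz; rewrite {1}(divz_eq z d) mulrzDr [(z %/ d)%Z * _]mulrC mulrzA.
  by rewrite -pmulrn xd mul0rz add0r.
have [//|nz] := eqVneq (z %% d)%Z 0; exfalso.
move: r0 rd nz e; case: (z %% d)%Z => [i|//] _ id i0; rewrite -pmulrn.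
by apply: dmin; apply/andP; split; [lia|move: id; rewrite ltz_nat].
Qed.

Lemma is_basis_leq (R : finFieldType) (V : lmodType R) (A : set V) (m n : nat)
  (v : 'I_m -> V) (u : 'I_n -> V) :
  (forall c : 'I_m -> R, A (\sum_i c i *: v i)) ->
  is_basis A v -> is_basis A u -> (m <= n)%N.
Proof.
move=> Asum [_ vfree _] [_ _ uspan].
have /boolp.choice[f fP] : forall c : {ffun 'I_m -> R}, exists e : {ffun 'I_n -> R},
    \sum_i c i *: v i = \sum_i e i *: u i.
  move=> c; have [e eE] := uspan _ (Asum c); exists [ffun i => e i].
  by rewrite eE; apply: eq_bigr => i _; rewrite ffunE.
have f_inj : injective f.
  move=> c c' e; apply/ffunP => i; apply/eqP; rewrite -subr_eq0; apply/eqP.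
  apply: (vfree (fun i => c i - c' i)).
  under eq_bigr do rewrite scalerBl.
  by rewrite sumrB !fP e subrr.
have := leq_card f f_inj; rewrite !card_ffun !card_ord leq_exp2l //.
exact: finNzRing_gt1.
Qed.

Section FilteredBasis.
Variables (R : finFieldType) (V : lmodType R) (A : set V) (m : nat).
Variables (z : V) (v : 'I_m -> V) (p : pred 'I_m).
Hypothesis Az : A z.
Hypothesis Av : forall i, p i -> A (v i).
Hypothesis indep : forall (c0 : R) (c : 'I_m -> R),
  c0 *: z + \sum_(i | p i) c i *: v i = 0 -> c0 = 0 /\ forall i, p i -> c i = 0.
Hypothesis span : forall x, A x -> exists (c0 : R) (c : 'I_m -> R),
  x = c0 *: z + \sum_(i | p i) c i *: v i.

(** The shape of the list [A] of the procedure, shared by its counterpart in [Pic / 2 Pic]. Bases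
    are found indexed by a predicate on the generators and renumbered here. *)
Definition filtered_family : seq V := z :: [seq v i | i <- enum 'I_m & p i].

Let s := [seq i <- enum 'I_m | p i].

Lemma filtered_basis : is_basis A (fun j : 'I_(size s).+1 => nth 0 filtered_family j).
Proof.
have us : uniq s by rewrite filter_uniq // enum_uniq.
have sP i : (i \in s) = p i by rewrite mem_filter mem_enum andbT.
pose t j : 'I_m := tnth (in_tuple s) j.
have nthE (j : 'I_(size s)) : nth 0 filtered_family (fintype.lift ord0 j) = v (t j).
  by rewrite /= add0n (nth_map (t j)) ?ltn_ord // [in RHS]/t (tnth_nth (t j)).
pose e (i : 'I_m) : 'I_(size s).+1 := inord (index i s).+1.
have et j : e (t j) = fintype.lift ord0 j.
  apply: val_inj; rewrite /= inordK; last by rewrite ltnS index_mem mem_tnth.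
  by rewrite /t (tnth_nth (t j)) /= index_uniq.
have sumE (c : 'I_(size s).+1 -> R) :
    \sum_j c j *: nth 0 filtered_family j = c ord0 *: z + \sum_(i | p i) c (e i) *: v i.
  rewrite big_ord_recl; congr (_ + _).
  transitivity (\sum_(i <- s) c (e i) *: v i); last first.
    by rewrite big_filter big_enum_cond; apply: eq_bigl => i.
  by rewrite [RHS]big_tnth; apply: eq_bigr => j _; rewrite nthE -/(t j) et.
split.
- move=> j; have [j' ->|->] := unliftP ord0 j; last exact: Az.
  by rewrite nthE; apply: Av; rewrite -sP mem_tnth.
- move=> c; rewrite sumE => /indep[c0 h] j.
  have [j' ->|-> //] := unliftP ord0 j.
  by rewrite -et; apply: h; rewrite -sP mem_tnth.
- move=> x /span[c0 [c xE]].
  exists (fun j => if unlift ord0 j is Some j' then c (t j') else c0).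
  rewrite sumE unlift_none xE; congr (_ + _); apply: eq_bigr => i pi.
  have is_ : (index i s < size s)%N by rewrite index_mem sP.
  have -> : e i = fintype.lift ord0 (Ordinal is_).
    by apply: val_inj; rewrite /= inordK.
  by rewrite liftK; congr (c _ *: _); rewrite /t (tnth_nth i) /= nth_index // sP.
Qed.

End FilteredBasis.

(** * 2-torsion and classes modulo 2 from a Smith presentation *)

Section SmithPresentation.
Variables (V : zmodType) (A : set V) (m : nat) (x : 'I_m -> V) (d : 'I_m -> nat).
Hypothesis sm : smith_presentation A x d.

Lemma smith_expand y : A y -> exists c : 'I_m -> int, y = \sum_i x i *~ c i.
Proof.
have [_ [hspan _] _] := sm => /hspan[e eC ->].
have /boolp.choice[c cP] : forall i, exists c : int, e i = x i *~ c.
  by move=> i; have [c _ <-] := eC i; exists c.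
by exists c; apply: eq_bigr => i _.
Qed.

Lemma smith_free (c : 'I_m -> int) : \sum_i x i *~ c i = 0 -> forall i, (d i %| c i)%Z.
Proof.
have [xo [_ hfree] _] := sm => e i; apply: (has_order_dvd (xo i)).
by apply: (hfree (fun i => x i *~ c i)) => // j; exists (c j).
Qed.

(** A coordinate [z i] of a 2-torsion element is a multiple of [d i] when [d i] is odd and of
    [d i / 2] when it is even, where only the parity of the quotient matters. The sign matches the
    divisors [- d i D i] of the [alpha i]. *)
Lemma smith_torsion2 y : A y -> y *+ 2 = 0 -> exists c : 'I_m -> 'F_2,
  y = - \sum_(i | ~~ odd (d i)) x i *+ (c i * (d i)./2).
Proof.
move=> Ay y2; have [z zE] := smith_expand Ay.
have zd i : (d i %| z i * 2)%Z.
  apply: (@smith_free (fun i => z i * 2)).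
  under eq_bigr do rewrite mulrzA.
  by rewrite -mulrz_suml -zE -[y *~ 2]pmulrn.
have [xo _ _] := sm.
have xz i (t : int) : (d i %| t)%Z -> x i *~ t = 0.
  move=> /dvdzP[q ->]; have [_ xd _] := xo i.
  by rewrite mulrC mulrzA -pmulrn xd mul0rz.
exists (fun i => ((z i %/ (d i)./2)%Z)%:~R).
rewrite zE -sumrN [RHS]big_mkcond; apply: eq_bigr => i _; case: ifP => [ev|/negbFE odd_d].
  have dE : d i = ((d i)./2 * 2)%N by rewrite muln2 even_halfK.
  have d0 : ((d i)./2 : int) != 0 by have [h _ _] := xo i; lia.
  have /dvdzP[q qE] : ((d i)./2 %| z i)%Z.
    by have := zd i; rewrite {1}dE PoszM (dvdz_mul2r (p := 2)).
  rewrite qE mulzK //; set c : 'F_2 := _%:~R.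
  apply/eqP; rewrite -addr_eq0 pmulrn -mulrzDr; apply/eqP/xz.
  have cE : (2 %| q + (c : nat)%:Z)%Z.
    rewrite (dvdz_pcharf (pchar_Fp (isT : prime 2))) intrD.
    by rewrite -[X in _ + X]/((c : nat)%:R) natr_Zp -mulr2n -mulr_natr pchar_Fp_0 // mulr0.
  rewrite PoszM -mulrDl [X in (X %| _)%Z](congr1 Posz dE) PoszM mulrC.
  by rewrite dvdz_mul2l.
apply: xz; have := zd i; rewrite Gauss_dvdzl //.
by rewrite coprimezE coprimen2.
Qed.

Lemma smith_half_indep (c : 'I_m -> 'F_2) :
  \sum_(i | ~~ odd (d i)) x i *+ (c i * (d i)./2) = 0 ->
  forall i, ~~ odd (d i) -> c i = 0.
Proof.
have [xo _ _] := sm.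
move=> e i ev; apply: F2_double.
have := @smith_free (fun i => if ~~ odd (d i) then (c i * (d i)./2)%N%:Z else 0) _ i.
rewrite ev => h.
have : (d i %| (c i * (d i)./2)%N%:Z)%Z.
  apply: h; rewrite -[RHS]e [RHS]big_mkcond; apply: eq_bigr => j _.
  by case: ifP => _; rewrite ?mulr0z // -pmulrn.
have [d0 _ _] := xo i.
rewrite dvdzE /= -{1}(even_halfK ev) -muln2 mulnC dvdn_pmul2r //.
by move: ev d0; case: (d i) => [|[|]].
Qed.

Lemma smith_mem i : A (x i).
Proof.
have [_ [hspan _] _] := sm; apply/hspan; exists (fun j => if j == i then x i else 0).
  move=> j; case: eqP => [->|_]; first by exists 1.
  by exists 0; rewrite // mulr0z.
by rewrite -big_mkcond big_pred1_eq.
Qed.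

End SmithPresentation.

Section SmithMod2.
Variables (V : zmodType) (dg : V -> int) (A : set V).
Hypothesis dgB : forall x y, dg (x - y) = dg x - dg y.
Hypothesis dgA : forall x, A x <-> dg x = 0.
Variables (m : nat) (x : 'I_m -> V) (d : 'I_m -> nat).
Hypothesis sm : smith_presentation A x d.
Variables (dl : V) (g : nat).
Hypothesis g_gt0 : (0 < g)%N.
Hypothesis dl_g : dg dl = g.
Hypothesis g_dvd : forall y, (g %| dg y)%Z.

Let dg0 : dg 0 = 0. Proof. by have := dgB 0 0; rewrite !subrr. Qed.
Let dgN y : dg (- y) = - dg y. Proof. by rewrite -[- y]sub0r dgB dg0 sub0r. Qed.
Let dgD y z : dg (y + z) = dg y + dg z.
Proof. by rewrite -[z in LHS]opprK dgB dgN opprK. Qed.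
Let dgMn y i : dg (y *+ i) = dg y *+ i.
Proof. by elim: i => [|i IH]; rewrite ?mulr0n ?dg0 // !mulrS dgD IH. Qed.
Let dgMz y (i : int) : dg (y *~ i) = dg y * i.
Proof. by rewrite -mulrzz; case: i => i; rewrite ?NegzE ?mulrNz -!pmulrn ?dgN dgMn. Qed.

Let A_sum (p : pred 'I_m) (c : 'I_m -> nat) : dg (\sum_(i | p i) x i *+ c i) = 0.
Proof.
elim/big_rec: _ => [|i y _ IH]; first exact: dg0.
by rewrite dgD IH dgMn ((dgA _).1 (smith_mem sm i)) mul0rn.
Qed.

(** Comparing degrees with those of a double gives [c0 = 0]; the remaining relation is in degree 0,
    where [smith_free] applies. *)
Lemma pic_mod2_indep (c0 : 'F_2) (c : 'I_m -> 'F_2) :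
  c0 *: class2 dl + \sum_(i | ~~ odd (d i)) c i *: class2 (x i) = 0 ->
  c0 = 0 /\ forall i, ~~ odd (d i) -> c i = 0.
Proof.
under eq_bigr do rewrite class2Z.
rewrite class2Z -class2_sum -class2D => /class2_eq0[y yE].
have c00 : c0 = 0.
  apply: F2_double; move/(congr1 dg): yE.
  rewrite dgD A_sum addr0 !dgMn dl_g; have /dvdzP[q ->] := g_dvd y.
  move=> e; have {}e : (c0 : nat)%:Z = q * 2.
    apply: (mulIf (_ : g%:Z != 0)); first by lia.
    by rewrite mulrC -[RHS]mulrAC -[in LHS]mulrzz -[RHS]mulrzz -!pmulrn.
  by move: e; lia.
split=> // i ei; move: yE; rewrite c00 mulr0n add0r => yE.
have Ay : A y.
  apply/dgA; move/(congr1 dg): yE; rewrite A_sum dgMn; lia.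
have [z zE] := smith_expand sm Ay.
have := @smith_free _ _ _ _ _ sm (fun i => (if ~~ odd (d i) then (c i : nat)%:Z else 0) - z i * 2) _ i.
rewrite ei => h; apply: F2_double.
have : (2 %| (c i : nat)%:Z - z i * 2)%Z.
  apply: dvdz_trans (h _); first by rewrite dvdzE /= dvdn2.
  transitivity (\sum_i (x i *~ (if ~~ odd (d i) then (c i : nat)%:Z else 0) -
      x i *~ z i *~ 2)).
    by apply: eq_bigr => j _; rewrite mulrzBr mulrzA.
  rewrite sumrB -mulrz_suml -zE -[y *~ 2]pmulrn -yE [X in _ - X]big_mkcond -sumrB big1 // => j _.
  by case: ifP => _; rewrite ?mulr0z -?pmulrn subrr.
lia.
Qed.

(** Subtracting a multiple of [dl] reaches degree 0; generators of odd order are doubles and drop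
    out. *)
Lemma pic_mod2_span (u : mod2 V) : exists (c0 : 'F_2) (c : 'I_m -> 'F_2),
  u = c0 *: class2 dl + \sum_(i | ~~ odd (d i)) c i *: class2 (x i).
Proof.
have [y ->] := class2_surj u; have /dvdzP[q qE] := g_dvd y.
have Ay : A (y - dl *~ q).
  by apply/dgA; rewrite dgB dgMz dl_g qE mulrC subrr.
have [z zE] := smith_expand sm Ay.
exists q%:~R, (fun i => (z i)%:~R).
have -> : y = dl *~ q + \sum_i x i *~ z i by rewrite -zE addrC subrK.
rewrite class2D class2Mz class2_sum; congr (_ + _).
rewrite [RHS]big_mkcond; apply: eq_bigr => i _; case: ifP => [_|/negbFE odd_d].
  exact: class2Mz.
have [xo _ _] := sm; have [_ xd _] := xo i.
suff xi0 : class2 (x i) = 0 by rewrite class2Mz xi0 scaler0.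
apply/class2_eq0; exists (x i *- (d i)./2).
move: xd; rewrite -{1}(odd_double_half (d i)) odd_d mulrnDr mulr1n -muln2 mulrnA.
by move=> /eqP; rewrite addr_eq0 => /eqP xE; rewrite {1}xE mulNrn.
Qed.

End SmithMod2.

(** * Adjoining a square root; squares in a global function field *)

Lemma horner_sqrt (K L : fieldType) (f : {rmorphism K -> L}) (la : K) (r : L) (q : {poly K}) :
  r ^+ 2 = f la -> exists a b, (map_poly f q).[r] = f a + f b * r.
Proof.
move=> rr; elim/poly_ind: q => [|q c [a [b e]]].
  by exists 0, 0; rewrite !rmorph0 horner0 mul0r addr0.
exists (c + b * la), a.
rewrite rmorphD rmorphM /= map_polyX map_polyC !hornerE e.
by rewrite rmorphD rmorphM -rr expr2 /=; ring.
Qed.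

(** The conjugation is defined through coordinates, unique because [la] is not a square.
    [baseFieldType] regards [L] as an extension of the base field of [K], so that
    [global_function_field] applies to [L] too. *)
Lemma sqrt_extension (F0 : fieldType) (K : fieldExtType F0) (la : K) :
  (forall a, a ^+ 2 != la) ->
  exists (L : fieldExtType F0) (io : {rmorphism K -> L}) (sg : {rmorphism L -> L}) (r : L),
    [/\ forall c : F0, io c%:A = c%:A, r ^+ 2 = io la,
        forall w, exists a b, w = io a + io b * r,
        forall a, sg (io a) = io a & sg r = - r].
Proof.
move=> la_nsq.
have sz : size ('X^2 - la%:P) = 3 by rewrite size_XnsubC.
have irr : irreducible_poly ('X^2 - la%:P).
  apply: cubic_irreducible; first by rewrite sz.
  by move=> a; rewrite rootE !hornerE subr_eq0.
have [L0 _ [r rroot rgen]] := irredp_FAdjoin irr.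
pose io0 : {rmorphism K -> L0} := in_alg L0.
have rr0 : r ^+ 2 = io0 la.
  move: rroot; rewrite rmorphB /= map_polyXn map_polyC rootE !hornerE subr_eq0.
  by move=> /eqP.
pose L : fieldExtType F0 := baseFieldType L0.
pose io : {rmorphism K -> L} := io0.
have rr : (r : L) ^+ 2 = io la := rr0.
have coord (w : L) : exists a b, w = io a + io b * (r : L).
  have : (w : L0) \in <<1; r>>%VS by rewrite rgen memvf.
  move=> /Fadjoin_polyP[p /polyOver1P[q ->] wE].
  have [a [b e]] := horner_sqrt q rr0; exists a, b.
  by rewrite wE -[RHS]e.
have uniq_coord a b : io a + io b * (r : L) = 0 -> a = 0 /\ b = 0.
  have [->|b0] := eqVneq b 0.
    by rewrite rmorph0 mul0r addr0 => /eqP; rewrite fmorph_eq0 => /eqP.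
  move=> /eqP; rewrite addrC addr_eq0 => /eqP e; exfalso.
  have rE : (r : L) = io (- a / b).
    by rewrite fmorph_div rmorphN -e mulrC mulKf // fmorph_eq0.
  have /eqP[] := la_nsq (- a / b); apply: (fmorph_inj io).
  by rewrite rmorphXn -rE.
have /boolp.choice[f fP] : forall w, exists c : K * K, w = io c.1 + io c.2 * (r : L).
  by move=> w; have [a [b e]] := coord w; exists (a, b).
pose s (w : L) := io (f w).1 - io (f w).2 * (r : L).
have sE a b : s (io a + io b * (r : L)) = io a - io b * (r : L).
  have := fP (io a + io b * (r : L)); rewrite /s; move: (f _) => c e.
  have [] := uniq_coord (a - c.1) (b - c.2).
    by rewrite !rmorphB mulrBl addrACA e -opprD subrr.
  by move=> /eqP; rewrite subr_eq0 => /eqP -> /eqP; rewrite subr_eq0 => /eqP ->.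
have sB : zmod_morphism s.
  move=> w z; have [a [b ->]] := coord w; have [c [d ->]] := coord z.
  rewrite opprD addrACA -mulrBl -!rmorphB !sE !rmorphB; ring.
have sM : monoid_morphism s.
  split; first by have := sE 1 0; rewrite rmorph1 rmorph0 mul0r addr0 subr0.
  move=> w z; have [a [b ->]] := coord w; have [c [d ->]] := coord z.
  have -> : (io a + io b * (r : L)) * (io c + io d * (r : L)) =
            io (a * c + b * d * la) + io (a * d + b * c) * (r : L).
    by rewrite !rmorphD !rmorphM -rr expr2 /=; ring.
  by rewrite !sE !rmorphD !rmorphM -rr expr2 /=; ring.
pose s1 := GRing.isZmodMorphism.Build L L s sB.
pose s2 := GRing.isMonoidMorphism.Build L L s sM.
pose sg : {rmorphism L -> L} := HB.pack s s1 s2.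
exists L, io, sg, r; split=> //.
- by move=> a; have := sE a 0; rewrite rmorph0 mul0r addr0 subr0.
- by have := sE 0 1; rewrite rmorph0 rmorph1 mul1r add0r sub0r.
Qed.

Lemma global_function_field (F : finFieldType) (K : fieldExtType {fraction {poly F}}) :
  function_field (constK K) (@place_deg F K).
Proof.
have [n [w sw]] := rat_basis_tvar K.
split; first by exists (tvar K), n, w.
- exact: place_deg_ge.
- exact: place_deg_le.
Qed.

Section GlobalField.
Variables (F : finFieldType) (K : fieldExtType {fraction {poly F}}).

Let ffK := global_function_field K.

Hypothesis fullF : full_constant_field K.

(** Such an element is a root of unity, hence algebraic over the constants. *)
Lemma full_units x : x != 0 -> (forall P : place K, P x = 0) -> exists c : F, x = constK K c.
Proof.
move=> x0 xP; apply: fullF; have [i i0 xi] := ff_units ffK x0 xP.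
exists ('X^i - 1).
  by rewrite -size_poly_eq0 size_XnsubC.
by rewrite rmorphB /= map_polyXn rmorph1 rootE !hornerE xi subrr.
Qed.

Hypothesis two_neq0 : (2%:R : F) != 0.

Variables (n : nat) (b : 'I_n -> place K).
Hypothesis b_span : forall u : mod2 (Pic K), exists c : 'I_n -> 'F_2,
  u = \sum_i c i *: class2 (divclass << b i >>).

Let b_spanD (D : divisor K) : exists (c : 'I_n -> nat) (E : divisor K) x,
  x != 0 /\ D = \sum_i << b i >> *+ c i + E *+ 2 + pdiv x.
Proof.
have [c cE] := b_span (class2 (divclass D)).
have h : class2 (divclass D) = class2 (divclass (\sum_i << b i >> *+ c i)).
  rewrite cE (big_morph _ (@divclassD K) (divclass0 K)) class2_sum.
  by apply: eq_bigr => i _; rewrite divclassMn class2Z.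
have [z zE] := (class2_eq _ _).1 h; have [E EE] := divclass_surj z.
rewrite EE -divclassMn -divclassD in zE.
have [x x0 xE] := (divclassP ffK _ _).1 zE.
by exists (fun i => c i), E, x.
Qed.

Lemma square_of_local_squares la : la != 0 -> (forall P : place K, (2 %| P la)%Z) ->
  (forall i, local_square (b i) la) -> exists a, la = a ^+ 2.
Proof.
move=> la0 la_even la_loc; have [//|nsq] := pselect (exists a, la = a ^+ 2).
have la_nsq a : a ^+ 2 != la by apply/eqP => e; apply: nsq; exists a.
have [L [io [sg [r [io_c rr coord sg_io sg_r]]]]] := sqrt_extension la_nsq.
have two_neq0K : (2%:R : K) != 0 by rewrite -(rmorph_nat (constK K)) fmorph_eq0.
have io_k c : io (constK K c) = constK L c by exact: io_c.
case: (norms_span_contradiction ffK (global_function_field L) io_k rr coord sg_io sg_r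
  two_neq0K la_even la_nsq full_units (@finfield_nonsquare_ratio F)
  (@finfield_norm_surj F two_neq0) (b := b) _ b_spanD).
by move=> i N; exact: (local_square_approx (la_loc i) N).
Qed.

End GlobalField.

(** * Singular square classes *)

Section SquareClasses.
Variable K : fieldType.
Implicit Types x y : K.

Lemma sqclassE x (x0 : x != 0) : sqclass x = class2 (Sub x x0 : mulgroup K).
Proof. by congr class2; apply: val_inj; rewrite insubdK. Qed.

Lemma sqclassM x y : x != 0 -> y != 0 -> sqclass (x * y) = sqclass x + sqclass y.
Proof.
move=> x0 y0; rewrite !sqclassE ?mulf_neq0 // => xy0.
by rewrite -class2D; congr class2; apply: val_inj.
Qed.

Lemma sqclass_eq0 x : x != 0 -> (sqclass x = 0 <-> exists a, x = a ^+ 2).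
Proof.
move=> x0; rewrite (sqclassE x0); split=> [/class2_eq0[a /(congr1 val)/= ->]|[a aE]].
  by exists (val a); rewrite expr2.
have a0 : a != 0 by apply: contraNneq x0 => a0; rewrite aE a0 expr0n.
apply/class2_eq0; exists (Sub a a0); apply: val_inj.
by rewrite /= aE expr2.
Qed.

Lemma sqclass1 : sqclass (1 : K) = 0.
Proof. by apply/sqclass_eq0; rewrite ?oner_neq0 //; exists 1; rewrite expr1n. Qed.

Lemma sqclassX x i : x != 0 -> sqclass (x ^+ i) = sqclass x *+ i.
Proof.
move=> x0; elim: i => [|i IH]; first by rewrite expr0 mulr0n sqclass1.
by rewrite exprS sqclassM ?expf_neq0 // IH mulrS.
Qed.

Lemma sqclass_prod (I : Type) (s : seq I) (p : pred I) (f : I -> K) :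
  (forall i, p i -> f i != 0) ->
  sqclass (\prod_(i <- s | p i) f i) = \sum_(i <- s | p i) sqclass (f i).
Proof.
move=> f0; elim: s => [|i s IH]; first by rewrite !big_nil sqclass1.
rewrite !big_cons; case: ifP => // pi; rewrite sqclassM ?f0 // ?IH //.
by elim/big_rec: _ {IH} => [|j y pj y0]; rewrite ?oner_neq0 // mulf_neq0 ?f0.
Qed.

End SquareClasses.

Section SingularBasis.
Variables (F : finFieldType) (K : fieldExtType {fraction {poly F}}).
Let ffK := global_function_field K.

Let picdegK : Pic K -> int := picdeg (@place_deg F K).

Lemma Pic0P c : @Pic0 F K c <-> picdegK c = 0.
Proof.
split=> [[D D0 <-]|]; first by rewrite /picdegK (picdegE ffK).
by have [D ->] := divclass_surj c; rewrite /picdegK (picdegE ffK) => D0; exists D.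
Qed.

Lemma effective_deg0 (D : divisor K) : (forall P, 0 <= coeff P D) -> div_deg D = 0 -> D = 0.
Proof.
move=> /effectiveP[[|P T] ->]; first by rewrite /sumdiv big_nil.
have [_ _ hle] := ffK.
rewrite /div_deg -/(fdeg _ _) fdeg_sumdiv big_cons => e.
by have := deg_gt0 hle P; lia.
Qed.

(** The divisor of [x] plus [D] is effective of degree 0. Hence the freedom in choosing the
    [alpha i] is only a unit. *)
Lemma pdiv_RR (D : divisor K) x : div_deg D = 0 -> x != 0 -> RR_space D x -> pdiv x = - D.
Proof.
move=> D0 x0 [[_ xD]|e]; last by rewrite e eqxx in x0.
apply/eqP; rewrite -addr_eq0; apply/eqP/effective_deg0 => [P|].
  by rewrite coeffD (ff_coeff_pdiv ffK) -lerBlDr sub0r.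
transitivity (fdeg (@place_deg F K) (pdiv x) + div_deg D).
  exact: (raddfD (fdeg (@place_deg F K))).
by rewrite (ff_fdeg_pdiv ffK x0) add0r.
Qed.

Variables (m : nat) (D : 'I_m -> divisor K) (d : 'I_m -> nat).
Hypothesis sm : smith_presentation (@Pic0 F K) (fun i => divclass (D i)) d.

Let degD i : div_deg (D i *+ d i) = 0.
Proof.
have /Pic0P := smith_mem sm i; rewrite /picdegK (picdegE ffK) => D0.
transitivity (fdeg (@place_deg F K) (D i) *+ d i); last by rewrite D0 mul0rn.
exact: (raddfMn (fdeg (@place_deg F K))).
Qed.

Lemma ex_RR_generator i : exists x, x != 0 /\ RR_space (D i *+ d i) x.
Proof.
have [xo _ _] := sm; have [_ xd _] := xo i.
have : divclass (D i *+ d i) = divclass 0 by rewrite divclassMn xd divclass0.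
move=> /(divclassP ffK)[x x0 xE]; exists x^-1; split; first by rewrite invr_eq0.
left; split=> [|P]; first by rewrite invr_eq0.
by rewrite xE add0r placeV // (ff_coeff_pdiv ffK).
Qed.

Variables (zeta : F) (alpha : 'I_m -> K).
Hypothesis zeta0 : zeta != 0.
Hypothesis zeta_nsq : ~ exists y : F, y ^+ 2 = zeta.
Hypothesis alphaP : forall i, ~~ odd (d i) -> alpha i != 0 /\ RR_space (D i *+ d i) (alpha i).

Let alpha0 i : ~~ odd (d i) -> alpha i != 0. Proof. by move=> /alphaP[]. Qed.

Let pdiv_alpha i : ~~ odd (d i) -> pdiv (alpha i) = - (D i *+ d i).
Proof. by move=> /alphaP[a0 aR]; exact: pdiv_RR. Qed.

Let constK0 (c : F) : c != 0 -> constK K c != 0.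
Proof. by move=> c0; rewrite fmorph_eq0. Qed.

Let pdiv_const (c : F) : pdiv (constK K c) = 0.
Proof. by apply: div_ext => P; rewrite (ff_coeff_pdiv ffK) coeff0 (place_const (constK K)). Qed.

Lemma singular_const : singular_classes (sqclass (constK K zeta)).
Proof.
exists (constK K zeta) => //; split=> [|P]; first exact: constK0.
by rewrite (place_const (constK K)).
Qed.

Lemma singular_generator i : ~~ odd (d i) -> singular_classes (sqclass (alpha i)).
Proof.
move=> ev; exists (alpha i) => //; split=> [|P]; first exact: alpha0.
rewrite -(ff_coeff_pdiv ffK) pdiv_alpha // coeffN coeffMn -(even_halfK ev) -muln2.
by rewrite mulrnA -[_ *+ 2](mulr_natr _ 2) rpredN dvdz_mull.
Qed.

Let pdiv_alphas (c : 'I_m -> 'F_2) :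
  pdiv (\prod_(i | ~~ odd (d i)) alpha i ^+ c i) =
  - (\sum_(i | ~~ odd (d i)) D i *+ (c i * (d i)./2)) *+ 2.
Proof.
have h : \prod_(i | ~~ odd (d i)) alpha i ^+ c i != 0 /\
  pdiv (\prod_(i | ~~ odd (d i)) alpha i ^+ c i) =
  \sum_(i | ~~ odd (d i)) - (D i *+ (c i * (d i)./2) *+ 2).
  elim/big_rec2: _ => [|i y x ev [x0 xE]].
    by split; rewrite ?oner_neq0 // -(rmorph1 (constK K)) pdiv_const.
  have a0 := expf_neq0 (c i) (alpha0 ev); split; first by rewrite mulf_neq0.
  rewrite (ff_pdivM ffK) // xE (ff_pdivX ffK) pdiv_alpha //.
  by rewrite mulNrn -!mulrnA -mulnA muln2 even_halfK // mulnC.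
by rewrite h.2 sumrN mulNrn sumrMnl.
Qed.

Hypothesis fullF : full_constant_field K.

(** Half the divisor of the product is the divisor of its root [a], a relation in [Pic0] to which
    [smith_half_indep] applies. What remains is [zeta], not a square even in [K] because a root of a
    constant is a unit, hence a constant. *)
Lemma singular_indep (c0 : 'F_2) (c : 'I_m -> 'F_2) :
  c0 *: sqclass (constK K zeta) + \sum_(i | ~~ odd (d i)) c i *: sqclass (alpha i) = 0 ->
  c0 = 0 /\ forall i, ~~ odd (d i) -> c i = 0.
Proof.
pose y := \prod_(i | ~~ odd (d i)) alpha i ^+ c i.
have y0 : y != 0.
  by apply/prodf_neq0 => i ev; rewrite expf_neq0 // alpha0.
have z0 := constK0 zeta0.
have -> : \sum_(i | ~~ odd (d i)) c i *: sqclass (alpha i) = sqclass y.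
  rewrite sqclass_prod => [|i ev]; last by rewrite expf_neq0 // alpha0.
  by apply: eq_bigr => i ev; rewrite sqclassX // alpha0.
rewrite -[c0 *: _]/(_ *+ c0) -sqclassX // -sqclassM ?expf_neq0 //.
move=> /sqclass_eq0; case; first by rewrite mulf_neq0 ?expf_neq0.
move=> a aE.
have a0 : a != 0.
  have : a ^+ 2 != 0 by rewrite -aE mulf_neq0 ?expf_neq0.
  by rewrite expf_eq0.
have c_0 i : ~~ odd (d i) -> c i = 0.
  move: i; apply: (smith_half_indep sm).
  have e : - (\sum_(i | ~~ odd (d i)) D i *+ (c i * (d i)./2)) = pdiv a.
    apply: div_ext => P; have := congr1 (fun x => coeff P (pdiv x)) aE.
    rewrite /= (ff_pdivM ffK) ?expf_neq0 // !(ff_pdivX ffK) pdiv_const mul0rn add0r.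
    by rewrite pdiv_alphas !coeffMn => /eqP; rewrite eqr_pMn2r // => /eqP.
  transitivity (divclass (- pdiv a)).
    rewrite -e opprK (big_morph _ (@divclassD K) (divclass0 K)).
    by apply: eq_bigr => i _; rewrite divclassMn.
  by rewrite -[- _]sub0r divclassB (divclass_pdiv ffK) // divclass0 subr0.
split=> //; have y1 : y = 1.
  by rewrite /y big1 // => i ev; rewrite c_0.
have c0E : c0 = 0 \/ c0 = 1.
  by case: (c0) => [[|[|]]] // h; [left|right]; apply: val_inj.
case: c0E => // c01; exfalso; apply: zeta_nsq.
rewrite y1 mulr1 c01 expr1 in aE.
have [|e eE] := full_units fullF a0.
  move=> P; have := congr1 P aE; rewrite (place_const (constK K)) placeX => /esym/eqP.
  by rewrite mulrn_eq0 => /eqP.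
by exists e; apply: (fmorph_inj (constK K)); rewrite rmorphXn /= -eE -aE.
Qed.

(** Half the divisor of a singular element is a 2-torsion class. [smith_torsion2] matches it with a
    product of the [alpha i], so the element is this product times a square times a constant, and a
    constant is a square or [zeta] times a square. *)
Lemma singular_span (u : sqclasses K) : singular_classes u ->
  exists (c0 : 'F_2) (c : 'I_m -> 'F_2),
    u = c0 *: sqclass (constK K zeta) + \sum_(i | ~~ odd (d i)) c i *: sqclass (alpha i).
Proof.
move=> [la [la0 la_even] <-].
have [E EE] := half_pdiv ffK la_even.
have E2 : divclass E *+ 2 = 0 by rewrite -divclassMn -EE (divclass_pdiv ffK).
have E0 : @Pic0 F K (divclass E).
  apply/Pic0P; rewrite /picdegK (picdegE ffK).
  have := ff_fdeg_pdiv ffK la0; rewrite EE raddfMn /= => /eqP.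
  by rewrite mulrn_eq0 => /eqP.
have [c cE] := smith_torsion2 sm E0 E2.
pose y := \prod_(i | ~~ odd (d i)) alpha i ^+ c i.
have y0 : y != 0.
  by apply/prodf_neq0 => i ev; rewrite expf_neq0 // alpha0.
have : divclass E = divclass (- \sum_(i | ~~ odd (d i)) D i *+ (c i * (d i)./2)).
  rewrite -[- \sum_(i | _) D i *+ _]sub0r divclassB divclass0 sub0r cE; congr (- _).
  rewrite (big_morph _ (@divclassD K) (divclass0 K)).
  by apply: eq_bigr => i _; rewrite divclassMn.
move=> /(divclassP ffK)[x x0 xE].
have x20 := expf_neq0 2 x0; have yx0 := mulf_neq0 y0 x20.
have : pdiv la = pdiv (y * x ^+ 2).
  rewrite (ff_pdivM ffK) // (ff_pdivX ffK) EE xE pdiv_alphas.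
  by rewrite mulrnDl.
move=> /(pdiv_eqP ffK la0 yx0)[v vP vE].
have v0 : v != 0 by apply: contraNneq la0 => v0; rewrite vE v0 mul0r.
have [w wE] := full_units fullF v0 vP.
have w0 : w != 0 by apply: contraNneq v0 => w0; rewrite wE w0 rmorph0.
have z0 := constK0 zeta0.
have [c0 c0E] : exists c0 : 'F_2, sqclass (constK K w) = c0 *: sqclass (constK K zeta).
  have [[e eE]|wn] := pselect (exists e, w = e ^+ 2).
    exists 0; rewrite scale0r; apply/sqclass_eq0; rewrite ?constK0 //.
    by exists (constK K e); rewrite eE rmorphXn.
  have zn : ~ exists e, zeta = e ^+ 2 by move=> [e eE]; apply: zeta_nsq; exists e.
  have [e eE] := finfield_nonsquare_ratio w0 zeta0 wn zn.
  have e0 : e ^+ 2 != 0 by rewrite -eE mulf_neq0 ?invr_eq0.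
  exists 1; rewrite scale1r -[w](divfK zeta0) eE rmorphM sqclassM ?constK0 //.
  rewrite -[RHS]add0r; congr (_ + _); apply/sqclass_eq0; rewrite ?constK0 //.
  by exists (constK K e); rewrite rmorphXn.
exists c0, c.
rewrite vE sqclassM // wE c0E; congr (_ + _).
rewrite sqclassM // [sqclass (x ^+ 2)](_ : _ = 0) ?addr0; last first.
  by apply/sqclass_eq0 => //; exists x.
rewrite sqclass_prod => [|i ev]; last by rewrite expf_neq0 // alpha0.
by apply: eq_bigr => i ev; rewrite sqclassX // alpha0.
Qed.

End SingularBasis.

(** * Changes of basis *)

Section Bases.
Variables (R : fieldType) (V : lmodType R) (A : set V).

Lemma basis_inj n (v : 'I_n -> V) : is_basis A v -> injective v.
Proof.
move=> [_ vfree _] i j vij; apply/eqP; apply: contraT => ij.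
have := vfree (fun l => (l == i)%:R - (l == j)%:R).
have e (i0 : 'I_n) : \sum_l (l == i0)%:R *: v l = v i0.
  rewrite (bigD1 i0) //= eqxx scale1r big1 ?addr0 // => l /negPf ->.
  by rewrite scale0r.
under eq_bigr do rewrite scalerBl.
rewrite sumrB !e vij subrr => /(_ (erefl _) i)/eqP.
by rewrite eqxx (negPf ij) subr0 oner_eq0.
Qed.

Lemma basis_perm n (v : 'I_n -> V) (s : 'S_n) : is_basis A v -> is_basis A (fun i => v (s i)).
Proof.
move=> [vA vfree vspan]; split=> [i //|c|x /vspan[c ->]].
  rewrite (reindex_inj (@perm_inj _ s^-1)) /=.
  under eq_bigr do rewrite permKV.
  by move=> /vfree h i; rewrite -(h (s i)) permK.
exists (fun i => c (s i)); rewrite (reindex_inj (@perm_inj _ s)) /=.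
by [].
Qed.

Lemma basis_mx n (v : 'I_n -> V) (e : 'M[R]_n) : (forall c : 'I_n -> R, A (\sum_i c i *: v i)) ->
  e \in unitmx -> is_basis A v -> is_basis A (fun i => \sum_j e i j *: v j).
Proof.
move=> Asum ue [vA vfree vspan].
have sumE (c : 'rV[R]_n) :
    \sum_i c 0 i *: (\sum_j e i j *: v j) = \sum_j (c *m e) 0 j *: v j.
  under eq_bigr do rewrite scaler_sumr.
  rewrite exchange_big; apply: eq_bigr => j _ /=.
  rewrite mxE scaler_suml; apply: eq_bigr => i _; exact: scalerA.
split=> [i|c|x /vspan[c ->]]; first exact: Asum.
- have := sumE (\row_i c i); under eq_bigr do rewrite mxE.
  move=> -> /vfree h i; have : \row_i c i *m e = 0.
    by apply/rowP => j; rewrite h mxE.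
  move=> /(congr1 (mulmx^~ (invmx e))); rewrite mulmxK // mul0mx => /rowP/(_ i).
  by rewrite !mxE.
- exists (fun i => (\row_i c i *m invmx e) 0 i).
  by rewrite sumE mulmxKV //; apply: eq_bigr => i _; rewrite mxE.
Qed.

End Bases.

Lemma sign_F2 (k : nat) : (-1 : int) ^+ ((k%:R : 'F_2) : nat) = (-1) ^+ k.
Proof. by rewrite -[RHS]signr_odd -modn2 val_Fp_nat // . Qed.

Lemma singular_even (K : fieldType) (x : K) : x != 0 -> singular_classes (sqclass x) ->
  forall P : place K, (2 %| P x)%Z.
Proof.
move=> x0 [y [y0 ye]] e P.
have : sqclass (x * y) = 0 by rewrite sqclassM // e -mulr2n mod2_mulr2n.
move=> /(sqclass_eq0 (mulf_neq0 x0 y0))[z zE].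
have := congr1 P zE; rewrite placeM // placeX => h.
have -> : P x = P z *+ 2 - P y by rewrite -h addrK.
by rewrite rpredB // -(mulr_natr (P z)) dvdz_mull.
Qed.

(** * The matrix of quadratic symbols and the dual basis *)

Section SymbolMatrix.
Variables (F : finFieldType) (K : fieldExtType {fraction {poly F}}).
Hypothesis fullF : full_constant_field K.
Hypothesis two_neq0 : (2%:R : F) != 0.
Let ffK := global_function_field K.
Variables (n : nat) (b : 'I_n -> place K).
Hypothesis basis_b : is_basis [set: mod2 (Pic K)] (fun i => class2 (divclass << b i >>)).
Variable a : 'I_n -> K.
Hypothesis a0 : forall i, a i != 0.
Hypothesis basis_a : is_basis (@singular_classes K) (fun i => sqclass (a i)).

Let a_even i (P : place K) : (2 %| P (a i))%Z.
Proof. by apply: singular_even => //; have [+ _ _] := basis_a; apply. Qed.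

Let monomial (c : 'rV['F_2]_n) : K := \prod_i a i ^+ c 0 i.

Let monomial0 c : monomial c != 0.
Proof. by apply/prodf_neq0 => i _; rewrite expf_neq0. Qed.

Let monomial_even c (P : place K) : (2 %| P (monomial c))%Z.
Proof.
have [//] : monomial c != 0 /\ (2 %| P (monomial c))%Z.
rewrite /monomial; elim/big_rec: _ => [|i x _ [x0 xe]]; first by rewrite oner_neq0 place1.
have ai0 := expf_neq0 (c 0 i) (a0 i); rewrite mulf_neq0 //; split=> //.
by rewrite placeM // placeX rpredD // rpredMn.
Qed.

Let sqclass_monomial c : sqclass (monomial c) = \sum_i c 0 i *: sqclass (a i).
Proof.
rewrite sqclass_prod => [|i _]; last by rewrite expf_neq0.
by apply: eq_bigr => i _; rewrite sqclassX.
Qed.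

Lemma symbol_sign i j : symbol (b j) (a i) = 1 \/ symbol (b j) (a i) = -1.
Proof. by rewrite symbol_even //; case: asboolP; [left|right]. Qed.

Variable eps : 'M['F_2]_n.
Hypothesis epsP : forall i j, (-1) ^+ (eps i j) = symbol (b j) (a i).

Let symbol_monomial c j : symbol (b j) (monomial c) = (-1) ^+ ((c *m eps) 0 j).
Proof.
have symX x i : x != 0 -> (2 %| b j x)%Z -> symbol (b j) (x ^+ i) = symbol (b j) x ^+ i.
  move=> x0 xe; elim: i => [|i IH]; first by rewrite !expr0 symbol1.
  by rewrite !exprS (symbolM ffK two_neq0) ?IH ?expf_neq0 // placeX rpredMn.
have [_ [_ ->]] : monomial c != 0 /\ (2 %| b j (monomial c))%Z /\
    symbol (b j) (monomial c) = (-1) ^+ (\sum_i c 0%R i * eps i j)%N.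
  rewrite /monomial; elim/big_rec2: _ => [|i s x _ [x0 [xe xE]]].
    by rewrite oner_neq0 place1 symbol1.
  have ai0 := expf_neq0 (c 0 i) (a0 i).
  have aie : (2 %| b j (a i ^+ c 0%R i))%Z by rewrite placeX rpredMn.
  rewrite mulf_neq0 // placeM // rpredD //; split=> //; split=> //.
  rewrite (symbolM ffK two_neq0) // xE symX // -epsP -exprM exprD; congr (_ * _).
  by rewrite mulnC.
rewrite -sign_F2 natr_sum; congr (_ ^+ (nat_of_ord _)).
by rewrite mxE; apply: eq_bigr => i _; rewrite natrM !natr_Zp.
Qed.

(** A row vector killed by [eps] gives a product of the [a i] with all symbols 1, which is a square
    by [square_of_local_squares]; freeness of the [a i] makes the vector zero. *)
Lemma symbol_matrix_unit : eps \in unitmx.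
Proof.
rewrite -row_free_unit; apply: inj_row_free => v vE.
have [_ _ b_span] := basis_b.
have [] // := square_of_local_squares fullF two_neq0 (fun u => b_span u Logic.I)
  (monomial0 v) (monomial_even v).
  move=> i; have := symbol_monomial v i.
  rewrite vE mxE expr0 symbol_even //; case: asboolP => //.
move=> x xE; have [_ afree _] := basis_a.
have := afree (fun i => v 0 i); rewrite -sqclass_monomial => h.
apply/rowP => i; rewrite mxE; apply: h.
by apply/sqclass_eq0; [exact: monomial0|exists x].
Qed.

Let beta i := \prod_j a j ^+ (invmx eps i j).

Let betaE i : beta i = monomial (row i (invmx eps)).
Proof. by apply: eq_bigr => j _; rewrite mxE. Qed.

Lemma dual_basis : is_basis (@singular_classes K) (fun i => sqclass (beta i)).
Proof.
have -> : (fun i => sqclass (beta i)) = fun i => \sum_j invmx eps i j *: sqclass (a j).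
  apply: functional_extensionality_dep => i; rewrite betaE sqclass_monomial.
  by apply: eq_bigr => j _; rewrite mxE.
apply: basis_mx basis_a => [c|]; last by rewrite unitmx_inv symbol_matrix_unit.
have := sqclass_monomial (\row_i c i); under eq_bigr do rewrite mxE.
by move=> <-; exists (monomial (\row_i c i)).
Qed.

(** The exponents of the symbols are the entries of [invmx eps *m eps]. *)
Lemma dual_compatible : compatible b beta.
Proof.
have symE i j : symbol (b j) (beta i) = (-1) ^+ ((1%:M : 'M['F_2]_n) i j).
  by rewrite betaE symbol_monomial -row_mul mulVmx ?symbol_matrix_unit // mxE.
split=> [|i|i j /negPf ij]; first by have [] := dual_basis.
  by rewrite symE mxE eqxx.
by rewrite symE mxE ij.
Qed.

End SymbolMatrix.

(** Along a divisibility chain evenness persists, so the even orders are those from the first one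
    on. If there is none, [find] returns [m] and the range is empty. *)
Lemma find_even (m : nat) (d : 'I_m -> nat) (i : 'I_m) :
  (forall i j : 'I_m, (i <= j)%N -> (d i %| d j)%N) ->
  (find (fun i : 'I_m => ~~ odd (d i)) (enum 'I_m) <= i)%N = ~~ odd (d i).
Proof.
move=> dvd_d; set p := fun i : 'I_m => _; apply/idP/idP => [ki|pi].
  have hs : has p (enum 'I_m).
    by rewrite has_find size_enum_ord (leq_ltn_trans ki).
  have := nth_find i hs; set j := nth i _ _; rewrite /p -!dvdn2 => pj.
  apply: dvdn_trans pj (dvd_d _ _ _).
  by rewrite /j nth_enum_ord // (leq_ltn_trans ki).
rewrite leqNgt; apply/negP => /(before_find i).
by rewrite nth_ord_enum /p pi.
Qed.

Lemma basis_cast (R : nzRingType) (V : lmodType R) (A : set V) (n1 n2 : nat) (f : nat -> V) :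
  n1 = n2 -> is_basis A (fun j : 'I_n1 => f j) -> is_basis A (fun j : 'I_n2 => f j).
Proof. by move=> e; case: n2 / e. Qed.

(** * Correctness of the procedure *)

Section Algorithm.
Variables (F : finFieldType) (K : fieldExtType {fraction {poly F}}).
Hypothesis fullF : full_constant_field K.
Let ffK := global_function_field K.
Variables (n : nat) (b : 'I_n -> place K).
Hypothesis basis_b : is_basis [set: mod2 (Pic K)] (fun i => class2 (divclass << b i >>)).
Variables (m : nat) (D : 'I_m -> divisor K) (d : 'I_m -> nat).
Hypothesis sm : smith_presentation (@Pic0 F K) (fun i => divclass (D i)) d.
Variables (zeta : F) (alpha : 'I_m -> K).
Hypothesis zeta0 : zeta != 0.
Hypothesis zeta_nsq : ~ exists y : F, y ^+ 2 = zeta.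
Hypothesis alphaP : forall i, ~~ odd (d i) -> alpha i != 0 /\ RR_space (D i *+ d i) (alpha i).

Let p (i : 'I_m) := ~~ odd (d i).
Let A := constK K zeta :: [seq alpha i | i <- enum 'I_m & p i].
Let s := [seq i <- enum 'I_m | p i].

(** Two bases of [Pic / 2 Pic] are compared. The extra 1 is the class of minimal positive degree
    here, and [zeta] in the list [A]. *)
Lemma even_rank : (size s).+1 = n.
Proof.
have [dl [g [g0 dl_g g_dvd]]] := min_degree (picdegB ffK) (pic_nontrivial ffK).
have basisP := filtered_basis (A := [set: mod2 (Pic K)]) (z := class2 dl)
  (v := fun i => class2 (divclass (D i))) (p := p) Logic.I (fun _ _ => Logic.I)
  (pic_mod2_indep (picdegB ffK) (@Pic0P F K) sm g0 dl_g g_dvd)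
  (fun u _ => pic_mod2_span (picdegB ffK) (@Pic0P F K) sm dl_g g_dvd u).
by apply/eqP; rewrite eqn_leq (is_basis_leq _ basisP basis_b) ?(is_basis_leq _ basis_b basisP).
Qed.

Lemma nonzero_A x : x \in A -> x != 0.
Proof.
rewrite inE => /orP[/eqP ->|/mapP[i]]; first by rewrite fmorph_eq0.
by rewrite mem_filter => /andP[pi _] ->; have [] := alphaP pi.
Qed.

Lemma basis_A : is_basis (@singular_classes K) (fun j : 'I_n => sqclass (nth 0 A j)).
Proof.
have B := filtered_basis (A := @singular_classes K) (z := sqclass (constK K zeta))
  (v := fun i => sqclass (alpha i)) (p := p) _ _
  (singular_indep sm zeta0 zeta_nsq alphaP fullF)
  (singular_span sm zeta0 zeta_nsq alphaP fullF).
have {}B := B (singular_const K zeta0) (singular_generator sm alphaP).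
apply: (basis_cast (f := fun j => sqclass (nth 0 A j)) even_rank).
move: B; congr is_basis; apply: functional_extensionality_dep => j.
have sA : size A = (size s).+1 by rewrite /= size_map.
by rewrite -(nth_map _ 0 (@sqclass K)) ?sA // /A /= -map_comp.
Qed.

Lemma size_A : size A = n.
Proof. by rewrite -even_rank /= size_map. Qed.

Lemma uniq_A : uniq A.
Proof.
apply/(uniqP 0) => i j; rewrite !inE size_A => hi hj e.
apply: (congr1 (@nat_of_ord n) (basis_inj basis_A (x1 := Ordinal hi) (x2 := Ordinal hj) _)).
by rewrite /= e.
Qed.

Lemma basis_numbering (a : n.-tuple K) : perm_eq a A ->
  is_basis (@singular_classes K) (fun j => sqclass (tnth a j)).
Proof.
have sA : size A == n by rewrite size_A.
move=> /(tuple_permP (t := Tuple sA))[t aE].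
have -> : (fun j => sqclass (tnth a j)) = fun j => sqclass (nth 0 A (t j)).
  apply: functional_extensionality_dep => j.
  by rewrite (tnth_nth 0) aE (nth_map j) ?size_enum_ord // nth_ord_enum (tnth_nth 0).
exact: (basis_perm t basis_A).
Qed.

End Algorithm.

Theorem mainTheorem1
    (F : finFieldType) (K : fieldExtType {fraction {poly F}})
    (p : nat) (charKp : p \in [pchar K]) (odd_p : odd p)
    (fullF : full_constant_field K)
    (n : nat) (b : 'I_n -> place K)
    (basis_b : is_basis [set: mod2 (Pic K)]
                 (fun i => class2 (divclass << b i >>))) :
  [/\ (* step 1 *)
      (exists zeta : F, zeta != 0 /\ ~ (exists y : F, y ^+ 2 = zeta)),
      (* step 2 *)
      (exists (m : nat) (D : 'I_m -> divisor K) (d : 'I_m -> nat),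
        smith_presentation (@Pic0 F K) (fun i => divclass (D i)) d) &
      forall (zeta : F), zeta != 0 -> ~ (exists y : F, y ^+ 2 = zeta) ->
      forall (m : nat) (D : 'I_m -> divisor K) (d : 'I_m -> nat),
        smith_presentation (@Pic0 F K) (fun i => divclass (D i)) d ->
      (* step 3, with indices starting from 0 *)
      let k := find (fun i : 'I_m => ~~ odd (d i)) (enum 'I_m) in
      (* step 4 *)
      (forall i : 'I_m, (k <= i)%N ->
        exists alpha : K, alpha != 0 /\ RR_space (D i *+ d i) alpha) /\
      forall alpha : 'I_m -> K,
        (forall i : 'I_m, (k <= i)%N ->
          alpha i != 0 /\ RR_space (D i *+ d i) (alpha i)) ->
      let A := constK K zeta ::
                 [seq alpha i | i : 'I_m <- enum 'I_m & (k <= i)%N] in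
      [/\ size A = n, uniq A &
          (* step 5, for an arbitrary numbering of the elements of A *)
          forall a : n.-tuple K, perm_eq a A ->
          (forall i j, symbol (b j) (tnth a i) = 1
                    \/ symbol (b j) (tnth a i) = -1) /\
          forall eps : 'M['F_2]_n,
            (forall i j, (-1) ^+ (eps i j) = symbol (b j) (tnth a i)) ->
          (* steps 6 and 7 *)
          eps \in unitmx /\
          let e := invmx eps in
          let beta := fun i => \prod_j tnth a j ^+ (e i j) in
          is_basis (@singular_classes K) (fun i => sqclass (beta i)) /\
          compatible b beta]].
Proof.
have p2 : p != 2 by apply: contraTneq odd_p => ->.
have two_neq0 : (2%:R : F) != 0.
  rewrite -(fmorph_eq0 (constK K)) rmorph_nat -(dvdn_pcharf charKp).
  by rewrite (dvdn_prime2 (pcharf_prime charKp)).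
have ffK := global_function_field K.
split; first exact: finfield_ex_nonsquare.
  have [S SP] := pic_finite0 ffK.
  have [|||m [x [d sm]]] := @smith_of_finite (Pic K) (@Pic0 F K).
  - by apply/Pic0P; rewrite -(subrr (0 : Pic K)) (picdegB ffK) subrr.
  - move=> c c' /Pic0P h /Pic0P h'; apply/Pic0P.
    by rewrite (picdegB ffK) h h' subrr.
  - by exists S => c /Pic0P; exact: SP.
  have /boolp.choice[D DE] := fun i => divclass_surj (x i).
  exists m, D, d; suff <- : x = fun i => divclass (D i) by [].
  exact: functional_extensionality_dep.
move=> zeta zeta0 zeta_nsq m D d sm k; have [_ _ dvd_d] := sm.
have kE (i : 'I_m) : (k <= i)%N = ~~ odd (d i) by exact: find_even.
split=> [i _|alpha alphaP A]; first exact: (ex_RR_generator sm).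
have {}alphaP i : ~~ odd (d i) -> alpha i != 0 /\ RR_space (D i *+ d i) (alpha i).
  by rewrite -kE; exact: alphaP.
have {A}-> : A = constK K zeta :: [seq alpha i | i <- enum 'I_m & ~~ odd (d i)].
  by rewrite /A; congr (_ :: map _ _); apply: eq_filter.
split.
- exact: (size_A basis_b sm).
- exact: (uniq_A fullF basis_b sm zeta0 zeta_nsq alphaP).
move=> a aA.
have basis_a := basis_numbering fullF basis_b sm zeta0 zeta_nsq alphaP aA.
have a0 i : tnth a i != 0.
  by apply: (nonzero_A zeta0 alphaP); rewrite -(perm_mem aA) mem_tnth.
split=> [i j|eps epsP]; first exact: symbol_sign.
split; first exact: (symbol_matrix_unit fullF two_neq0 basis_b a0 basis_a epsP).
split; first exact: (dual_basis fullF two_neq0 basis_b a0 basis_a epsP).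
exact: (dual_compatible fullF two_neq0 basis_b a0 basis_a epsP).
Qed.
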